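(* Let $C$ be a coalgebra, $\mathcal B$ a right $\times_C$-Hopf coalgebra, $M$ a right-left stable anti-Yetter-Drinfeld (SAYD) module over $\mathcal B$, and $A$ a right $\mathcal B$-comodule ($C$-)ring with multiplication $\mathfrak m$ and unit map $\eta_A$. For $n\ge0$ set $\widetilde C^{\mathcal B,n}(A,M)=A^{\square_C(n+1)}\,\square_{\mathcal B}\,M$. Then the following operators define a cocyclic module structure on $\widetilde C^{\mathcal B,\bullet}(A,M)$: $$\delta_i(a_0\otimes\cdots\otimes a_n\otimes m)=a_0\otimes\cdots\otimes\eta_A(a_{i\langle\overline{-1}\rangle})\otimes a_{i\langle\overline0\rangle}\otimes\cdots\otimes a_n\otimes m\quad(0\le i\le n),$$ $$\sigma_i(a_0\otimes\cdots\otimes a_n\otimes m)=a_0\otimes\cdots\otimes\mathfrak m(a_i\otimes a_{i+1})\otimes\cdots\otimes a_n\otimes m\quad(0\le i\le n-1),$$ $$\tau_n(a_0\otimes\cdots\otimes a_n\otimes m)=a_1\otimes\cdots\otimes a_n\otimes a_{0[0]}\otimes m\triangleleft a_{0[1]},$$ the last coface $\delta_{n+1}:\widetilde C^{\mathcal B,n}(A,M)\to\widetilde C^{\mathcal B,n+1}(A,M)$ being $\tau_{n+1}\delta_0$.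
   Context: Conventions. All vector spaces, coalgebras and tensor products are over the field of complex numbers; $\Delta(x)=x^{(1)}\otimes x^{(2)}$ and $\varepsilon$ is the counit; elements of (co)tensor products are written as simple tensors, sums being understood. $C_{\rm cop}$ is the co-opposite coalgebra. For a right $C$-comodule $X$ and a left $C$-comodule $Y$, $X\square_CY\subseteq X\otimes Y$ consists of the elements $x\otimes y$ with $x_{\langle\overline0\rangle}\otimes x_{\langle\overline1\rangle}\otimes y=x\otimes y_{\langle\overline{-1}\rangle}\otimes y_{\langle\overline0\rangle}$. Overlined indices denote coactions of $C$, brackets $[\ ]$ coactions of $\mathcal B$. Right $\times_C$-Hopf coalgebra. A right bicoalgebroid $\mathcal B$ over $C$ is a coalgebra with coalgebra maps $\alpha:\mathcal B\to C$, $\beta:\mathcal B\to C_{\rm cop}$ such that $\alpha(b^{(1)})\otimes\beta(b^{(2)})=\alpha(b^{(2)})\otimes\beta(b^{(1)})$; it is a $C$-bicomodule by $b\mapsto\beta(b^{(2)})\otimes b^{(1)}$ and $b\mapsto b^{(1)}\otimes\alpha(b^{(2)})$; and there are $C$-bicomodule maps $\mu:\mathcal B\square_C\mathcal B\to\mathcal B$, $b\otimes b'\mapsto bb'$ (associative) and $\eta:C\to\mathcal B$ with, for $b\otimes b'\in\mathcal B\square_C\mathcal B$, $c\in C$: (1) $bb'^{(2)}\otimes\beta(b'^{(1)})=b^{(2)}b'\otimes\alpha(b^{(1)})$; (2) $\Delta(bb')=b^{(1)}b'^{(1)}\otimes b^{(2)}b'^{(2)}$; (3) $\varepsilon(bb')=\varepsilon(b)\varepsilon(b')$;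 (4) $b^{(1)}\eta(\alpha(b^{(2)}))=b=\eta(\beta(b^{(2)}))b^{(1)}$; (5) $\Delta(\eta(c))=\eta(\alpha(\eta(c)^{(1)}))\otimes\eta(c)^{(2)}=\eta(\beta(\eta(c)^{(1)}))\otimes\eta(c)^{(2)}$; (6) $\varepsilon(\eta(c))=\varepsilon(c)$. It is a right $\times_C$-Hopf coalgebra if $\nu:\mathcal B\square_C\mathcal B\to\mathcal B\square_{C_{\rm cop}}\mathcal B$, $b\otimes b'\mapsto b^{(1)}\otimes b^{(2)}b'$, is bijective, the codomain being formed with the coactions $b\mapsto b^{(1)}\otimes\beta(b^{(2)})$ and $b\mapsto\beta(b^{(1)})\otimes b^{(2)}$. Write $\nu^{-1}(b\otimes b')=\nu^-(b,b')\otimes\nu^+(b,b')$. SAYD modules. A right $\mathcal B$-module $M$ is a right $C$-comodule with an associative and unital action $\triangleleft:M\square_C\mathcal B\to M$ (unital: $m_{\langle\overline0\rangle}\triangleleft\eta(m_{\langle\overline1\rangle})=m$) that is a right $C$-comodule map for $m\otimes b\mapsto m\otimes b^{(1)}\otimes\alpha(b^{(2)})$; it has the canonical left coaction $m\mapsto\alpha(\eta(m_{\langle\overline1\rangle})^{(1)})\otimes m_{\langle\overline0\rangle}\triangleleft\eta(m_{\langle\overline1\rangle})^{(2)}$. A left $\mathcal B$-comodule $M$ is a left comodule $m\mapsto m_{[-1]}\otimes m_{[0]}$ over the coalgebra $\mathcal B$; it has an induced left coaction $m\mapsto\beta(m_{[-1]})\otimes m_{[0]}$. A right-left anti-Yetter-Drinfeld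 module is a right $\mathcal B$-module and left $\mathcal B$-comodule $M$ such that (i) the induced left coaction coincides with the canonical one, and (ii) for all $b\otimes m\in\mathcal B\square_{C_{\rm cop}}M$ (formed with $b^{(1)}\otimes\beta(b^{(2)})$ and $\beta(m_{[-1]})\otimes m_{[0]}$), $(m\triangleleft b)_{[-1]}\otimes(m\triangleleft b)_{[0]}=\nu^+(b^{(2)},m_{[-1]})b^{(1)}\otimes m_{[0]}\triangleleft\nu^-(b^{(2)},m_{[-1]})$. It is stable (SAYD) if $m_{[0]}\triangleleft m_{[-1]}=m$. Comodule rings. A $C$-ring $A$ is a $C$-bicomodule with $C$-bicolinear maps $\mathfrak m:A\square_CA\to A$ (associative) and $\eta_A:C\to A$ satisfying $\mathfrak m(a_{\langle\overline0\rangle}\otimes\eta_A(a_{\langle\overline1\rangle}))=a=\mathfrak m(\eta_A(a_{\langle\overline{-1}\rangle})\otimes a_{\langle\overline0\rangle})$. A right $\mathcal B$-comodule ring $A$ is a $C$-ring that is a right $\mathcal B$-comodule $a\mapsto a_{[0]}\otimes a_{[1]}$ with $\eta_A(c)_{[0]}\otimes\eta_A(c)_{[1]}=\eta_A(\alpha(\eta(c)^{(1)}))\otimes\eta(c)^{(2)}$ and $\mathfrak m(a_1\otimes a_2)_{[0]}\otimes\mathfrak m(a_1\otimes a_2)_{[1]}=\mathfrak m(a_{1[0]}\otimes a_{2[0]})\otimes a_{1[1]}a_{2[1]}$; its $C$-bicomodule structure is the one induced by the $\mathcal B$-coaction, $a\mapsto\beta(a_{[1]})\otimes a_{[0]}$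 and $a\mapsto a_{[0]}\otimes\alpha(a_{[1]})$. The right $\mathcal B$-coaction on $A^{\square_C(n+1)}$ is $a_0\otimes\cdots\otimes a_n\mapsto a_{0[0]}\otimes\cdots\otimes a_{n[0]}\otimes a_{0[1]}\cdots a_{n[1]}$. *)

(* Defs.v *)
From HB Require Import structures.
From mathcomp Require Import all_boot all_order all_algebra.
From mathcomp Require Import boolp classical_sets functions.

Set Implicit Arguments.
Unset Strict Implicit.
Unset Printing Implicit Defensive.

Import GRing.Theory.
Local Open Scope ring_scope.

Section Subspaces.
Variable K : fieldType.
Implicit Types V W Z : lmodType K.

Record linsub V := LinSub {
  lset :> V -> Prop;
  lset0 : lset 0;
  lsetP : forall a u v, lset u -> lset v -> lset (a *: u + v) }.

Definition lmem V (U : linsub V) : V -> bool := fun x => `[< U x >].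

Lemma lmem_closed V (U : linsub V) : submod_closed (lmem U).
Proof.
split=> [|a u v]; first by apply/asboolP; exact: lset0.
rewrite /in_mem /= => /asboolP Uu /asboolP Uv; apply/asboolP.
exact: lsetP.
Qed.

HB.instance Definition _ V (U : linsub V) :=
  GRing.isSubmodClosed.Build K V (lmem U) (lmem_closed U).

Definition lsub V (U : linsub V) := {x : V | lmem U x}.

HB.instance Definition _ V (U : linsub V) := SubType.on (lsub U).
HB.instance Definition _ V (U : linsub V) := [Choice of lsub U by <:].
HB.instance Definition _ V (U : linsub V) :=
  [SubChoice_isSubLmodule of lsub U by <:].

Lemma lsubP V (U : linsub V) (u : lsub U) : U (val u).
Proof. exact: (asboolW (valP u)). Qed.

Program Definition lfull V : linsub V := @LinSub V (fun=> True) _ _.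

Definition lgraph V W (G : set (V * W)) :=
  (forall a p q, G p -> G q -> G (a *: p + q)) /\
  (forall w, G (0, w) -> w = 0).

Lemma graph_extend V W (G0 : set (V * W)) : (G0 !=set0)%classic -> lgraph G0 ->
  exists g : {linear V -> W}, forall p, G0 p -> g p.1 = p.2.
Proof.
move=> [p0 Gp0] [G0l G0f].
pose P (G : set (V * W)) := lgraph (G `|` G0)%classic.
have [A [PA maxA]] : exists A, P A /\ forall B, (A `<` B)%classic -> ~ P B.
  apply: Zorn_bigcup => F FP Ftot; split.
  - have key p q : (\bigcup_(X in F) X `|` G0)%classic p ->
        (\bigcup_(X in F) X `|` G0)%classic q ->
        (G0 p /\ G0 q) \/ exists2 X, F X & (X `|` G0)%classic p /\ (X `|` G0)%classic q.
      move=> [[X FX Xp]|Gp] [[Y FY Yq]|Gq].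
      + case: (Ftot X Y FX FY) => s; right.
          by exists Y => //; split; left => //; exact: s.
        by exists X => //; split; left => //; exact: s.
      + by right; exists X => //; split; [left|right].
      + by right; exists Y => //; split; [right|left].
      + by left.
    move=> a p q hp hq; case: (key p q hp hq) => [[Gp Gq]|[X FX [Xp Xq]]].
      by right; exact: G0l.
    by case: ((FP X FX).1 a _ _ Xp Xq) => ?; [left; exists X|right].
  - move=> w [[X FX Xw]|Gw]; last exact: G0f.
    by apply: (FP X FX).2; left.
pose G := (A `|` G0)%classic.
have [Gl Gf] : lgraph G by exact: PA.
have G00 : G (0, 0).
  have := Gl (-1) p0 p0 (or_intror Gp0) (or_intror Gp0).
  by rewrite scaleN1r addNr.
have tot v : exists w, G (v, w).
  apply/not_existsP => nv.
  pose B : set (V * W) := fun r => exists a p, G p /\ r = (a *: v + p.1, p.2).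
  have GB : (G `<=` B)%classic.
    by move=> [x y] Gxy; exists 0, (x, y); rewrite scale0r add0r.
  have Bv : B (v, 0) by exists 1, (0, 0); rewrite scale1r addr0.
  apply: (maxA B).
    split; first by move=> p Ap; apply: GB; left.
    by move=> BA; apply: (nv 0); left; exact: BA.
  have -> : P B = lgraph B.
    by rewrite /P; congr lgraph; apply: setUidl => p Gp; apply: GB; right.
  split.
  - move=> c _ _ [a [p [Gp ->]]] [b [q [Gq ->]]].
    exists (c * a + b), (c *: p + q); split; first exact: Gl.
    congr pair => /=.
    by rewrite scalerDl scalerDr scalerA addrACA.
  - move=> w [a [[x y] [Gp []]]] /= e ->.
    have [a0|a0] := eqVneq a 0.
      move: e; rewrite a0 scale0r add0r => e; apply: Gf; by rewrite e.
    exfalso; apply: (nv (- a^-1 *: y)).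
    have := Gl (- a^-1) _ _ Gp G00; congr G; rewrite [LHS]surjective_pairing /=.
    rewrite !addr0; congr pair.
    have -> : x = - (a *: v) by apply/eqP; rewrite -addr_eq0 addrC -e.
    by rewrite scalerN scaleNr opprK scalerA mulVf // scale1r.
pose g v := sval (cid (tot v)).
have gG v : G (v, g v) by rewrite /g; case: cid.
have uniqG v w : G (v, w) -> g v = w.
  move=> h; apply/eqP; rewrite -subr_eq0; apply/eqP; apply: Gf.
  have := Gl (-1) _ _ h (gG v); congr G; rewrite scaleN1r.
  by rewrite [LHS]surjective_pairing /= addNr addrC.
have glin : linear g by move=> a u v; apply: uniqG; exact: (Gl a _ _ (gG u) (gG v)).
pose gm := GRing.isLinear.Build _ _ _ _ g glin.
pose gL : {linear V -> W} := HB.pack g gm.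
by exists gL => -[x y] Gp; apply: uniqG; right.
Qed.

Lemma lin_extend V (U : linsub V) W (f : {linear lsub U -> W}) :
  exists g : {linear V -> W}, forall u : lsub U, g (val u) = f u.
Proof.
pose G0 : set (V * W) := fun p => exists u : lsub U, p = (val u, f u).
have G00 : (G0 !=set0)%classic by exists (0, 0), 0; rewrite !raddf0.
have [|g gP] := @graph_extend V W G0 G00.
  split=> [a _ _ [u ->] [v ->]|w [u [e ->]]].
    by exists (a *: u + v); rewrite !linearP.
  by rewrite -(raddf0 f); congr (f _); apply: val_inj; rewrite [RHS]raddf0; exact: esym.
by exists g => u; rewrite (gP (val u, f u)) //; exists u.
Qed.

(* A linear map defined on a subspace, extended to the whole space.  The values
   outside the subspace are arbitrary. *)
Definition lext V (U : linsub V) W (f : {linear lsub U -> W}) :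
  {linear V -> W} := sval (cid (lin_extend f)).

Lemma lextE V (U : linsub V) W (f : {linear lsub U -> W}) (u : lsub U) :
  lext f (val u) = f u.
Proof. by rewrite /lext; case: cid. Qed.

End Subspaces.

Section Tensor.
Variable K : fieldType.
Implicit Types V W Y Z : lmodType K.

Definition bilin V W Z (f : V -> W -> Z) :=
  (forall w, linear (f^~ w)) /\ (forall v, linear (f v)).

Lemma bilinZl V W Z (f : V -> W -> Z) a v w :
  bilin f -> f (a *: v) w = a *: f v w.
Proof.
move=> fb; have f0 := fb.1 w (-1) 0 0; have := fb.1 w a v 0.
by rewrite !addr0 scaleN1r oppr0 scaleN1r addNr in f0 * => ->; rewrite f0 addr0.
Qed.

Definition bilform V W := {b : V -> W -> K^o | bilin b}.

Definition ev V W (v : V) (w : W) : bilform V W -> K^o := fun b => sval b v w.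

(* Finite sums of evaluations at pairs (v, w).  This realizes the tensor product
   inside the space of functions on bilinear forms; [pure_bilin], [tensP],
   [sw_pure] and [sw_linear] below are the universal property. *)
Definition ev_span V W (x : bilform V W -> K^o) : Prop :=
  exists s : seq (V * W), x = \sum_(p <- s) ev p.1 p.2.

Lemma ev_span0 V W : ev_span (0 : bilform V W -> K^o).
Proof. by exists [::]; rewrite big_nil. Qed.

Lemma ev_spanP V W a (x y : bilform V W -> K^o) :
  ev_span x -> ev_span y -> ev_span (a *: x + y).
Proof.
move=> [s ->] [t ->]; exists ([seq (a *: p.1, p.2) | p <- s] ++ t).
rewrite big_cat big_map /= scaler_sumr; congr (_ + _); apply: eq_bigr => p _.
by apply/funext => -[b bb]; symmetry; exact: (bilinZl a p.1 p.2 bb).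
Qed.

Definition tens V W : lmodType K :=
  lsub (@LinSub K (bilform V W -> K^o) (@ev_span V W) (@ev_span0 V W)
                (@ev_spanP V W)).

Lemma pure_subproof V W (v : V) (w : W) :
  lmem (@LinSub K (bilform V W -> K^o) (@ev_span V W) (@ev_span0 V W)
                (@ev_spanP V W)) (ev v w).
Proof. by apply/asboolP; exists [:: (v, w)]; rewrite big_seq1. Qed.

Definition pure V W (v : V) (w : W) : tens V W :=
  exist _ (ev v w) (pure_subproof v w).

Lemma pure_bilin V W : bilin (@pure V W).
Proof.
split=> [w|v] a x y; apply: val_inj; apply/funext => -[b [bl br]];
by rewrite /= ?(bl w) ?(br v).
Qed.

Lemma tensP V W (z : tens V W) :
  exists s : seq (V * W), z = \sum_(p <- s) pure p.1 p.2.
Proof.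
have [s zs] := lsubP z; exists s; apply: val_inj.
by rewrite [LHS]zs raddf_sum.
Qed.

(* sw z f is f(x, y) for z = x (x) y, summation understood; it does not depend
   on the chosen expansion of z as soon as f is bilinear. *)
Definition sw V W Z (z : tens V W) (f : V -> W -> Z) : Z :=
  \sum_(p <- sval (cid (tensP z))) f p.1 p.2.

Lemma separate Z (z : Z) :
  (forall phi : {linear Z -> K^o}, phi z = 0) -> z = 0.
Proof.
move=> h; apply/eqP; apply/negPn/negP => z0.
pose G0 : set (Z * K^o) := fun p => exists a : K, p = (a *: z, a).
have [||g gP] := @graph_extend K Z K^o G0.
- by exists (0 *: z, 0); exists 0.
- split=> [a _ _ [b ->] [c ->]|w [b [/esym/eqP e ->]]].
    by exists (a * b + c); rewrite [LHS]surjective_pairing /= scalerA -scalerDl.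
  by move: e; rewrite scaler_eq0 (negPf z0) orbF => /eqP.
have /= := gP (z, 1) _; rewrite h => e.
have : (1 : K) = 0 by rewrite -e //; exists 1; rewrite scale1r.
by move/eqP; rewrite oner_eq0.
Qed.

Lemma sw_sum V W Z (f : V -> W -> Z) (s : seq (V * W)) : bilin f ->
  sw (\sum_(p <- s) pure p.1 p.2) f = \sum_(p <- s) f p.1 p.2.
Proof.
move=> [fl fr]; rewrite /sw; case: cid => t /= e.
apply/eqP; rewrite -subr_eq0; apply/eqP/separate => phi.
have bP : bilin (fun v w => phi (f v w) : K^o).
  by split=> [w|v] a x y; rewrite ?fl ?fr linearP.
have {}e := congr1 (fun z : tens V W => val z (exist _ _ bP)) e.
have valE r : val (\sum_(p <- r) pure p.1 p.2 : tens V W) (exist _ _ bP)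
    = \sum_(p <- r) phi (f p.1 p.2).
  elim: r => [|p r IH]; first by rewrite !big_nil.
  by rewrite !big_cons -IH.
rewrite !valE in e.
by rewrite raddfB /= (raddf_sum phi) (raddf_sum phi) -e subrr.
Qed.

Lemma sw_pure V W Z (f : V -> W -> Z) v w : bilin f ->
  sw (pure v w) f = f v w.
Proof. by move=> /(sw_sum [:: (v, w)]); rewrite !big_seq1. Qed.

Lemma sw_linear V W Z (f : V -> W -> Z) : bilin f ->
  linear (fun z : tens V W => sw z f).
Proof.
move=> fb a x y; have [s ->] := tensP x; have [t ->] := tensP y.
have -> : a *: (\sum_(p <- s) pure p.1 p.2) + \sum_(p <- t) pure p.1 p.2
    = \sum_(p <- [seq (a *: p.1, p.2) | p <- s] ++ t) pure p.1 p.2 :> tens V W.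
  rewrite big_cat big_map /= scaler_sumr; congr (_ + _); apply: eq_bigr => p _.
  by rewrite (bilinZl _ _ _ (pure_bilin V W)).
rewrite !sw_sum // big_cat big_map /= scaler_sumr; congr (_ + _).
by apply: eq_bigr => p _; rewrite /= (bilinZl _ _ _ fb).
Qed.

Lemma linear_sw V W Z Y (r : Y -> tens V W) (f : V -> W -> Z) :
  linear r -> bilin f -> linear (fun y => sw (r y) f).
Proof. by move=> rl fb a x y; rewrite rl (sw_linear fb). Qed.

Lemma linear_swr V W Z Y (z : tens V W) (f : Y -> V -> W -> Z) :
  (forall v w, linear (fun y => f y v w)) -> linear (fun y => sw z (f y)).
Proof.
move=> fl a x y; rewrite /sw scaler_sumr -big_split.
by apply: eq_bigr => p _; exact: fl.
Qed.

Lemma linear_pure V W Y (f : Y -> V) (w : W) :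
  linear f -> linear (fun y => pure (f y) w).
Proof. by move=> fl a x y; rewrite fl ((pure_bilin V W).1 w). Qed.

Lemma linear_purer V W Y (f : Y -> W) (v : V) :
  linear f -> linear (fun y => pure v (f y)).
Proof. by move=> fl a x y; rewrite fl ((pure_bilin V W).2 v). Qed.

Lemma linear_app V W Y (g : {linear V -> W}) (f : Y -> V) :
  linear f -> linear (fun y => g (f y)).
Proof. by move=> fl a x y; rewrite fl linearP. Qed.

Lemma linear_id V : linear (fun v : V => v). Proof. by []. Qed.

End Tensor.

Ltac linear_tac :=
  lazymatch goal with
  | |- bilin _ => split => ?; linear_tac
  | |- forall v w, linear _ => move=> ? ?; linear_tac
  | _ => first
    [ exact: linear_id
    | apply: linear_pure; linear_tac
    | apply: linear_purer; linear_tac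
    | apply: linear_swr; linear_tac
    | apply: linear_sw; linear_tac
    | apply: linear_app; linear_tac ]
  end.

Notation "x \ot y" := (pure x y)
  (at level 38, right associativity) : ring_scope.
Notation "\sw_ ( x , y <- z ) E" := (sw z (fun x y => E))
  (at level 69, x name, y name, E at level 69,
   format "'[' \sw_ ( x ,  y  <-  z ) '/  '  E ']'") : ring_scope.


Section Coactions.
Variable K : fieldType.
Implicit Types D E X Y Z : lmodType K.

(* x |-> x_0 (x) h(x_1), x |-> h(x_1) (x) x_0 and x |-> h(x_{-1}) (x) x_0. *)
Definition push_r X D E (r : {linear X -> tens X D}) (h : {linear D -> E})
  (x : X) : tens X E := \sw_(x0, x1 <- r x) x0 \ot h x1.

Definition push_flip X D E (r : {linear X -> tens X D}) (h : {linear D -> E})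
  (x : X) : tens E X := \sw_(x0, x1 <- r x) h x1 \ot x0.

Definition push_l X D E (l : {linear X -> tens D X}) (h : {linear D -> E})
  (x : X) : tens E X := \sw_(x_1, x0 <- l x) h x_1 \ot x0.

Definition flip X Y (z : tens X Y) : tens Y X := \sw_(x, y <- z) y \ot x.

Definition lcoact1 X Y D (l : {linear X -> tens D X}) (t : tens X Y) :
  tens D (tens X Y) := \sw_(x, y <- t) \sw_(d, x0 <- l x) d \ot x0 \ot y.

Lemma push_r_linear X D E r h : linear (@push_r X D E r h).
Proof. rewrite /push_r; linear_tac. Qed.
HB.instance Definition _ X D E r h :=
  GRing.isLinear.Build K _ _ _ (@push_r X D E r h) (push_r_linear r h).

Lemma push_flip_linear X D E r h : linear (@push_flip X D E r h).
Proof. rewrite /push_flip; linear_tac. Qed.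
HB.instance Definition _ X D E r h :=
  GRing.isLinear.Build K _ _ _ (@push_flip X D E r h) (push_flip_linear r h).

Lemma push_l_linear X D E l h : linear (@push_l X D E l h).
Proof. rewrite /push_l; linear_tac. Qed.
HB.instance Definition _ X D E l h :=
  GRing.isLinear.Build K _ _ _ (@push_l X D E l h) (push_l_linear l h).

Lemma flip_linear X Y : linear (@flip X Y).
Proof. rewrite /flip; linear_tac. Qed.
HB.instance Definition _ X Y :=
  GRing.isLinear.Build K _ _ _ (@flip X Y) (@flip_linear X Y).

Lemma lcoact1_linear X Y D l : linear (@lcoact1 X Y D l).
Proof. rewrite /lcoact1; linear_tac. Qed.
HB.instance Definition _ X Y D l :=
  GRing.isLinear.Build K _ _ _ (@lcoact1 X Y D l) (@lcoact1_linear X Y D l).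

Section Cotensor.
Variables (X Y D : lmodType K) (U : linsub X) (V : linsub Y).
Variables (r : {linear X -> tens X D}) (l : {linear Y -> tens D Y}).

Definition cot_right (z : tens X Y) : tens X (tens D Y) :=
  \sw_(x, y <- z) \sw_(x0, x1 <- r x) x0 \ot x1 \ot y.
Definition cot_left (z : tens X Y) : tens X (tens D Y) :=
  \sw_(x, y <- z) \sw_(y_1, y0 <- l y) x \ot y_1 \ot y0.

(* U [] V inside X (x) Y for subspaces U of X and V of Y: the finite sums of
   u (x) v with u in U and v in V on which the two coactions agree. *)
Definition in_cotensor (z : tens X Y) : Prop :=
  (exists s : seq (lsub U * lsub V),
     z = \sum_(p <- s) val p.1 \ot val p.2) /\
  cot_right z = cot_left z.

Lemma cot_right_linear : linear cot_right.
Proof. rewrite /cot_right; linear_tac. Qed.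

Lemma cot_left_linear : linear cot_left.
Proof. rewrite /cot_left; linear_tac. Qed.

Lemma in_cotensor0 : in_cotensor 0.
Proof.
split; first by exists [::]; rewrite big_nil.
have e (f : tens X Y -> tens X (tens D Y)) : linear f -> f 0 = 0.
  by move=> fl; have := fl (-1) 0 0; rewrite !scaleN1r !addNr.
by rewrite (e _ cot_right_linear) (e _ cot_left_linear).
Qed.

Lemma in_cotensorP a u v :
  in_cotensor u -> in_cotensor v -> in_cotensor (a *: u + v).
Proof.
move=> [[s us] u2] [[t vt] v2]; split; last first.
  by rewrite cot_right_linear cot_left_linear u2 v2.
exists ([seq (a *: p.1, p.2) | p <- s] ++ t).
rewrite us vt big_cat big_map /= scaler_sumr; congr (_ + _).
by apply: eq_bigr => p _; rewrite (bilinZl _ _ _ (pure_bilin X Y)).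
Qed.

Definition cotensor : linsub (tens X Y) := LinSub in_cotensor0 in_cotensorP.

End Cotensor.

(* f (x (x) y) for f defined on a subspace P of X (x) Y.  A simple tensor need
   not lie in P: papp occurs inside sw, summed over an element of (a tensor
   product with) P, and the result then does not depend on the values of
   lext f outside P. *)
Definition papp X Y Z (P : linsub (tens X Y)) (f : {linear lsub P -> Z})
  (x : X) (y : Y) : Z := lext f (x \ot y).

Lemma papp_linearl X Y Z P f y : linear ((@papp X Y Z P f)^~ y).
Proof. rewrite /papp; linear_tac. Qed.
Lemma papp_linearr X Y Z P f x : linear (@papp X Y Z P f x).
Proof. rewrite /papp; linear_tac. Qed.

End Coactions.

Arguments in_cotensor0 {_ _ _ _}.
Arguments in_cotensorP {_ _ _ _}.

Section Coalgebras.
Variable K : fieldType.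
Implicit Types X : lmodType K.

Record coalgebra := Coalgebra {
  csort :> lmodType K;
  cDelta : {linear csort -> tens csort csort};
  ceps : {scalar csort};
  cDeltaA : forall x,
    \sw_(x1, x2 <- cDelta x) \sw_(x11, x12 <- cDelta x1) x11 \ot x12 \ot x2 =
    \sw_(x1, x2 <- cDelta x) \sw_(x21, x22 <- cDelta x2) x1 \ot x21 \ot x22;
  cepsl : forall x, \sw_(x1, x2 <- cDelta x) ceps x1 *: x2 = x;
  cepsr : forall x, \sw_(x1, x2 <- cDelta x) ceps x2 *: x1 = x }.

Arguments cDelta {_}.
Arguments ceps {_}.

Implicit Types C D : coalgebra.

Definition right_coaction D X (r : X -> tens X D) : Prop :=
  (forall x,
    \sw_(x0, x1 <- r x) \sw_(x00, x01 <- r x0) x00 \ot x01 \ot x1 =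
    \sw_(x0, x1 <- r x) \sw_(d1, d2 <- cDelta x1) x0 \ot d1 \ot d2) /\
  (forall x, \sw_(x0, x1 <- r x) ceps x1 *: x0 = x).

Definition left_coaction D X (l : X -> tens D X) : Prop :=
  (forall x,
    \sw_(x_1, x0 <- l x) \sw_(d1, d2 <- cDelta x_1) d1 \ot d2 \ot x0 =
    \sw_(x_1, x0 <- l x) \sw_(y_1, y0 <- l x0) x_1 \ot y_1 \ot y0) /\
  (forall x, \sw_(x_1, x0 <- l x) ceps x_1 *: x0 = x).

Definition coactions_commute C D X (l : X -> tens C X) (r : X -> tens X D) :=
  forall x, \sw_(x0, d <- r x) \sw_(c, x00 <- l x0) c \ot x00 \ot d =
            \sw_(c, x0 <- l x) \sw_(x00, d <- r x0) c \ot x00 \ot d.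

Definition coalgebra_map C D (f : C -> D) : Prop :=
  (forall c, cDelta (f c) = \sw_(c1, c2 <- cDelta c) f c1 \ot f c2) /\
  (forall c, ceps (f c) = ceps c).

(* f : C -> D_cop *)
Definition coalgebra_antimap C D (f : C -> D) : Prop :=
  (forall c, cDelta (f c) = \sw_(c1, c2 <- cDelta c) f c2 \ot f c1) /\
  (forall c, ceps (f c) = ceps c).

End Coalgebras.

Arguments cDelta {_ _}.
Arguments ceps {_ _}.

Section Bicoalgebroids.
Variables (K : fieldType) (C : coalgebra K).

Record precoalgebroid := Precoalgebroid {
  pcg :> coalgebra K;
  alpha : {linear pcg -> C};
  beta : {linear pcg -> C};
  alphaP : coalgebra_map alpha;
  betaP : coalgebra_antimap beta;
  alpha_beta : forall b,
    \sw_(b1, b2 <- cDelta b) alpha b1 \ot beta b2 =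
    \sw_(b1, b2 <- cDelta b) alpha b2 \ot beta b1 }.

Arguments alpha {_}.
Arguments beta {_}.

(* The C-coactions of B: b |-> b1 (x) alpha(b2), b |-> beta(b2) (x) b1, and
   those used over C_cop: b |-> b1 (x) beta(b2), b |-> beta(b1) (x) b2. *)
Definition rC (B : precoalgebroid) : {linear B -> tens B C} :=
  push_r (@cDelta K B) alpha.
Definition lC (B : precoalgebroid) : {linear B -> tens C B} :=
  push_flip (@cDelta K B) beta.
Definition rCcop (B : precoalgebroid) : {linear B -> tens B C} :=
  push_r (@cDelta K B) beta.
Definition lCcop (B : precoalgebroid) : {linear B -> tens C B} :=
  push_l (@cDelta K B) beta.

Arguments rC {_}.
Arguments lC {_}.
Arguments rCcop {_}.
Arguments lCcop {_}.

Definition BB (B : precoalgebroid) : linsub (tens B B) :=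
  cotensor (lfull B) (lfull B) rC lC.
Definition BBcop (B : precoalgebroid) : linsub (tens B B) :=
  cotensor (lfull B) (lfull B) rCcop lCcop.
Definition BBB (B : precoalgebroid) : linsub (tens B (tens B B)) :=
  cotensor (lfull B) (BB B) rC (lcoact1 lC).

Record bicoalgebroid := Bicoalgebroid {
  bcg :> precoalgebroid;
  mu : {linear lsub (BB bcg) -> bcg};
  eta : {linear C -> bcg};
  mu_colinl : forall x : lsub (BB bcg),
    lC (mu x) = \sw_(b, b' <- val x) \sw_(c, b0 <- lC b) c \ot papp mu b0 b';
  mu_colinr : forall x : lsub (BB bcg),
    rC (mu x) = \sw_(b, b' <- val x) \sw_(b0, c <- rC b') papp mu b b0 \ot c;
  muA : forall x, BBB bcg x ->
    \sw_(b, y <- x) \sw_(b', b'' <- y) papp mu (papp mu b b') b'' =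
    \sw_(b, y <- x) \sw_(b', b'' <- y) papp mu b (papp mu b' b'');
  eta_colinl : forall c,
    lC (eta c) = \sw_(c1, c2 <- cDelta c) c1 \ot eta c2;
  eta_colinr : forall c,
    rC (eta c) = \sw_(c1, c2 <- cDelta c) eta c1 \ot c2;
  mu_alpha_beta : forall x : lsub (BB bcg),
    \sw_(b, b' <- val x) \sw_(b'1, b'2 <- cDelta b')
      papp mu b b'2 \ot beta b'1 =
    \sw_(b, b' <- val x) \sw_(b1, b2 <- cDelta b)
      papp mu b2 b' \ot alpha b1;
  mu_Delta : forall x : lsub (BB bcg),
    cDelta (mu x) =
    \sw_(b, b' <- val x) \sw_(b1, b2 <- cDelta b) \sw_(b'1, b'2 <- cDelta b')
      papp mu b1 b'1 \ot papp mu b2 b'2;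
  mu_eps : forall x : lsub (BB bcg),
    ceps (mu x) = \sw_(b, b' <- val x) (ceps b * ceps b' : K^o);
  mu_etar : forall b,
    \sw_(b1, b2 <- cDelta b) papp mu b1 (eta (alpha b2)) = b;
  mu_etal : forall b,
    \sw_(b1, b2 <- cDelta b) papp mu (eta (beta b2)) b1 = b;
  eta_Delta_alpha : forall c,
    cDelta (eta c) = \sw_(h1, h2 <- cDelta (eta c)) eta (alpha h1) \ot h2;
  eta_Delta_beta : forall c,
    cDelta (eta c) = \sw_(h1, h2 <- cDelta (eta c)) eta (beta h1) \ot h2;
  eta_eps : forall c, ceps (eta c) = ceps c }.

Arguments mu {_}.
Arguments eta {_}.

Definition nu (B : bicoalgebroid) (x : tens B B) : tens B B :=
  \sw_(b, b' <- x) \sw_(b1, b2 <- cDelta b) b1 \ot papp mu b2 b'.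

Record hopf_coalgebra := HopfCoalgebra {
  hcg :> bicoalgebroid;
  nu_bij : set_bij (BB hcg) (BBcop hcg) (@nu hcg) }.

End Bicoalgebroids.

Arguments alpha {_ _ _}.
Arguments beta {_ _ _}.
Arguments rC {_ _ _}.
Arguments lC {_ _ _}.
Arguments rCcop {_ _ _}.
Arguments lCcop {_ _ _}.
Arguments mu {_ _ _}.
Arguments eta {_ _ _}.


Section HopfCoalgebras.
Variables (K : fieldType) (C : coalgebra K) (B : hopf_coalgebra C).

Lemma nu_linear : linear (@nu K C B).
Proof. rewrite /nu /papp; linear_tac. Qed.

Lemma nuinv_ex : exists g : {linear tens B B -> tens B B},
  forall x, BB B x -> g (nu x) = x.
Proof.
have nu0 : nu 0 = 0 :> tens B B.
  by have := nu_linear (-1) 0 0; rewrite !scaleN1r !addNr.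
pose G0 : set (tens B B * tens B B) :=
  fun p => exists x, BB B x /\ p = (nu x, x).
have [||g gP] := @graph_extend K _ _ G0.
- by exists (nu 0, 0), 0; split=> //; exact: lset0.
- split=> [a _ _ [x [Bx ->]] [y [By ->]]|w [x [Bx [e ->]]]].
    by exists (a *: x + y); split; [exact: lsetP | rewrite nu_linear].
  have [_ inj _] := nu_bij B.
  by apply: inj; rewrite ?inE ?nu0 //; exact: lset0.
by exists g => x Bx; rewrite (gP (nu x, x)) //; exists x.
Qed.

(* A linear map whose restriction to BBcop is the inverse of nu; the letters
   nu^-(b, b') (x) nu^+(b, b') denote the components of nuinv (b (x) b'). *)
Definition nuinv : {linear tens B B -> tens B B} := sval (cid nuinv_ex).

Lemma nuinvK x : BB B x -> nuinv (nu x) = x.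
Proof. by rewrite /nuinv; case: cid => g gP; exact: gP. Qed.

Lemma nuinv_BB y : BBcop B y -> BB B (nuinv y) /\ nu (nuinv y) = y.
Proof.
have [_ _ surj] := nu_bij B.
by move=> By; have [x Bx <-] := surj y By; rewrite nuinvK.
Qed.

Record rmodule := RModule {
  rm_sort :> lmodType K;
  rm_coact : {linear rm_sort -> tens rm_sort C};
  rm_act : {linear lsub (cotensor (lfull rm_sort) (lfull B) rm_coact lC)
            -> rm_sort};
  rm_coactP : right_coaction rm_coact;
  rm_actA : forall x : tens rm_sort (tens B B),
    cotensor (lfull rm_sort) (BB B) rm_coact (lcoact1 lC) x ->
    \sw_(m, y <- x) \sw_(b, b' <- y) papp rm_act (papp rm_act m b) b' =
    \sw_(m, y <- x) \sw_(b, b' <- y) papp rm_act m (papp mu b b');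
  rm_act1 : forall m, \sw_(m0, c <- rm_coact m) papp rm_act m0 (eta c) = m;
  rm_act_colin : forall x,
    rm_coact (rm_act x) =
    \sw_(m, b <- val x) \sw_(b0, c <- rC b) papp rm_act m b0 \ot c }.

Arguments rm_coact {_}.
Arguments rm_act {_}.

Definition MB (M : rmodule) : linsub (tens M B) :=
  cotensor (lfull M) (lfull B) rm_coact lC.

Definition rm_lcoact (M : rmodule) (m : M) : tens C M :=
  \sw_(m0, c <- rm_coact m) \sw_(h1, h2 <- cDelta (eta c))
    alpha h1 \ot papp rm_act m0 h2.

Record rlmodule := RLModule {
  rl_mod :> rmodule;
  lam : {linear rl_mod -> tens B rl_mod};
  lamP : left_coaction lam }.

Arguments lam {_}.

Definition BcopM (M : rlmodule) : linsub (tens B M) :=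
  cotensor (lfull B) (lfull M) rCcop (push_l lam beta).

(* The action is only defined on the cotensor product of M and B, so that a
   formula containing m <| b asserts that m (x) b belongs to it; this is the
   role of x below. *)
Definition anti_yetter_drinfeld (M : rlmodule) : Prop :=
  (forall m : M, push_l lam beta m = rm_lcoact m) /\
  (forall z : tens B M, BcopM M z ->
    exists2 x : lsub (MB M), val x = flip z &
      lam (rm_act x) =
      \sw_(b, m <- z) \sw_(b1, b2 <- cDelta b) \sw_(m_1, m0 <- lam m)
        \sw_(nm, np <- nuinv (b2 \ot m_1))
          papp mu np b1 \ot papp rm_act m0 nm).

Definition stable (M : rlmodule) : Prop :=
  forall m : M, exists2 x : lsub (MB M), val x = flip (lam m) & rm_act x = m.

End HopfCoalgebras.

Arguments lam {_ _ _ _}.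
Arguments rm_coact {_ _ _ _}.
Arguments rm_act {_ _ _ _}.

Section ComoduleRings.
Variables (K : fieldType) (C : coalgebra K).

Record cring := CRing {
  cr_sort :> lmodType K;
  cr_l : {linear cr_sort -> tens C cr_sort};
  cr_r : {linear cr_sort -> tens cr_sort C};
  cr_lP : left_coaction cr_l;
  cr_rP : right_coaction cr_r;
  cr_lr : coactions_commute cr_l cr_r;
  cr_mul : {linear lsub (cotensor (lfull cr_sort) (lfull cr_sort) cr_r cr_l)
            -> cr_sort};
  cr_one : {linear C -> cr_sort};
  cr_mul_colinl : forall x, cr_l (cr_mul x) =
    \sw_(a, a' <- val x) \sw_(c, a0 <- cr_l a) c \ot papp cr_mul a0 a';
  cr_mul_colinr : forall x, cr_r (cr_mul x) =
    \sw_(a, a' <- val x) \sw_(a0, c <- cr_r a') papp cr_mul a a0 \ot c;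
  cr_mulA : forall x : tens cr_sort (tens cr_sort cr_sort),
    cotensor (lfull cr_sort)
      (cotensor (lfull cr_sort) (lfull cr_sort) cr_r cr_l)
      cr_r (lcoact1 cr_l) x ->
    \sw_(a, y <- x) \sw_(a', a'' <- y) papp cr_mul (papp cr_mul a a') a'' =
    \sw_(a, y <- x) \sw_(a', a'' <- y) papp cr_mul a (papp cr_mul a' a'');
  cr_one_colinl : forall c,
    cr_l (cr_one c) = \sw_(c1, c2 <- cDelta c) c1 \ot cr_one c2;
  cr_one_colinr : forall c,
    cr_r (cr_one c) = \sw_(c1, c2 <- cDelta c) cr_one c1 \ot c2;
  cr_mulr1 : forall a, \sw_(a0, c <- cr_r a) papp cr_mul a0 (cr_one c) = a;
  cr_mul1r : forall a, \sw_(c, a0 <- cr_l a) papp cr_mul (cr_one c) a0 = a }.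

Arguments cr_l {_}.
Arguments cr_r {_}.
Arguments cr_mul {_}.
Arguments cr_one {_}.

Record comodule_ring (B : bicoalgebroid C) := ComoduleRing {
  cmr :> cring;
  coact : {linear cmr -> tens cmr B};
  coactP : right_coaction coact;
  coact_l : forall a, cr_l a = push_flip coact beta a;
  coact_r : forall a, cr_r a = push_r coact alpha a;
  coact_one : forall c : C, coact (cr_one c) =
    \sw_(h1, h2 <- cDelta (eta c)) cr_one (alpha h1) \ot h2;
  coact_mul : forall x, coact (cr_mul x) =
    \sw_(a, a' <- val x) \sw_(a0, a1 <- coact a) \sw_(a'0, a'1 <- coact a')
      papp cr_mul a0 a'0 \ot papp mu a1 a'1 }.

Arguments coact {_ _}.

(* The ambient space A^{(x)(n+1)}, nested to the right. *)
Fixpoint tpow (A : lmodType K) (n : nat) : lmodType K :=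
  if n is n'.+1 then tens A (tpow A n') else A.

Section Powers.
Variables (B : bicoalgebroid C) (A : comodule_ring B).

Definition tpow_l n : {linear tpow A n -> tens C (tpow A n)} :=
  match n return {linear tpow A n -> tens C (tpow A n)} with
  | 0 => cr_l
  | n'.+1 => lcoact1 cr_l
  end.

(* A^{[]_C(n+1)} as a subspace of A^{(x)(n+1)}. *)
Fixpoint cotpow n : linsub (tpow A n) :=
  match n return linsub (tpow A n) with
  | 0 => lfull A
  | n'.+1 => cotensor (lfull A) (cotpow n') cr_r (tpow_l n')
  end.

Definition coact2 (Y : lmodType K) (r : {linear Y -> tens Y B})
  (z : tens A Y) : tens (tens A Y) B :=
  \sw_(a, y <- z) \sw_(a0, a1 <- coact a) \sw_(y0, y1 <- r y)
    (a0 \ot y0) \ot papp mu a1 y1.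

Lemma coact2_linear Y r : linear (@coact2 Y r).
Proof. rewrite /coact2 /papp; linear_tac. Qed.
HB.instance Definition _ Y r :=
  GRing.isLinear.Build K _ _ _ (@coact2 Y r) (@coact2_linear Y r).

(* Since mu is only defined on B [] B, this is meaningful on the subspace
   cotpow n only, where it is the right B-coaction of A^{[](n+1)}. *)
Fixpoint tpow_coact n : {linear tpow A n -> tens (tpow A n) B} :=
  match n return {linear tpow A n -> tens (tpow A n) B} with
  | 0 => coact
  | n'.+1 => coact2 (tpow_coact n')
  end.

End Powers.
End ComoduleRings.

Arguments cr_l {_ _ _}.
Arguments cr_r {_ _ _}.
Arguments cr_mul {_ _ _}.
Arguments cr_one {_ _ _}.
Arguments coact {_ _ _ _}.

Section Operators.
Variables (K : fieldType) (C : coalgebra K) (B : hopf_coalgebra C).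
Variables (M : rlmodule B) (A : comodule_ring B).

(* A^{[]_C(n+1)} []_B M as a subspace of A^{(x)(n+1)} (x) M. *)
Definition Ctilde n : linsub (tens (tpow A n) M) :=
  cotensor (cotpow A n) (lfull M) (tpow_coact A n) lam.

(* a_0 (x) ... (x) eta_A(a_i<-1>) (x) a_i<0> (x) ... (x) a_n, for i <= n. *)
Fixpoint insert_one n (i : nat) : tpow A n -> tpow A n.+1 :=
  match n return tpow A n -> tpow A n.+1 with
  | 0 => fun a => \sw_(c, a0 <- cr_l a) cr_one c \ot a0
  | n'.+1 => fun x => \sw_(a, t <- x)
      if i is i'.+1 then a \ot insert_one i' t
      else \sw_(c, a0 <- cr_l a) cr_one c \ot a0 \ot t
  end.

(* a_0 (x) ... (x) a_i a_{i+1} (x) ... (x) a_{n+1}, for i <= n. *)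
Fixpoint merge n (i : nat) : tpow A n.+1 -> tpow A n :=
  match n return tpow A n.+1 -> tpow A n with
  | 0 => fun x => \sw_(a, b <- x) papp cr_mul a b
  | n'.+1 => fun x => \sw_(a, t <- x)
      if i is i'.+1 then a \ot merge i' t
      else \sw_(b, u <- t) papp cr_mul a b \ot u
  end.

Fixpoint tsnoc n (t : tpow A n) (a : A) : tpow A n.+1 :=
  match n return tpow A n -> tpow A n.+1 with
  | 0 => fun b => b \ot a
  | n'.+1 => fun x => \sw_(b, u <- x) b \ot tsnoc u a
  end t.

Definition delta_formula n i (z : tens (tpow A n) M) : tens (tpow A n.+1) M :=
  \sw_(t, m <- z) insert_one i t \ot m.

Definition sigma_formula n i (z : tens (tpow A n.+1) M) : tens (tpow A n) M :=
  \sw_(t, m <- z) merge i t \ot m.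

Definition tau_formula n : tens (tpow A n) M -> tens (tpow A n) M :=
  match n return tens (tpow A n) M -> tens (tpow A n) M with
  | 0 => fun z => \sw_(a, m <- z) \sw_(a0, a1 <- coact a)
      a0 \ot papp rm_act m a1
  | n'.+1 => fun z => \sw_(x, m <- z) \sw_(a, t <- x) \sw_(a0, a1 <- coact a)
      tsnoc t a0 \ot papp rm_act m a1
  end.

End Operators.

(* Cofaces d n i : X n -> X n.+1 for i <= n.+1, codegeneracies
   s n i : X n.+1 -> X n for i <= n, cyclic operators t n; the values at larger
   i are irrelevant. *)
Record cocyclic (K : fieldType) (X : nat -> lmodType K)
    (d : forall n, nat -> {linear X n -> X n.+1})
    (s : forall n, nat -> {linear X n.+1 -> X n})
    (t : forall n, {linear X n -> X n}) : Prop := Cocyclic {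
  coface_coface : forall n i j x, (i <= j <= n.+1)%N ->
    d n.+1 j.+1 (d n i x) = d n.+1 i (d n j x);
  codeg_codeg : forall n i j x, (i <= j <= n)%N ->
    s n j (s n.+1 i x) = s n i (s n.+1 j.+1 x);
  codeg_coface_lt : forall n i j x, (i <= j <= n)%N ->
    s n.+1 j.+1 (d n.+1 i x) = d n i (s n j x);
  codeg_coface_eq : forall n j x, (j <= n)%N -> s n j (d n j x) = x;
  codeg_coface_eqS : forall n j x, (j <= n)%N -> s n j (d n j.+1 x) = x;
  codeg_coface_gt : forall n i j x, (j < i <= n.+1)%N ->
    s n.+1 j (d n.+1 i.+1 x) = d n i (s n j x);
  cyc_coface : forall n i x, (i <= n)%N ->
    t n.+1 (d n i.+1 x) = d n i (t n x);
  cyc_coface0 : forall n x, t n.+1 (d n 0%N x) = d n n.+1 x;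
  cyc_codeg : forall n i x, (i < n)%N ->
    t n (s n i.+1 x) = s n i (t n.+1 x);
  cyc_codeg0 : forall n x, t n (s n 0%N x) = s n n (t n.+1 (t n.+1 x));
  cyc_order : forall n x, iter n.+1 (t n) x = x }.

Arguments cocyclic {K} X d s t.

(* Main.v *)
From HB Require Import structures.
From mathcomp Require Import all_boot all_order all_algebra.
From mathcomp Require Import boolp classical_sets functions reals.
From mathcomp Require Import complex zify.
Require Import Defs.

(* The identities are checked in Sweedler notation.  The products of B, of A and
   the action on M are only meaningful on cotensor products, so each step needs
   a proof that the relevant components of a tensor lie in such a subspace; over
   a field this can be tested after applying functionals to all other factors
   ([tensr_slice]).

   The cosimplicial identities come from the comodule ring A alone.  The point
   is that the cyclic operator is well defined.  Stability gives
   m_<0> (x) m_<1> = m_0 (x) beta(m_{-1}), so m (x) a_1 lies in M [] B; it also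
   identifies alpha(m_{-1}) (x) m_0 with the canonical left coaction, whence
   alpha(m_{-1}) (x) m_0 <| b = beta(b_1) (x) m <| b_2, which puts the rotated
   tensor into the cotensor power; and nu^{-1}(nu(x)) = x turns the
   anti-Yetter-Drinfeld formula into B-colinearity.  Finally tau_n^{n+1}
   multiplies m by all the coaction components, which gives m_0 <| m_{-1} = m.
   The relations with the outermost operators follow by rotation. *)

Set Implicit Arguments.
Unset Strict Implicit.
Unset Printing Implicit Defensive.

Import GRing.Theory.
Local Open Scope ring_scope.

(** * Sweedler calculus *)

(** The products are extended linearly to whole tensor products with arbitrary values outside the
    cotensor products, so an axiom such as associativity need not hold summand by summand under a
    [sw]. Hence a recurring move: gather the rest of the expression into one spectator factor [V],
    form a tensor [t] in [V] tensor the domain of the axiom, prove that its second factor stays in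
    that domain, rewrite there, and unfold again. Flatness over a field makes this work: tensoring
    with [V] preserves the equalizers that define cotensor products. The bracketing of the powers is
    the other obstacle. [tpow] and its coaction recurse on the first letter, whereas rotation
    appends a last letter; comparing the two costs an associativity argument in [B] at each level.
    For the order of the cyclic operator all conditions are postponed: the iterate is computed
    formally on pure words, and cotensor membership enters only when the successive actions are
    merged into one. *)

Section TensorCalculus.
Variable K : fieldType.
Implicit Types V W Y Z : lmodType K.

Lemma eq_sw V W Z (z : tens V W) (f g : V -> W -> Z) :
  (forall x y, f x y = g x y) -> sw z f = sw z g.
Proof. by move=> e; rewrite /sw; apply: eq_bigr => p _. Qed.

Lemma linear_fun0 V W (f : V -> W) : linear f -> f 0 = 0.
Proof. by move=> fl; have := fl (-1) 0 0; rewrite !scaleN1r !addNr. Qed.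

Lemma linear_funD V W (f : V -> W) x y : linear f -> f (x + y) = f x + f y.
Proof. by move=> fl; have := fl 1 x y; rewrite !scale1r. Qed.

Lemma linear_funZ V W (f : V -> W) a x : linear f -> f (a *: x) = a *: f x.
Proof.
by move=> fl; have := fl a x 0; rewrite (linear_fun0 fl) !addr0.
Qed.

Lemma linear_fun_sum V W (f : V -> W) I (r : seq I) (F : I -> V) :
  linear f -> f (\sum_(i <- r) F i) = \sum_(i <- r) f (F i).
Proof.
move=> fl; elim: r => [|i r IH]; first by rewrite !big_nil (linear_fun0 fl).
by rewrite !big_cons (linear_funD _ _ fl) IH.
Qed.

Lemma linear_fun_sw V W Y Z (g : Y -> Z) (z : tens V W) (f : V -> W -> Y) :
  linear g -> g (sw z f) = sw z (fun x y => g (f x y)).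
Proof. by move=> gl; rewrite /sw (linear_fun_sum _ _ gl). Qed.

Lemma sw_sw V W V' W' Z (z : tens V W) (f : V -> W -> tens V' W')
    (g : V' -> W' -> Z) :
  bilin g -> sw (sw z f) g = sw z (fun x y => sw (f x y) g).
Proof. by move=> gb; apply: (linear_fun_sw z f (sw_linear gb)). Qed.

Lemma sw_exch V W V' W' Z (z : tens V W) (w : tens V' W')
    (f : V -> W -> V' -> W' -> Z) :
  sw z (fun x y => sw w (f x y)) =
  sw w (fun x' y' => sw z (fun x y => f x y x' y')).
Proof. by rewrite /sw exchange_big. Qed.

Lemma pure_sw V W (z : tens V W) : sw z (@pure K V W) = z.
Proof.
by have [s ->] := tensP z; rewrite sw_sum //; exact: pure_bilin.
Qed.

Lemma pure_swl V W V' W' (z : tens V W) (f : V -> W -> V') (w : W') :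
  pure (sw z f) w = sw z (fun x y => pure (f x y) w).
Proof. by apply: (linear_fun_sw _ _ ((pure_bilin V' W').1 w)). Qed.

Lemma pure_swr V W V' W' (z : tens V W) (f : V -> W -> W') (v : V') :
  pure v (sw z f) = sw z (fun x y => pure v (f x y)).
Proof. by apply: (linear_fun_sw _ _ ((pure_bilin V' W').2 v)). Qed.

Lemma papp_swl V W X Y Z (P : linsub (tens X Y)) (g : {linear lsub P -> Z})
    (z : tens V W) (f : V -> W -> X) y :
  papp g (sw z f) y = sw z (fun u v => papp g (f u v) y).
Proof. by apply: (linear_fun_sw _ _ (papp_linearl g y)). Qed.

Lemma papp_swr V W X Y Z (P : linsub (tens X Y)) (g : {linear lsub P -> Z})
    (z : tens V W) (f : V -> W -> Y) x :
  papp g x (sw z f) = sw z (fun u v => papp g x (f u v)).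
Proof. by apply: (linear_fun_sw _ _ (papp_linearr g x)). Qed.

Lemma app_sw V W Y Z (g : {linear Y -> Z}) (z : tens V W) (f : V -> W -> Y) :
  g (sw z f) = sw z (fun x y => g (f x y)).
Proof. by apply: linear_fun_sw => a x y; rewrite linearP. Qed.

Lemma scale_swl V W Z (z : tens V W) (f : V -> W -> K^o) (v : Z) :
  (sw z f : K) *: v = sw z (fun x y => (f x y : K) *: v).
Proof. by rewrite /sw scaler_suml. Qed.

Lemma scale_swr V W Z (z : tens V W) (f : V -> W -> Z) a :
  a *: sw z f = sw z (fun x y => a *: f x y).
Proof. by rewrite /sw scaler_sumr. Qed.

Lemma linear_pappl V W Z Y (P : linsub (tens V W)) (g : {linear lsub P -> Z})
    (f : Y -> V) w : linear f -> linear (fun y => papp g (f y) w).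
Proof. by move=> fl a x y; rewrite fl papp_linearl. Qed.

Lemma linear_pappr V W Z Y (P : linsub (tens V W)) (g : {linear lsub P -> Z})
    (f : Y -> W) v : linear f -> linear (fun y => papp g v (f y)).
Proof. by move=> fl a x y; rewrite fl papp_linearr. Qed.

Lemma linear_scalel Y Z (g : Y -> K^o) (v : Z) :
  linear g -> linear (fun y => (g y : K) *: v).
Proof. by move=> gl a x y; rewrite gl scalerDl scalerA. Qed.

Lemma linear_scaler Y Z (f : Y -> Z) (a : K) :
  linear f -> linear (fun y => a *: f y).
Proof. by move=> fl b x y; rewrite fl scalerDr !scalerA mulrC. Qed.

Lemma linear_comp V Y Z (g : V -> Z) (f : Y -> V) :
  linear g -> linear f -> linear (fun y => g (f y)).
Proof. by move=> gl fl a x y; rewrite fl gl. Qed.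

Lemma linear_scalar V Y (g : {scalar V}) (f : Y -> V) :
  linear f -> linear (fun y => g (f y) : K^o).
Proof. by move=> fl a x y; rewrite fl linearP. Qed.

Definition trilin V W Y Z (f : V -> W -> Y -> Z) :=
  [/\ forall w y, linear (fun v => f v w y), forall v y, linear (fun w => f v w y)
    & forall v w, linear (f v w)].

Lemma trilin1 V W Y Z (f : V -> W -> Y -> Z) w y :
  trilin f -> linear (fun v => f v w y).
Proof. by case. Qed.
Lemma trilin2 V W Y Z (f : V -> W -> Y -> Z) v y :
  trilin f -> linear (fun w => f v w y).
Proof. by case. Qed.
Lemma trilin3 V W Y Z (f : V -> W -> Y -> Z) v w :
  trilin f -> linear (f v w).
Proof. by case. Qed.

End TensorCalculus.

Section Unfold.
Variable K : fieldType.
Implicit Types V W X Y D E : lmodType K.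

Lemma push_rE X D E (r : {linear X -> tens X D}) (h : {linear D -> E}) x :
  push_r r h x = \sw_(x0, x1 <- r x) x0 \ot h x1.
Proof. by []. Qed.
Lemma push_flipE X D E (r : {linear X -> tens X D}) (h : {linear D -> E}) x :
  push_flip r h x = \sw_(x0, x1 <- r x) h x1 \ot x0.
Proof. by []. Qed.
Lemma push_lE X D E (l : {linear X -> tens D X}) (h : {linear D -> E}) x :
  push_l l h x = \sw_(x1, x0 <- l x) h x1 \ot x0.
Proof. by []. Qed.
Lemma push_lE' X D E (l : {linear X -> tens D X}) (h : {linear D -> E}) x :
  (push_l l h : {linear X -> tens E X}) x = \sw_(x1, x0 <- l x) h x1 \ot x0.
Proof. by []. Qed.
Lemma push_rE' X D E (r : {linear X -> tens X D}) (h : {linear D -> E}) x :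
  (push_r r h : {linear X -> tens X E}) x = \sw_(x0, x1 <- r x) x0 \ot h x1.
Proof. by []. Qed.
Lemma flipE X Y (z : tens X Y) : flip z = \sw_(x, y <- z) y \ot x.
Proof. by []. Qed.
Lemma lcoact1E X Y D (l : {linear X -> tens D X}) (t : tens X Y) :
  (lcoact1 l : {linear tens X Y -> tens D (tens X Y)}) t =
  \sw_(x, y <- t) \sw_(d, x0 <- l x) d \ot x0 \ot y.
Proof. by []. Qed.
Lemma cot_rightE X Y D (r : {linear X -> tens X D}) (z : tens X Y) :
  cot_right r z = \sw_(x, y <- z) \sw_(x0, x1 <- r x) x0 \ot x1 \ot y.
Proof. by []. Qed.
Lemma cot_leftE X Y D (l : {linear Y -> tens D Y}) (z : tens X Y) :
  cot_left l z = \sw_(x, y <- z) \sw_(y1, y0 <- l y) x \ot y1 \ot y0.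
Proof. by []. Qed.
Lemma coact2E (C : coalgebra K) (B : bicoalgebroid C) (A : comodule_ring B) Y
    (r : {linear Y -> tens Y B}) (z : tens A Y) :
  (coact2 r : {linear tens A Y -> tens (tens A Y) B}) z =
  \sw_(a, y <- z) \sw_(a0, a1 <- coact a) \sw_(y0, y1 <- r y)
    (a0 \ot y0) \ot papp mu a1 y1.
Proof. by []. Qed.

Lemma nuE (C : coalgebra K) (B : bicoalgebroid C) (x : tens B B) :
  nu x = \sw_(b, b' <- x) \sw_(b1, b2 <- cDelta b) b1 \ot papp mu b2 b'.
Proof. by []. Qed.

Lemma tpow_lSE (C : coalgebra K) (B : bicoalgebroid C) (A : comodule_ring B) n
    (x : tpow A n.+1) :
  tpow_l A n.+1 x = \sw_(a, t <- x) \sw_(c, a0 <- cr_l a) c \ot a0 \ot t.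
Proof. by []. Qed.
Lemma tpow_coactSE (C : coalgebra K) (B : bicoalgebroid C) (A : comodule_ring B) n
    (x : tpow A n.+1) :
  tpow_coact A n.+1 x =
  \sw_(a, t <- x) \sw_(a0, a1 <- coact a) \sw_(t0, t1 <- tpow_coact A n t)
    (a0 \ot t0) \ot papp mu a1 t1.
Proof. by []. Qed.

Section C.
Variables (C : coalgebra K) (B : precoalgebroid C) (b : B).
Lemma rCE : rC b = \sw_(b1, b2 <- cDelta b) b1 \ot alpha b2.
Proof. by []. Qed.
Lemma lCE : lC b = \sw_(b1, b2 <- cDelta b) beta b2 \ot b1.
Proof. by []. Qed.
Lemma rCcopE : rCcop b = \sw_(b1, b2 <- cDelta b) b1 \ot beta b2.
Proof. by []. Qed.
End C.
End Unfold.

(** * Automation: linearity goals and normal forms of Sweedler sums *)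

Ltac const_of f := lazymatch f with (fun _ => ?v) => constr:(v) end.

Ltac lin :=
  lazymatch goal with
  | |- bilin _ => first [assumption | split => ?; cbv beta; lin]
  | |- trilin _ => first [assumption | split => ? ?; cbv beta; lin]
  | |- forall v w, linear _ => move=> ? ?; cbv beta; lin
  | |- linear ?f => lin_body f
  end
with lin_body f :=
  lazymatch f with
  | (fun y => y) => exact: linear_id
  | (fun y => pure (@?a y) (@?b y)) => first
    [ let v := const_of a in refine (@linear_purer _ _ _ _ b v _)
    | let w := const_of b in refine (@linear_pure _ _ _ _ a w _) ]; lin
  | (fun y => sw (@?r y) (@?a y)) => first
    [ let z := const_of r in refine (@linear_swr _ _ _ _ _ z a _)
    | let g := const_of a in refine (@linear_sw _ _ _ _ _ r g _ _) ]; lin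
  | (fun y => papp ?g (@?a y) (@?b y)) => first
    [ let v := const_of a in refine (@linear_pappr _ _ _ _ _ _ g b v _)
    | let w := const_of b in refine (@linear_pappl _ _ _ _ _ _ g a w _) ]; lin
  | (fun y => GRing.scale (@?a y) (@?b y)) => first
    [ let c := const_of a in refine (@linear_scaler _ _ _ b c _)
    | let v := const_of b in refine (@linear_scalel _ _ _ a v _) ]; lin
  | (fun y => GRing.Linear.sort ?g (@?a y)) => first
    [ refine (@linear_app _ _ _ _ g a _) | refine (@linear_scalar _ _ _ g a _) ]; lin
  | GRing.Linear.sort ?g => first
    [ exact (linear_app g (@linear_id _ _)) | exact (linear_scalar g (@linear_id _ _)) ]
  | _ => first
    [ assumption
    | match goal with H : bilin ?h |- linear (?h ?v) => exact (H.2 v) end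
    | match goal with H : trilin ?h |- linear (?h ?v ?w) => exact (trilin3 v w H) end
    | lazymatch f with
      | (fun y => ?h (@?a y) (@?b y)) => first
        [ let w := const_of b in
          refine (@linear_comp _ _ _ _ (fun v => h v w) a _ _); [lin_hypl h | lin]
        | let v := const_of a in
          refine (@linear_comp _ _ _ _ (h v) b _ _); [lin_hypr h | lin] ]
      end
    | lazymatch f with
      | (fun y => ?h (@?a y) (@?b y) (@?c y)) => first
        [ let v := const_of b in let w := const_of c in
          refine (@linear_comp _ _ _ _ (fun u => h u v w) a _ _); [apply: trilin1; eassumption | lin]
        | let v := const_of a in let w := const_of c in
          refine (@linear_comp _ _ _ _ (fun u => h v u w) b _ _); [apply: trilin2; eassumption | lin]
        | let v := const_of a in let w := const_of b in
          refine (@linear_comp _ _ _ _ (h v w) c _ _); [apply: trilin3; eassumption | lin] ]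
      end
    | lazymatch f with
      | (fun y => ?h (@?a y)) => refine (@linear_comp _ _ _ _ h a _ _); [lin_hyp h | lin]
      end ]
  end
with lin_hyp h :=
  first
  [ assumption
  | lazymatch h with
    | cot_right ?r => exact (cot_right_linear r (Y := _))
    | cot_left ?l => exact (cot_left_linear l (X := _))
    | push_r ?r ?g => exact (push_r_linear r g)
    | push_l ?r ?g => exact (push_l_linear r g)
    | push_flip ?r ?g => exact (push_flip_linear r g)
    | lcoact1 ?l => exact (lcoact1_linear l)
    | coact2 ?r => exact (coact2_linear r)
    | @nu ?K ?C ?B => exact (@nu_linear K C B)
    | @flip _ _ _ => exact (@flip_linear _ _ _)
    end ]
with lin_hypl h := match goal with H : bilin h |- _ => exact (H.1 _) end
with lin_hypr h := match goal with H : bilin h |- _ => exact (H.2 _) end.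

(* Rewrites the left-hand side of an equation into a nested sum whose summands
   contain no further sum; the right-hand side may be an evar. *)
Ltac nrm :=
  lazymatch goal with
  | |- sw (pure _ _) _ = _ =>
      etransitivity; [apply: sw_pure; lin | cbn beta; nrm]
  | |- sw (sw _ _) _ = _ =>
      etransitivity; [apply: sw_sw; lin | cbn beta; nrm]
  | |- sw ?z ?f = _ =>
      first
      [ etransitivity; [apply: (f_equal (fun w => sw w f)); nrm1 | cbn beta; nrm]
      | apply: eq_sw; let x := fresh "x" in let y := fresh "y" in
        intros x y; cbn beta; nrm ]
  | |- _ => first
      [ etransitivity; [nrm1 | cbn beta; nrm] | reflexivity ]
  end
with nrm1 :=
  lazymatch goal with
  | |- sw (pure _ _) _ = _ => apply: sw_pure; lin
  | |- sw (sw _ _) _ = _ => apply: sw_sw; lin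
  | |- pure (sw _ _) _ = _ => apply: pure_swl
  | |- pure _ (sw _ _) = _ => apply: pure_swr
  | |- pure ?u ?v = _ => first
      [ apply: (f_equal (fun w => pure w v)); nrm1
      | apply: (f_equal (fun w => pure u w)); nrm1 ]
  | |- papp _ (sw _ _) _ = _ => apply: papp_swl
  | |- papp _ _ (sw _ _) = _ => apply: papp_swr
  | |- papp ?g ?u ?v = _ => first
      [ apply: (f_equal (fun w => papp g w v)); nrm1
      | apply: (f_equal (fun w => papp g u w)); nrm1 ]
  | |- _ *: (sw _ _) = _ => apply: scale_swr
  | |- (sw _ _) *: _ = _ => apply: scale_swl
  | |- ?a *: ?v = _ => first
      [ apply: (f_equal (fun w => w *: v)); nrm1
      | apply: (f_equal (fun w => a *: w)); nrm1 ]
  | |- push_r _ _ _ = _ => apply: push_rE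
  | |- push_flip _ _ _ = _ => apply: push_flipE
  | |- push_l _ _ _ = _ => apply: push_lE
  | |- flip _ = _ => apply: flipE
  | |- nu _ = _ => apply: nuE
  | |- coact2 _ _ = _ => apply: coact2E
  | |- lcoact1 _ _ = _ => apply: lcoact1E
  | |- cot_right _ _ = _ => apply: cot_rightE
  | |- cot_left _ _ = _ => apply: cot_leftE
  | |- GRing.Linear.sort rC _ = _ => apply: rCE
  | |- GRing.Linear.sort lC _ = _ => apply: lCE
  | |- GRing.Linear.sort rCcop _ = _ => apply: rCcopE
  | |- GRing.Linear.sort ?g (sw _ _) = _ => apply: (app_sw g)
  | |- GRing.Linear.sort ?g ?x = _ =>
      lazymatch g with
      | tpow_l ?A ?n.+1 => exact (@tpow_lSE _ _ _ A n x)
      | tpow_coact ?A ?n.+1 => exact (@tpow_coactSE _ _ _ A n x)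
      | context [@lcoact1 _ _ _ _ _] => apply: lcoact1E
      | context [@push_r _ _ _ _ _ _] => apply: push_rE'
      | context [@push_l _ _ _ _ _ _] => apply: push_lE'
      | context [@coact2 _ _ _ _ _ _] => apply: coact2E
      | _ => apply: (f_equal (fun w => g w)); nrm1
      end
  | |- ?h ?u ?v ?w = _ =>
      let H := lazymatch goal with H : trilin h |- _ => H end in
      first
      [ apply: (linear_fun_sw _ _ (trilin1 v w H))
      | apply: (linear_fun_sw _ _ (trilin2 u w H))
      | apply: (linear_fun_sw _ _ (trilin3 u v H))
      | apply: (f_equal (fun x => h x v w)); nrm1
      | apply: (f_equal (fun x => h u x w)); nrm1
      | apply: (f_equal (fun x => h u v x)); nrm1 ]
  | |- ?h ?u ?v = _ =>
      let H := lazymatch goal with H : bilin h |- _ => H end in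
      first
      [ apply: (linear_fun_sw _ _ (H.1 v))
      | apply: (linear_fun_sw _ _ (H.2 u))
      | apply: (f_equal (fun x => h x v)); nrm1
      | apply: (f_equal (fun x => h u x)); nrm1 ]
  | |- ?h ?u = _ =>
      let H := lazymatch goal with H : linear h |- _ => H end in
      first
      [ apply: (linear_fun_sw _ _ H)
      | apply: (f_equal (fun x => h x)); nrm1 ]
  end.

Ltac nrm2 :=
  etransitivity; [nrm | symmetry; etransitivity; [nrm | symmetry]].

(* Equality of nested sums up to the order of independent summations. *)
Ltac pull z :=
  lazymatch goal with
  | |- sw z _ = _ => reflexivity
  | |- sw ?w ?h = _ =>
      etransitivity;
      [ apply: eq_sw; let x := fresh "x" in let y := fresh "y" in
        intros x y; cbn beta; pull z
      | apply: sw_exch ]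
  end.

Ltac swmatch :=
  first [ reflexivity |
  lazymatch goal with
  | |- sw ?z _ = _ =>
      symmetry; etransitivity;
      [ pull z
      | cbn beta; apply: eq_sw; let x := fresh "x" in let y := fresh "y" in
        intros x y; cbn beta; symmetry; swmatch ]
  end ].

Ltac swt := nrm2; swmatch.

(* Applies [tac] to the outermost subsum of the left-hand side where it succeeds. *)
Ltac at_sw tac :=
  first
  [ tac
  | lazymatch goal with
    | |- sw _ _ = _ => apply: eq_sw; let x := fresh "x" in let y := fresh "y" in
        intros x y; cbn beta; at_sw tac
    end ].

Tactic Notation "swr" tactic3(t) :=
  etransitivity; [at_sw ltac:(t; try lin) | cbn beta].
Tactic Notation "swr_rhs" tactic3(t) :=
  symmetry; etransitivity; [at_sw ltac:(t; try lin) | cbn beta]; symmetry.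

Tactic Notation "lhs" uconstr(e) :=
  refine (etrans e _); [try lin .. | cbn beta].
Tactic Notation "lhs" "<-" uconstr(e) :=
  refine (etrans (esym e) _); [try lin .. | cbn beta].

(* Proves an equation by an instance of e, up to normalization of both sides. *)
Tactic Notation "via" uconstr(e) :=
  refine (etrans _ (etrans e _)); [by swt | try lin .. | by swt].

(** * Coassociativity and counit laws in an arbitrary multilinear context *)

Section Triple.
Variable K : fieldType.
Implicit Types V W X Y Z : lmodType K.

Lemma congr_sw V W Z (t t' : tens V W) (F : V -> W -> Z) :
  t = t' -> sw t F = sw t' F.
Proof. by move=> ->. Qed.

(** This is how the axioms are used: each is an equality in a threefold tensor product. Evaluating
    both members against a multilinear [F] and normalizing gives the axiom inside any expression. *)
Lemma eq_tens3 V W Y Z (t t' : tens V (tens W Y)) (F : V -> W -> Y -> Z) :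
  t = t' ->
  \sw_(v, z <- t) \sw_(w, y <- z) F v w y = \sw_(v, z <- t') \sw_(w, y <- z) F v w y.
Proof. by move=> ->. Qed.

Lemma coassocE (D : coalgebra K) Z (F : D -> D -> D -> Z) x : trilin F ->
  \sw_(x1, x2 <- cDelta x) \sw_(x11, x12 <- cDelta x1) F x11 x12 x2 =
  \sw_(x1, x2 <- cDelta x) \sw_(x21, x22 <- cDelta x2) F x1 x21 x22.
Proof.
move=> Fl; have := eq_tens3 F (cDeltaA x) => e.
by etransitivity; [|etransitivity; [exact: e|nrm]]; symmetry; nrm.
Qed.

Lemma epslE (D : coalgebra K) Z (F : D -> Z) x : linear F ->
  \sw_(x1, x2 <- cDelta x) (ceps x1 : K) *: F x2 = F x.
Proof.
move=> Fl; rewrite -[in RHS](cepsl x) (linear_fun_sw _ _ Fl).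
by apply: eq_sw => u v; rewrite (linear_funZ _ _ Fl).
Qed.

Section Coactions.
Variables (D : coalgebra K) (X : lmodType K).

Lemma rcoassocE (r : {linear X -> tens X D}) Z (F : X -> D -> D -> Z) x :
  right_coaction r -> trilin F ->
  \sw_(x0, x1 <- r x) \sw_(x00, x01 <- r x0) F x00 x01 x1 =
  \sw_(x0, x1 <- r x) \sw_(d1, d2 <- cDelta x1) F x0 d1 d2.
Proof.
move=> [rA _] Fl; have := eq_tens3 F (rA x) => e.
by etransitivity; [|etransitivity; [exact: e|nrm]]; symmetry; nrm.
Qed.

Lemma rcounitE (r : {linear X -> tens X D}) Z (F : X -> Z) x :
  right_coaction r -> linear F ->
  \sw_(x0, x1 <- r x) (ceps x1 : K) *: F x0 = F x.
Proof.
move=> [_ r1] Fl; rewrite -[in RHS](r1 x) (linear_fun_sw _ _ Fl).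
by apply: eq_sw => u v; rewrite (linear_funZ _ _ Fl).
Qed.

Lemma lcoassocE (l : {linear X -> tens D X}) Z (F : D -> D -> X -> Z) x :
  left_coaction l -> trilin F ->
  \sw_(x1, x0 <- l x) \sw_(d1, d2 <- cDelta x1) F d1 d2 x0 =
  \sw_(x1, x0 <- l x) \sw_(y1, y0 <- l x0) F x1 y1 y0.
Proof.
move=> [lA _] Fl; have := eq_tens3 F (lA x) => e.
by etransitivity; [|etransitivity; [exact: e|nrm]]; symmetry; nrm.
Qed.

Lemma lcounitE (l : {linear X -> tens D X}) Z (F : X -> Z) x :
  left_coaction l -> linear F ->
  \sw_(x1, x0 <- l x) (ceps x1 : K) *: F x0 = F x.
Proof.
move=> [_ l1] Fl; rewrite -[in RHS](l1 x) (linear_fun_sw _ _ Fl).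
by apply: eq_sw => u v; rewrite (linear_funZ _ _ Fl).
Qed.

End Coactions.
End Triple.

(** * Subspaces of tensor products *)

Section Slices.
Variable K : fieldType.
Implicit Types V W X Y Z : lmodType K.

Definition slice V W (phi : {linear V -> K^o}) (t : tens V W) : W :=
  sw t (fun v w => (phi v : K) *: w).

Lemma bilin_slice V W (phi : {linear V -> K^o}) :
  bilin (fun (v : V) (w : W) => (phi v : K) *: w).
Proof. lin. Qed.

Lemma slice_linear V W (phi : {linear V -> K^o}) : linear (@slice V W phi).
Proof. by apply: sw_linear; apply: bilin_slice. Qed.
HB.instance Definition _ V W phi :=
  GRing.isLinear.Build K _ _ _ (@slice V W phi) (slice_linear phi).

Lemma exists_functional V (v : V) : v != 0 ->
  exists phi : {linear V -> K^o}, phi v = 1.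
Proof.
move=> v0; have [phi pv] : exists phi : {linear V -> K^o}, phi v != 0.
  apply/not_existsP => h; case/eqP: v0; apply: separate => phi.
  by apply/eqP/negPn/negP; exact: h.
exists ((phi v : K)^-1 \*: phi : {linear V -> K^o}).
by rewrite /= [LHS]mulVf.
Qed.

(** Induction on the length of an expansion: a functional that does not vanish on the first left
    entry allows the expansion to be replaced by a shorter one. *)
Lemma slice_inj V W (t : tens V W) : (forall phi, slice phi t = 0) -> t = 0.
Proof.
have [s ->] := tensP t; move: {t}(size s) {-2}s (leqnn (size s)) => n {s}.
elim: n => [|n IH] [|[v w] s] sn h; rewrite ?big_nil //.
have {}sn : (size s <= n)%N by [].
have slE (r : seq (V * W)) phi :
    slice phi (\sum_(p <- r) pure p.1 p.2) = \sum_(p <- r) (phi p.1 : K) *: p.2.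
  by rewrite /slice sw_sum //; exact: bilin_slice.
have [v0|v0] := eqVneq v 0.
  rewrite big_cons /= v0 (linear_fun0 ((pure_bilin V W).1 w)) add0r.
  apply: IH => // phi; have := h phi.
  by rewrite !slE big_cons /= v0 linear0 scale0r add0r.
have [phi pv] := exists_functional v0.
(* [q] is the projection along [v]. Replacing every left entry [p.1] by [q p.1] subtracts [v] tensor
   the [phi]-slice, which is 0, and it kills the first summand because [q v = 0]. *)
pose q x := x - (phi x : K) *: v.
have ql : linear q.
  move=> a x y; rewrite /q linearP scalerBr scalerDl scalerA.
  by rewrite opprD addrACA.
have qv : q v = 0 by rewrite /q pv scale1r subrr.
have -> : \sum_(p <- (v, w) :: s) pure p.1 p.2
    = \sum_(p <- [seq (q p.1, p.2) | p <- s]) pure p.1 p.2 :> tens V W.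
  have e : \sum_(p <- (v, w) :: s) pure ((phi p.1 : K) *: v) p.2
      = 0 :> tens V W.
    transitivity (pure v (slice phi (\sum_(p <- (v, w) :: s) pure p.1 p.2))).
      rewrite slE (linear_fun_sum _ _ ((pure_bilin V W).2 v)).
      apply: eq_bigr => p _.
      by rewrite (linear_funZ _ _ ((pure_bilin V W).1 _))
                 (linear_funZ _ _ ((pure_bilin V W).2 _)).
    by rewrite h (linear_fun0 ((pure_bilin V W).2 v)).
  rewrite big_map -[LHS]subr0 -[X in _ - X]e -sumrB big_cons /=.
  rewrite pv scale1r subrr add0r; apply: eq_bigr => p _.
  rewrite /q (linear_funD _ _ ((pure_bilin V W).1 _)); congr (_ + _).
  by rewrite -!scaleN1r (linear_funZ (-1) _ ((pure_bilin V W).1 _)).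
apply: IH; first by rewrite size_map.
move=> psi.
pose g := GRing.isLinear.Build _ _ _ _ q ql.
pose qL : {linear V -> V} := HB.pack q g.
have := h (psi \o qL : {linear V -> K^o}).
by rewrite !slE big_cons big_map /= qv linear0 scale0r add0r.
Qed.

Lemma eq_slice V W (t t' : tens V W) :
  (forall phi, slice phi t = slice phi t') -> t = t'.
Proof.
move=> h; apply/eqP; rewrite -subr_eq0; apply/eqP/slice_inj => phi.
by rewrite linearB /= h subrr.
Qed.

Lemma lset_sum V (U : linsub V) I (r : seq I) (F : I -> V) :
  (forall i, U (F i)) -> U (\sum_(i <- r) F i).
Proof.
move=> h; elim: r => [|i r IH]; first by rewrite big_nil; exact: lset0.
by rewrite big_cons -[F i]scale1r; exact: lsetP.
Qed.

Lemma lset_sw V W Z (U : linsub Z) (z : tens V W) f :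
  (forall x y, U (f x y)) -> U (sw z f).
Proof. by move=> h; apply: lset_sum. Qed.

Lemma lsetZ V (U : linsub V) a x : U x -> U (a *: x).
Proof. by move=> Ux; rewrite -[_ *: _]addr0; apply: lsetP => //; exact: lset0. Qed.

Lemma lsubE V (U : linsub V) x : U x -> exists u : lsub U, x = val u.
Proof.
move=> Ux; have h : lmem U x by apply/asboolP.
by exists (exist _ x h).
Qed.

(** Extending the identity of [U] to [W] gives a projector onto [U]; this is where the ground ring
    being a field enters the membership tests. *)
Lemma linsub_projection W (U : linsub W) :
  exists g : {linear W -> lsub U}, forall w, U w -> val (g w) = w.
Proof.
have [g gP] := lin_extend (idfun : {linear lsub U -> lsub U}).
by exists g => w /lsubE[u ->]; rewrite gP.
Qed.

Section TensorSubspaces.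
Variables (V W : lmodType K).

Definition in_tensr (U : linsub W) (t : tens V W) : Prop :=
  exists s : seq (V * lsub U), t = \sum_(p <- s) pure p.1 (val p.2).

Lemma in_tensr0 U : in_tensr U 0.
Proof. by exists [::]; rewrite big_nil. Qed.

Lemma in_tensrP U a u v : in_tensr U u -> in_tensr U v -> in_tensr U (a *: u + v).
Proof.
move=> [s ->] [t ->]; exists ([seq (a *: p.1, p.2) | p <- s] ++ t).
rewrite big_cat big_map /= scaler_sumr; congr (_ + _); apply: eq_bigr => p _.
by rewrite (bilinZl _ _ _ (pure_bilin V W)).
Qed.

Definition tensr U : linsub (tens V W) := LinSub (in_tensr0 U) (@in_tensrP U).

Definition in_tensl (U : linsub V) (t : tens V W) : Prop :=
  exists s : seq (lsub U * W), t = \sum_(p <- s) pure (val p.1) p.2.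

Lemma in_tensl0 U : in_tensl U 0.
Proof. by exists [::]; rewrite big_nil. Qed.

Lemma in_tenslP U a u v : in_tensl U u -> in_tensl U v -> in_tensl U (a *: u + v).
Proof.
move=> [s ->] [t ->]; exists ([seq (p.1, a *: p.2) | p <- s] ++ t).
rewrite big_cat big_map /= scaler_sumr; congr (_ + _); apply: eq_bigr => p _.
by rewrite (linear_funZ _ _ ((pure_bilin V W).2 _)).
Qed.

Definition tensl U : linsub (tens V W) := LinSub (in_tensl0 U) (@in_tenslP U).

Lemma tensr_pure (U : linsub W) v w : U w -> tensr U (pure v w).
Proof. by move=> /lsubE[u ->]; exists [:: (v, u)]; rewrite big_seq1. Qed.

Lemma tensl_pure (U : linsub V) v w : U v -> tensl U (pure v w).
Proof. by move=> /lsubE[u ->]; exists [:: (u, w)]; rewrite big_seq1. Qed.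

Lemma tensr_full t : tensr (lfull W) t.
Proof. by rewrite -[t]pure_sw; apply: lset_sw => x y; apply: tensr_pure. Qed.

Lemma tensl_full t : tensl (lfull V) t.
Proof. by rewrite -[t]pure_sw; apply: lset_sw => x y; apply: tensl_pure. Qed.

(** The means of using an identity valid only on [U]: bilinearity allows [sw] to be computed on an
    expansion whose right entries all lie in [U], instead of the chosen one. *)
Lemma sw_tensr (U : linsub W) Z (t : tens V W) (f g : V -> W -> Z) :
  tensr U t -> bilin f -> bilin g -> (forall v w, U w -> f v w = g v w) ->
  sw t f = sw t g.
Proof.
move=> [s ->] fb gb h.
have E k : bilin k -> sw (\sum_(p <- s) pure p.1 (val p.2)) k
    = \sum_(p <- s) k p.1 (val p.2) :> Z.
  by move=> kb; rewrite (linear_fun_sum _ _ (sw_linear kb)); apply: eq_bigr => p _; rewrite sw_pure.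
by rewrite !E //; apply: eq_bigr => p _; apply: h; exact: lsubP.
Qed.

Lemma sw_tensl (U : linsub V) Z (t : tens V W) (f g : V -> W -> Z) :
  tensl U t -> bilin f -> bilin g -> (forall v w, U v -> f v w = g v w) ->
  sw t f = sw t g.
Proof.
move=> [s ->] fb gb h.
have E k : bilin k -> sw (\sum_(p <- s) pure (val p.1) p.2) k
    = \sum_(p <- s) k (val p.1) p.2 :> Z.
  by move=> kb; rewrite (linear_fun_sum _ _ (sw_linear kb)); apply: eq_bigr => p _; rewrite sw_pure.
by rewrite !E //; apply: eq_bigr => p _; apply: h; exact: lsubP.
Qed.

Lemma lset_sw_tensr (U : linsub W) Z (S : linsub Z) (t : tens V W) f :
  tensr U t -> bilin f -> (forall v w, U w -> S (f v w)) -> S (sw t f).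
Proof.
move=> [s ->] fb h.
rewrite (linear_fun_sum _ _ (sw_linear fb)); apply: lset_sum => p.
by rewrite sw_pure //; apply: h; exact: lsubP.
Qed.

Lemma lset_sw_tensl (U : linsub V) Z (S : linsub Z) (t : tens V W) f :
  tensl U t -> bilin f -> (forall v w, U v -> S (f v w)) -> S (sw t f).
Proof.
move=> [s ->] fb h.
rewrite (linear_fun_sum _ _ (sw_linear fb)); apply: lset_sum => p.
by rewrite sw_pure //; apply: h; exact: lsubP.
Qed.

(** Apply a projector onto [U] to the second factor. No slice changes, since all of them lie in [U],
    so the tensor itself is unchanged by [eq_slice]. *)
Lemma tensr_slice (U : linsub W) t :
  (forall phi : {linear V -> K^o}, U (slice phi t)) -> tensr U t.
Proof.
move=> h; have [g gP] := linsub_projection U.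
have -> : t = sw t (fun v w => pure v (val (g w))).
  apply: eq_slice => phi; rewrite -[LHS]gP // /slice.
  rewrite sw_sw; last exact: bilin_slice.
  have vl : linear (fun w => val (g w)) by move=> a x y; rewrite !linearP.
  rewrite (linear_fun_sw _ _ vl); apply: eq_sw => x y.
  by rewrite sw_pure ?(linear_funZ _ _ vl) //; exact: bilin_slice.
by apply: lset_sw => x y; apply: tensr_pure; exact: lsubP.
Qed.

Lemma slice_tensr (U : linsub W) (t : tens V W) phi : tensr U t -> U (slice phi t).
Proof.
by move=> h; apply: (lset_sw_tensr h) => [|v w]; [exact: bilin_slice | exact: lsetZ].
Qed.

End TensorSubspaces.

Arguments tensr {V W} U.
Arguments tensl {V W} U.

Lemma tensl_flip V W (U : linsub V) (t : tens V W) : tensl U t <-> tensr U (flip t).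
Proof.
split=> h.
  by apply: (lset_sw_tensl h) => [|v w Uv]; [lin | exact: tensr_pure].
have -> : t = sw (flip t) (fun w v => pure v w).
  by rewrite /flip; etransitivity; [exact: esym (pure_sw t) | symmetry; nrm].
by apply: (lset_sw_tensr h) => [|v w Uv]; [lin | exact: tensl_pure].
Qed.

(** Membership of the last factor does not depend on the bracketing of the factors before it. *)
Lemma tensr_assoc V X Y (U : linsub Y) (t : tens V (tens X Y)) :
  tensr U (\sw_(v, z <- t) \sw_(x, y <- z) (v \ot x) \ot y) ->
  tensr (tensr U) t.
Proof.
set t' := sw t _ => h.
have -> : t = \sw_(w, y <- t') \sw_(v, x <- w) v \ot x \ot y.
  rewrite -[LHS]pure_sw /t'; symmetry; etransitivity; [nrm|].
  by apply: eq_sw => v z; rewrite -[z in RHS]pure_sw pure_swr.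
apply: (lset_sw_tensr h) => [|w y Uy]; first by lin.
by apply: lset_sw => v x; do 2!apply: tensr_pure.
Qed.

Section Cotensor.
Variables (X Y D : lmodType K) (r : {linear X -> tens X D}) (l : {linear Y -> tens D Y}).

Lemma cotensor_r (V : linsub Y) z :
  cotensor (lfull X) V r l z <-> tensr V z /\ cot_right r z = cot_left l z.
Proof.
split=> -[h e]; split=> //.
  by case: h => s ->; apply: lset_sum => p; apply: tensr_pure; exact: lsubP.
case: h => s ->.
exists [seq (exist _ p.1 (asboolT I) : lsub (lfull X), p.2) | p <- s].
by rewrite big_map.
Qed.

Lemma cotensor_l (U : linsub X) z :
  cotensor U (lfull Y) r l z <-> tensl U z /\ cot_right r z = cot_left l z.
Proof.
split=> -[h e]; split=> //.
  by case: h => s ->; apply: lset_sum => p; apply: tensl_pure; exact: lsubP.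
case: h => s ->.
exists [seq (p.1, exist _ p.2 (asboolT I) : lsub (lfull Y)) | p <- s].
by rewrite big_map.
Qed.

Lemma cotensor_full z :
  cotensor (lfull X) (lfull Y) r l z <-> cot_right r z = cot_left l z.
Proof.
by rewrite cotensor_r; split=> [[]|] //; split=> //; exact: tensr_full.
Qed.

(** Exactness of [W] tensor a vector space: the equalizer condition may be tested with the spectator
    [W] attached, because each slice of the equation is the equation for the slice. *)
Lemma tensr_cotensor (V : linsub Y) W (t : tens W (tens X Y)) :
  tensr (tensr V) t ->
  \sw_(w, z <- t) w \ot cot_right r z = \sw_(w, z <- t) w \ot cot_left l z ->
  tensr (cotensor (lfull X) V r l) t.
Proof.
move=> h e; apply: tensr_slice => phi; apply/cotensor_r; split.
  exact: slice_tensr.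
have crl := cot_right_linear r (Y := Y); have cll := cot_left_linear l (X := X).
have := congr1 (slice phi) e; rewrite /slice.
do 2![rewrite sw_sw; last exact: bilin_slice].
rewrite (linear_fun_sw _ _ crl) (linear_fun_sw _ _ cll).
move=> {}e; etransitivity; [|etransitivity; [exact: e|]];
  apply: eq_sw => x y; rewrite sw_pure ?(linear_funZ _ _ crl) ?(linear_funZ _ _ cll) //;
  exact: bilin_slice.
Qed.

Lemma tensr_cotensor_full W (t : tens W (tens X Y)) :
  \sw_(w, z <- t) w \ot cot_right r z = \sw_(w, z <- t) w \ot cot_left l z ->
  tensr (cotensor (lfull X) (lfull Y) r l) t.
Proof.
move=> h; apply: tensr_cotensor h; rewrite -[t]pure_sw.
by apply: lset_sw => x y; apply: tensr_pure; exact: tensr_full.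
Qed.

Lemma tensr_cotensor_l (U : linsub X) W (t : tens W (tens X Y)) :
  tensr (tensl U) t ->
  \sw_(w, z <- t) w \ot cot_right r z = \sw_(w, z <- t) w \ot cot_left l z ->
  tensr (cotensor U (lfull Y) r l) t.
Proof.
move=> h e; apply: tensr_slice => phi; apply/cotensor_l; split.
  exact: slice_tensr.
have /(slice_tensr phi) := tensr_cotensor_full e.
by move=> /cotensor_full.
Qed.

End Cotensor.
End Slices.

Arguments tensr {K V W} U.
Arguments tensl {K V W} U.

(** * Bicoalgebroids *)

(** Connects [papp] with the genuine operation: [lext f] is linear on the whole space and agrees
    with [f] on [P], so its arbitrary values cancel in the sum over an element of [P]. *)
Lemma sw_papp (K : fieldType) (X Y Z : lmodType K) (P : linsub (tens X Y))
    (f : {linear lsub P -> Z}) (x : tens X Y) (u : lsub P) : x = val u ->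
  sw x (papp f) = f u.
Proof.
move=> ->; rewrite -lextE -[in RHS](pure_sw (val u)) app_sw.
by apply: eq_sw.
Qed.

Lemma eq_eq_iff (T : Type) (a b a' b' : T) : a = a' -> b = b' -> a = b <-> a' = b'.
Proof. by move=> -> ->. Qed.

Section Bicoalgebroid.
Variables (K : fieldType) (C : coalgebra K) (B : bicoalgebroid C).
Implicit Types (Z : lmodType K) (b : B) (c : C).

Lemma alphaE Z (F : C -> C -> Z) b : bilin F ->
  sw (cDelta (alpha b)) F = \sw_(b1, b2 <- cDelta b) F (alpha b1) (alpha b2).
Proof. by move=> Fb; rewrite (alphaP B).1; nrm. Qed.

Lemma betaE Z (F : C -> C -> Z) b : bilin F ->
  sw (cDelta (beta b)) F = \sw_(b1, b2 <- cDelta b) F (beta b2) (beta b1).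
Proof. by move=> Fb; rewrite (betaP B).1; nrm. Qed.

Lemma alpha_betaE Z (F : C -> C -> Z) b : bilin F ->
  \sw_(b1, b2 <- cDelta b) F (alpha b1) (beta b2) =
  \sw_(b1, b2 <- cDelta b) F (alpha b2) (beta b1).
Proof.
move=> Fb; have := congr_sw F (alpha_beta b) => e.
by etransitivity; [|etransitivity; [exact: e|nrm]]; symmetry; nrm.
Qed.

Lemma eta_colinrE Z (F : B -> C -> Z) c : bilin F ->
  \sw_(h1, h2 <- cDelta (eta c : B)) F h1 (alpha h2) =
  \sw_(c1, c2 <- cDelta c) F (eta c1) c2.
Proof.
move=> Fb; have := congr_sw F (eta_colinr B c) => e.
by etransitivity; [|etransitivity; [exact: e|nrm]]; symmetry; nrm.
Qed.

Lemma eta_colinlE Z (F : C -> B -> Z) c : bilin F ->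
  \sw_(h1, h2 <- cDelta (eta c : B)) F (beta h2) h1 =
  \sw_(c1, c2 <- cDelta c) F c1 (eta c2).
Proof.
move=> Fb; have := congr_sw F (eta_colinl B c) => e.
by etransitivity; [|etransitivity; [exact: e|nrm]]; symmetry; nrm.
Qed.

(** Apply the counit to the first leg of the right colinearity of [eta], then use that [eta]
    preserves the counit. *)
Lemma alpha_eta c : alpha (eta c : B) = c.
Proof.
transitivity (\sw_(h1, h2 <- cDelta (eta c : B)) (ceps h1 : K) *: alpha h2).
  by symmetry; apply: epslE; lin.
rewrite (eta_colinrE (F := fun h c' => (ceps h : K) *: c')); last by lin.
rewrite -[RHS](cepsl c); apply: eq_sw => x y; congr (_ *: _); exact: eta_eps.
Qed.

(** Apply [alpha] to the first leg of [eta_Delta_beta] and cancel [alpha] against [eta]. *)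
Lemma eta_alpha_betaE Z (F : C -> B -> Z) c : bilin F ->
  \sw_(h1, h2 <- cDelta (eta c : B)) F (alpha h1) h2 =
  \sw_(h1, h2 <- cDelta (eta c : B)) F (beta h1) h2.
Proof.
move=> Fb; rewrite {1}eta_Delta_beta; nrm2; apply: eq_sw => x y.
by rewrite alpha_eta.
Qed.

Lemma BBE (x : tens B B) : BB B x <->
  \sw_(b, b' <- x) \sw_(b1, b2 <- cDelta b) b1 \ot alpha b2 \ot b' =
  \sw_(b, b' <- x) \sw_(b1, b2 <- cDelta b') b \ot beta b2 \ot b1.
Proof.
rewrite /BB cotensor_full; apply: eq_eq_iff.
- by nrm.
- by nrm.
Qed.

Lemma mu_sw (x : tens B B) : BB B x ->
  exists2 u : lsub (BB B), x = val u & sw x (papp mu) = mu u.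
Proof. by move=> /lsubE[u xu]; exists u => //; exact: sw_papp. Qed.

Lemma mu_alpha_betaE Z (F : B -> C -> Z) (x : tens B B) : BB B x -> bilin F ->
  \sw_(b, b' <- x) \sw_(b'1, b'2 <- cDelta b') F (papp mu b b'2) (beta b'1) =
  \sw_(b, b' <- x) \sw_(b1, b2 <- cDelta b) F (papp mu b2 b') (alpha b1).
Proof.
move=> /mu_sw[u -> _] Fb; have := congr_sw F (mu_alpha_beta u) => e.
by etransitivity; [|etransitivity; [exact: e|nrm]]; symmetry; nrm.
Qed.

Lemma mu_DeltaE Z (F : B -> B -> Z) (x : tens B B) : BB B x -> bilin F ->
  \sw_(b, b' <- x) sw (cDelta (papp mu b b')) F =
  \sw_(b, b' <- x) \sw_(b1, b2 <- cDelta b) \sw_(b'1, b'2 <- cDelta b')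
    F (papp mu b1 b'1) (papp mu b2 b'2).
Proof.
move=> /mu_sw[u -> e] Fb.
transitivity (sw (cDelta (sw (val u) (papp mu))) F); first by symmetry; nrm.
by rewrite e mu_Delta; nrm.
Qed.

Lemma mu_epsE Z (F : Z) (x : tens B B) : BB B x ->
  \sw_(b, b' <- x) (ceps (papp mu b b') : K) *: F =
  \sw_(b, b' <- x) (ceps b : K) *: ((ceps b' : K) *: F).
Proof.
move=> /mu_sw[u -> e].
transitivity ((ceps (sw (val u) (papp mu)) : K) *: F).
  by symmetry; rewrite (linear_fun_sw _ _ (linear_scalar ceps (@linear_id _ _))) scale_swl.
rewrite e mu_eps scale_swl; apply: eq_sw => b b'; exact: esym (scalerA _ _ _).
Qed.

(** Both coactions give $b^{(1)}\otimes\alpha(b^{(2)})\otimes\eta(\alpha(b^{(3)}))$: on the right by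
    left colinearity of [eta] and comultiplicativity of [alpha]. *)
Lemma BB_eta b : BB B (\sw_(b1, b2 <- cDelta b) b1 \ot eta (alpha b2)).
Proof.
apply/BBE; nrm2.
symmetry; etransitivity.
  by apply: eq_sw => b1 b2; apply: (eta_colinlE (F := fun c h => b1 \ot c \ot h)); lin.
swr (apply: alphaE); symmetry; apply: coassocE; lin.
Qed.

(** The case of [B] acting on itself: the right member is the canonical left coaction of that
    module. [mu_alpha_beta] on the tensor of [BB_eta] moves the component of [eta] to [b], and the
    right unit law removes [eta]. *)
Lemma eta_Delta_act Z (F : C -> B -> Z) b : bilin F ->
  \sw_(b1, b2 <- cDelta b) F (alpha b1) b2 =
  \sw_(b1, b2 <- cDelta b) \sw_(h1, h2 <- cDelta (eta (alpha b2)))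
    F (alpha h1) (papp mu b1 h2).
Proof.
move=> Fb; have := mu_alpha_betaE (F := fun v w => F w v) (BB_eta b).
move=> /(_ ltac:(lin)) e.
symmetry; etransitivity.
  apply: eq_sw => b1 b2; apply: (eta_alpha_betaE (F := fun u v => F u (papp mu b1 v))); lin.
etransitivity; [|etransitivity; [exact: e|]]; first by symmetry; nrm.
etransitivity; [nrm|].
swr (apply: coassocE).
apply: eq_sw => b1 b2.
by rewrite -[in RHS](mu_etar b2) (linear_fun_sw _ _ (Fb.2 _)).
Qed.

(* The C-coactions [lC] and [rC] commute. *)
Lemma beta_alpha_shift Z (F : B -> C -> C -> Z) b : trilin F ->
  \sw_(b1, b2 <- cDelta b) \sw_(b11, b12 <- cDelta b1) F b11 (alpha b12) (beta b2) =
  \sw_(b1, b2 <- cDelta b) \sw_(b11, b12 <- cDelta b1) F b11 (alpha b2) (beta b12).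
Proof.
move=> Ft.
swr (apply: (coassocE (F := fun u v w => F u (alpha v) (beta w)))).
swr_rhs (apply: (coassocE (F := fun u v w => F u (alpha w) (beta v)))).
by apply: eq_sw => b1 b2; apply: (alpha_betaE (F := F b1)); lin.
Qed.

(** Right colinearity of [mu] together with the counit expresses $\alpha(bb')$ as
    $\varepsilon(bb'^{(1)})\alpha(b'^{(2)})$; multiplicativity of the counit then finishes. *)
Lemma mu_alphaE Z (F : C -> Z) (x : tens B B) : BB B x -> linear F ->
  \sw_(b, b' <- x) F (alpha (papp mu b b')) =
  \sw_(b, b' <- x) (ceps b : K) *: F (alpha b').
Proof.
move=> Bx Fl; have [u xu e] := mu_sw Bx.
have := congr_sw (fun v w => (ceps v : K) *: F w) (mu_colinr u).
move=> e'.
transitivity (F (alpha (mu u))); first by rewrite -e; symmetry; nrm.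
transitivity (\sw_(h1, h2 <- cDelta (mu u : B)) (ceps h1 : K) *: F (alpha h2)).
  by symmetry; apply: epslE; lin.
etransitivity; [|etransitivity; [exact: e'|]]; first by symmetry; nrm.
etransitivity; [nrm|]; rewrite -xu.
(* The value of [F] becomes the spectator, leaving $b\otimes b'^{(1)}$ to which [mu_epsE] applies.
   That this lies in [BB B] follows from [beta_alpha_shift]. *)
pose t := \sw_(b, b' <- x) \sw_(b1, b2 <- cDelta b') F (alpha b2) \ot b \ot b1.
transitivity (\sw_(z, y <- t) \sw_(b, b' <- y) (ceps (papp mu b b') : K) *: z).
  by symmetry; rewrite /t; nrm.
transitivity (\sw_(z, y <- t) \sw_(b, b' <- y) (ceps b : K) *: ((ceps b' : K) *: z)).
  apply: (sw_tensr (U := BB B)); [|lin|lin|by move=> v w; apply: mu_epsE].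
  apply: tensr_cotensor_full; rewrite /t; nrm2.
  have := eq_tens3 (fun b c b' => \sw_(b1, b2 <- cDelta b')
    F (alpha b2) \ot b \ot c \ot b1) ((BBE x).1 Bx) => {}e.
  etransitivity; [|etransitivity; [exact: e|]]; first by symmetry; swt.
  nrm2; apply: eq_sw => b b'.
  apply: (beta_alpha_shift (F := fun u v w => F v \ot b \ot w \ot u)); lin.
rewrite /t; etransitivity; [nrm|]; apply: eq_sw => b b'.
etransitivity; [symmetry; apply: (linear_fun_sw (g := fun z : Z => (ceps b : K) *: z)); lin|].
by congr (_ *: _); apply: epslE; lin.
Qed.

(** Mirror image of [mu_alphaE], with left colinearity of [mu] in place of right colinearity. *)
Lemma mu_betaE Z (F : C -> Z) (x : tens B B) : BB B x -> linear F ->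
  \sw_(b, b' <- x) F (beta (papp mu b b')) =
  \sw_(b, b' <- x) (ceps b' : K) *: F (beta b).
Proof.
move=> Bx Fl; have [u xu e] := mu_sw Bx.
have := congr_sw (fun v w => (ceps w : K) *: F v) (mu_colinl u).
move=> e'.
transitivity (F (beta (mu u))); first by rewrite -e; symmetry; nrm.
transitivity (\sw_(h1, h2 <- cDelta (mu u : B)) (ceps h1 : K) *: F (beta h2)).
  by symmetry; apply: epslE; lin.
etransitivity; [|etransitivity; [exact: e'|]]; first by symmetry; nrm.
etransitivity; [nrm|]; rewrite -xu.
pose t := \sw_(b, b' <- x) \sw_(b1, b2 <- cDelta b) F (beta b2) \ot b1 \ot b'.
transitivity (\sw_(z, y <- t) \sw_(b, b' <- y) (ceps (papp mu b b') : K) *: z).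
  by symmetry; rewrite /t; nrm.
transitivity (\sw_(z, y <- t) \sw_(b, b' <- y) (ceps b : K) *: ((ceps b' : K) *: z)).
  apply: (sw_tensr (U := BB B)); [|lin|lin|by move=> v w; apply: mu_epsE].
  apply: tensr_cotensor_full; rewrite /t; nrm2.
  have := eq_tens3 (fun b c b' => \sw_(b1, b2 <- cDelta b)
    F (beta b2) \ot b1 \ot c \ot b') ((BBE x).1 Bx) => {}e.
  etransitivity; [|etransitivity; [exact: e|]]; last by swt.
  nrm2; apply: eq_sw => b b'.
  apply: (beta_alpha_shift (F := fun u v w => F w \ot u \ot v \ot b')); lin.
rewrite /t; etransitivity; [nrm|]; apply: eq_sw => b b'.
etransitivity; last first.
  by apply: (epslE (F := fun b => (ceps b' : K) *: F (beta b))); lin.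
by [].
Qed.

Lemma muAE Z (F : B -> Z) (x : tens B (tens B B)) : BBB B x -> linear F ->
  \sw_(b, y <- x) \sw_(b', b'' <- y) F (papp mu (papp mu b b') b'') =
  \sw_(b, y <- x) \sw_(b', b'' <- y) F (papp mu b (papp mu b' b'')).
Proof.
move=> Bx Fl; have := congr1 F (muA Bx) => e.
by etransitivity; [|etransitivity; [exact: e|nrm]]; symmetry; nrm.
Qed.

Lemma BB_slice V (t : tens V (tens B B)) :
  \sw_(v, x <- t) \sw_(b, b' <- x) \sw_(b1, b2 <- cDelta b)
    v \ot b1 \ot alpha b2 \ot b' =
  \sw_(v, x <- t) \sw_(b, b' <- x) \sw_(b1, b2 <- cDelta b')
    v \ot b \ot beta b2 \ot b1 ->
  tensr (BB B) t.
Proof.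
move=> e; apply: tensr_cotensor_full.
by etransitivity; [|etransitivity; [exact: e|]]; [|symmetry]; nrm.
Qed.

Lemma BBB_slice V (t : tens V (tens B (tens B B))) :
  tensr (BB B) (\sw_(v, z <- t) \sw_(b, y <- z) (v \ot b) \ot y) ->
  \sw_(v, x <- t) \sw_(b, y <- x) \sw_(b', b'' <- y) \sw_(b1, b2 <- cDelta b)
    v \ot b1 \ot alpha b2 \ot b' \ot b'' =
  \sw_(v, x <- t) \sw_(b, y <- x) \sw_(b', b'' <- y) \sw_(b1, b2 <- cDelta b')
    v \ot b \ot beta b2 \ot b1 \ot b'' ->
  tensr (BBB B) t.
Proof.
move=> /tensr_assoc h e; apply: tensr_cotensor => //.
etransitivity; [|etransitivity; [exact: e|symmetry; nrm]].
nrm2; apply: eq_sw => v x; apply: eq_sw => b y.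
by rewrite -[y in LHS]pure_sw; swt.
Qed.

End Bicoalgebroid.

Lemma flipK (K : fieldType) (X Y : lmodType K) (z : tens X Y) : flip (flip z) = z.
Proof. by rewrite -[RHS]pure_sw; nrm. Qed.

(** * Stable modules *)

Section Module.
Variables (K : fieldType) (C : coalgebra K) (B : hopf_coalgebra C).
Variable (M : rmodule B).
Implicit Types (Z : lmodType K) (b : B) (c : C) (m : M).
Local Notation etaB := (@eta K C B).

Definition MBB : linsub (tens M (tens B B)) :=
  cotensor (lfull M) (BB B) (@rm_coact _ _ _ M) (lcoact1 lC).

Lemma MBE (x : tens M B) : MB M x <->
  \sw_(m, b <- x) \sw_(m0, c <- rm_coact m) m0 \ot c \ot b =
  \sw_(m, b <- x) \sw_(b1, b2 <- cDelta b) m \ot beta b2 \ot b1.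
Proof.
rewrite /MB cotensor_full; apply: eq_eq_iff; by nrm.
Qed.

Lemma MB_slice V (t : tens V (tens M B)) :
  \sw_(v, x <- t) \sw_(m, b <- x) \sw_(m0, c <- rm_coact m)
    v \ot m0 \ot c \ot b =
  \sw_(v, x <- t) \sw_(m, b <- x) \sw_(b1, b2 <- cDelta b)
    v \ot m \ot beta b2 \ot b1 ->
  tensr (MB M) t.
Proof.
move=> e; apply: tensr_cotensor_full.
by etransitivity; [|etransitivity; [exact: e|]]; [|symmetry]; nrm.
Qed.

Lemma MBB_slice V (t : tens V (tens M (tens B B))) :
  tensr (BB B) (\sw_(v, z <- t) \sw_(m, y <- z) (v \ot m) \ot y) ->
  \sw_(v, x <- t) \sw_(m, y <- x) \sw_(b, b' <- y) \sw_(m0, c <- rm_coact m)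
    v \ot m0 \ot c \ot b \ot b' =
  \sw_(v, x <- t) \sw_(m, y <- x) \sw_(b, b' <- y) \sw_(b1, b2 <- cDelta b)
    v \ot m \ot beta b2 \ot b1 \ot b' ->
  tensr MBB t.
Proof.
move=> /tensr_assoc h e; apply: tensr_cotensor => //.
etransitivity; [|etransitivity; [exact: e|symmetry; nrm]].
nrm2; apply: eq_sw => v x; apply: eq_sw => b y.
by rewrite -[y in LHS]pure_sw; swt.
Qed.

Lemma act_sw (x : tens M B) : MB M x ->
  exists2 u : lsub (MB M), x = val u & sw x (papp rm_act) = rm_act u.
Proof. by move=> /lsubE[u xu]; exists u => //; exact: sw_papp. Qed.

Lemma act_colinE Z (F : M -> C -> Z) (x : tens M B) : MB M x -> bilin F ->
  \sw_(m, b <- x) sw (rm_coact (papp rm_act m b)) F =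
  \sw_(m, b <- x) \sw_(b1, b2 <- cDelta b) F (papp rm_act m b1) (alpha b2).
Proof.
move=> /act_sw[u -> e] Fb.
transitivity (sw (rm_coact (sw (val u) (papp rm_act))) F); first by symmetry; nrm.
by rewrite e rm_act_colin; nrm.
Qed.

Lemma actAE Z (F : M -> Z) (x : tens M (tens B B)) : MBB x -> linear F ->
  \sw_(m, y <- x) \sw_(b, b' <- y) F (papp rm_act (papp rm_act m b) b') =
  \sw_(m, y <- x) \sw_(b, b' <- y) F (papp rm_act m (papp mu b b')).
Proof.
move=> Bx Fl; have := congr1 F (rm_actA Bx) => e.
by etransitivity; [|etransitivity; [exact: e|nrm]]; symmetry; nrm.
Qed.

Lemma act1E Z (F : M -> Z) m : linear F ->
  \sw_(m0, c <- rm_coact m) F (papp rm_act m0 (eta c)) = F m.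
Proof. by move=> Fl; rewrite -[in RHS](rm_act1 m); symmetry; nrm. Qed.

(** Colinearity of the action turns the $C$-component of $m\triangleleft b$ into $\alpha(b^{(2)})$;
    associativity carries the resulting unit element into [B], where [eta_Delta_act] evaluates
    it. *)
Lemma lcoact_act Z (F : C -> M -> Z) (x : tens M B) : MB M x -> bilin F ->
  \sw_(m, b <- x) \sw_(m0, c <- rm_coact (papp rm_act m b))
    \sw_(h1, h2 <- cDelta (etaB c)) F (alpha h1) (papp rm_act m0 h2) =
  \sw_(m, b <- x) \sw_(b1, b2 <- cDelta b) F (alpha b1) (papp rm_act m b2).
Proof.
move=> Mx Fb.
rewrite (act_colinE (F := fun m0 c => \sw_(h1, h2 <- cDelta (etaB c))
    F (alpha h1) (papp rm_act m0 h2)) Mx); last by lin.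
(* The spectator is $\alpha(h^{(1)})$ with $h=\eta(\alpha(b^{(2)}))$; the rest, $m\otimes
   b^{(1)}\otimes h^{(2)}$, must be shown to lie in [MBB] before associativity of the action can be
   applied. *)
pose t := \sw_(m, b <- x) \sw_(b1, b2 <- cDelta b)
  \sw_(h1, h2 <- cDelta (etaB (alpha b2))) alpha h1 \ot m \ot b1 \ot h2.
transitivity (\sw_(v, w <- t) \sw_(m, y <- w) \sw_(b, b' <- y)
    F v (papp rm_act (papp rm_act m b) b')).
  by symmetry; rewrite /t; nrm.
transitivity (\sw_(v, w <- t) \sw_(m, y <- w) \sw_(b, b' <- y)
    F v (papp rm_act m (papp mu b b'))).
  apply: (sw_tensr (U := MBB)); [|lin|lin|]; last first.
    by move=> v w Mw; apply: (actAE (F := F v)) => //; lin.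
  apply: MBB_slice; rewrite /t.
    apply: BB_slice; nrm2; apply: eq_sw => m b; symmetry.
    etransitivity.
      apply: eq_sw => b1 b2.
      lhs <- (coassocE (F := fun u v w : B =>
          (alpha u \ot m) \ot b1 \ot beta w \ot v) _ _).
      lhs (eta_colinlE (F := fun c h => \sw_(h1, h2 <- cDelta h)
          (alpha h1 \ot m) \ot b1 \ot c \ot h2) _ _).
      by apply: alphaE; lin.
    lhs <- (coassocE (F := fun u v w : B => \sw_(h1, h2 <- cDelta (etaB (alpha w)))
      (alpha h1 \ot m) \ot u \ot alpha v \ot h2) _ _).
    by swmatch.
  nrm2.
  have := eq_tens3 (fun m c b => \sw_(b1, b2 <- cDelta b)
    \sw_(h1, h2 <- cDelta (etaB (alpha b2))) alpha h1 \ot m \ot c \ot b1 \ot h2)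
    ((MBE x).1 Mx) => e.
  etransitivity; [|etransitivity; [exact: e|]]; first by symmetry; swt.
  nrm2; apply: eq_sw => m b.
  lhs (beta_alpha_shift (F := fun u v w => \sw_(h1, h2 <- cDelta (etaB v))
    alpha h1 \ot m \ot w \ot u \ot h2) _ _).
  by swmatch.
rewrite /t; etransitivity; [nrm|]; apply: eq_sw => m b.
symmetry; apply: (eta_Delta_act (F := fun u v => F u (papp rm_act m v))); lin.
Qed.

End Module.

Section StableModule.
Variables (K : fieldType) (C : coalgebra K) (B : hopf_coalgebra C).
Variables (M : rlmodule B) (M_stable : stable M).
Implicit Types (Z : lmodType K) (b : B) (c : C) (m : M).
Local Notation etaB := (@eta K C B).

Lemma lam_MB m : MB M (flip (lam m)).
Proof. by have [x <- _] := M_stable m; exact: lsubP. Qed.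

Lemma stableE Z (F : M -> Z) m : linear F ->
  \sw_(b, m0 <- lam m) F (papp rm_act m0 b) = F m.
Proof.
move=> Fl; have [x xm {2}<-] := M_stable m.
by rewrite -(sw_papp rm_act (esym xm)); symmetry; nrm.
Qed.

(** Stability includes the membership [lam_MB]; applying the counit to its [B]-leg gives the
    formula. *)
Lemma rm_coactE Z (F : M -> C -> Z) m : bilin F ->
  sw (rm_coact m) F = \sw_(b, m0 <- lam m) F m0 (beta b).
Proof.
move=> Fb.
have := eq_tens3 (fun m c b => (ceps b : K) *: F m c) ((MBE _).1 (lam_MB m)) => e.
transitivity (\sw_(b, m0 <- lam m) (ceps b : K) *: sw (rm_coact m0) F).
  by symmetry; apply: (lcounitE (F := fun m => sw (rm_coact m) F)) (lamP M) _; lin.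
etransitivity; [|etransitivity; [exact: e|]]; first by symmetry; swt.
etransitivity; [nrm|]; apply: eq_sw => b m0.
apply: (epslE (F := fun b => F m0 (beta b))); lin.
Qed.

(** Write $m=m_{[0]}\triangleleft m_{[-1]}$ and compute the canonical coaction of this product by
    [lcoact_act]; coassociativity of [lam] then exposes a second product, which stability
    contracts. *)
Lemma stable_lcoact Z (F : C -> M -> Z) m : bilin F ->
  \sw_(m0, c <- rm_coact m) \sw_(h1, h2 <- cDelta (etaB c))
    F (alpha h1) (papp rm_act m0 h2) =
  \sw_(b, m0 <- lam m) F (alpha b) m0.
Proof.
move=> Fb; have e := lcoact_act (lam_MB m) Fb.
transitivity (\sw_(m0, c <- rm_coact (\sw_(b, m0 <- lam m) papp rm_act m0 b))
  \sw_(h1, h2 <- cDelta (etaB c)) F (alpha h1) (papp rm_act m0 h2)).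
  by rewrite (stableE (F := fun m => m)).
etransitivity; [|etransitivity; [exact: e|]]; first by swt.
etransitivity; [nrm|].
etransitivity; first by apply: (lcoassocE
  (F := fun u v m => F (alpha u) (papp rm_act m v))) (lamP M) _; lin.
by apply: eq_sw => b m0; apply: (stableE (F := F (alpha b))); lin.
Qed.

(* By [stable_lcoact] the tensor alpha(m_{-1}) (x) m_0 is
   alpha(h_1) (x) m_<0> <| h_2 for h = eta(m_<1>), and [mu_alpha_beta] for
   h (x) b moves the C-component from h to b. *)
Lemma lam_actE Z (F : C -> M -> Z) (x : tens M B) : MB M x -> bilin F ->
  \sw_(m, b <- x) \sw_(b', m0 <- lam m) F (alpha b') (papp rm_act m0 b) =
  \sw_(m, b <- x) \sw_(b1, b2 <- cDelta b) F (beta b1) (papp rm_act m b2).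
Proof.
move=> Mx Fb.
have XE (W : lmodType K) (G : M -> C -> B -> W) : trilin G ->
    \sw_(m, b <- x) \sw_(m0, c <- rm_coact m) G m0 c b =
    \sw_(m, b <- x) \sw_(b1, b2 <- cDelta b) G m (beta b2) b1.
  move=> Gt; have := eq_tens3 G ((MBE x).1 Mx) => e.
  by etransitivity; [|etransitivity; [exact: e|nrm]]; symmetry; nrm.
etransitivity.
  apply: eq_sw => m b; symmetry.
  apply: (stable_lcoact (F := fun u v => F u (papp rm_act v b))); lin.
cbn beta.
(* First use of associativity, with $\alpha(h^{(1)})$ as spectator: $(m\triangleleft
   h^{(2)})\triangleleft b$ becomes $m\triangleleft(h^{(2)}b)$. *)
pose t1 := \sw_(m, b <- x) \sw_(m0, c <- rm_coact m) \sw_(h1, h2 <- cDelta (etaB c))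
  alpha h1 \ot m0 \ot h2 \ot b.
transitivity (\sw_(v, w <- t1) \sw_(m, y <- w) \sw_(b, b' <- y)
    F v (papp rm_act (papp rm_act m b) b')).
  by symmetry; rewrite /t1; nrm.
transitivity (\sw_(v, w <- t1) \sw_(m, y <- w) \sw_(b, b' <- y)
    F v (papp rm_act m (papp mu b b'))).
  apply: (sw_tensr (U := MBB M)); [|lin|lin|]; last first.
    by move=> v w Mw; apply: (actAE (F := F v)) => //; lin.
  apply: MBB_slice; rewrite /t1.
    apply: BB_slice; nrm2.
    etransitivity.
      apply: eq_sw => m b; etransitivity.
        apply: eq_sw => m0 c.
        lhs <- (coassocE (F := fun u v w : B =>
          (alpha u \ot m0) \ot v \ot alpha w \ot b) _ _).
        by apply: (eta_colinrE (F := fun h c' => \sw_(h1, h2 <- cDelta h)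
          (alpha h1 \ot m0) \ot h2 \ot c' \ot b)); lin.
      lhs <- (rcoassocE (F := fun m0 c1 c2 => \sw_(h1, h2 <- cDelta (etaB c1))
        (alpha h1 \ot m0) \ot h2 \ot c2 \ot b) _ (rm_coactP M) _).
      by [].
    lhs (XE _ (fun m c b => \sw_(m0, c1 <- rm_coact m)
      \sw_(h1, h2 <- cDelta (etaB c1)) (alpha h1 \ot m0) \ot h2 \ot c \ot b) _).
    by swmatch.
  nrm2; apply: eq_sw => m b; symmetry; etransitivity.
    apply: eq_sw => m0 c.
    lhs <- (coassocE (F := fun u v w : B =>
      alpha u \ot m0 \ot beta w \ot v \ot b) _ _).
    by apply: (eta_colinlE (F := fun c' h => \sw_(h1, h2 <- cDelta h)
      alpha h1 \ot m0 \ot c' \ot h2 \ot b)); lin.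
  lhs <- (rcoassocE (F := fun m0 c1 c2 => \sw_(h1, h2 <- cDelta (etaB c2))
    alpha h1 \ot m0 \ot c1 \ot h2 \ot b) _ (rm_coactP M) _).
  by swmatch.
(* Here only $h\otimes b$ is isolated; it lies in [BB B] because $x$ is balanced over $C$, and
   [mu_alpha_beta] exchanges $\alpha(h^{(1)})$ for $\beta(b^{(1)})$. *)
pose t2 := \sw_(m, b <- x) \sw_(m0, c <- rm_coact m) m0 \ot etaB c \ot b.
transitivity (\sw_(m, y <- t2) \sw_(h, b <- y) \sw_(h1, h2 <- cDelta h)
    F (alpha h1) (papp rm_act m (papp mu h2 b))).
  by rewrite /t1 /t2; swt.
transitivity (\sw_(m, y <- t2) \sw_(h, b <- y) \sw_(b1, b2 <- cDelta b)
    F (beta b1) (papp rm_act m (papp mu h b2))).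
  symmetry; apply: (sw_tensr (U := BB B)); [|lin|lin|]; last first.
    move=> m y By; apply: (mu_alpha_betaE (F := fun v u => F u (papp rm_act m v))) => //; lin.
  apply: BB_slice; rewrite /t2; nrm2.
  etransitivity.
    apply: eq_sw => m b; etransitivity.
      apply: eq_sw => m0 c.
      by apply: (eta_colinrE (F := fun h c' => m0 \ot h \ot c' \ot b)); lin.
    lhs <- (rcoassocE (F := fun m0 c1 c2 => m0 \ot etaB c1 \ot c2 \ot b) _
      (rm_coactP M) _).
    by [].
  lhs (XE _ (fun m c b => \sw_(m0, c1 <- rm_coact m) m0 \ot etaB c1 \ot c \ot b) _).
  by swmatch.
(* Associativity in the opposite direction with $\beta(b^{(1)})$ as spectator, after which
   $m_{\langle0\rangle}\triangleleft\eta(m_{\langle1\rangle})$ contracts to $m$. *)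
pose t3 := \sw_(m, b <- x) \sw_(m0, c <- rm_coact m) \sw_(b1, b2 <- cDelta b)
  beta b1 \ot m0 \ot etaB c \ot b2.
transitivity (\sw_(v, w <- t3) \sw_(m, y <- w) \sw_(b, b' <- y)
    F v (papp rm_act m (papp mu b b'))).
  by rewrite /t2 /t3; swt.
transitivity (\sw_(v, w <- t3) \sw_(m, y <- w) \sw_(b, b' <- y)
    F v (papp rm_act (papp rm_act m b) b')).
  symmetry; apply: (sw_tensr (U := MBB M)); [|lin|lin|]; last first.
    by move=> v w Mw; apply: (actAE (F := F v)) => //; lin.
  apply: MBB_slice; rewrite /t3.
    apply: BB_slice; nrm2.
    etransitivity.
      apply: eq_sw => m b; etransitivity.
        apply: eq_sw => m0 c; apply: eq_sw => b1 b2.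
        by apply: (eta_colinrE (F := fun h c' =>
          (beta b1 \ot m0) \ot h \ot c' \ot b2)); lin.
      etransitivity; last first.
        symmetry; refine (rcoassocE (F := fun m0 c1 c2 => \sw_(b1, b2 <- cDelta b)
          (beta b1 \ot m0) \ot etaB c1 \ot c2 \ot b2) m (rm_coactP M) _); lin.
      by swmatch.
    lhs (XE _ (fun m c b => \sw_(m0, c1 <- rm_coact m) \sw_(b1, b2 <- cDelta b)
      (beta b1 \ot m0) \ot etaB c1 \ot c \ot b2) _).
    apply: eq_sw => m b; symmetry.
    transitivity (\sw_(m0, c <- rm_coact m) \sw_(b1, b2 <- cDelta b)
      \sw_(b11, b12 <- cDelta b1) (beta b11 \ot m0) \ot etaB c \ot beta b2 \ot b12).
      apply: eq_sw => m0 c.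
      symmetry; apply: (coassocE (F := fun u v w : B =>
        (beta u \ot m0) \ot etaB c \ot beta w \ot v)); lin.
    by swmatch.
  nrm2; apply: eq_sw => m b; symmetry; etransitivity.
    apply: eq_sw => m0 c; apply: eq_sw => b1 b2.
    by apply: (eta_colinlE (F := fun c' h =>
      beta b1 \ot m0 \ot c' \ot h \ot b2)); lin.
  etransitivity; last first.
    transitivity (\sw_(m0, c <- rm_coact m) \sw_(m00, c1 <- rm_coact m0)
      \sw_(b1, b2 <- cDelta b) beta b1 \ot m00 \ot c1 \ot etaB c \ot b2).
      symmetry; apply: (rcoassocE (F := fun m0 c1 c2 => \sw_(b1, b2 <- cDelta b)
        beta b1 \ot m0 \ot c1 \ot etaB c2 \ot b2)) (rm_coactP M) _; lin.
    by swmatch.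
  by swmatch.
rewrite /t3; etransitivity; [nrm|]; apply: eq_sw => m b.
transitivity (\sw_(b1, b2 <- cDelta b) \sw_(m0, c <- rm_coact m)
  F (beta b1) (papp rm_act (papp rm_act m0 (eta c)) b2)); first by swt.
apply: eq_sw => b1 b2.
by apply: (act1E (F := fun m => F (beta b1) (papp rm_act m b2))); lin.
Qed.

End StableModule.

(** * Comodules and their cotensor products *)

Section ComodulesOn.
Variables (K : fieldType) (C : coalgebra K) (B : bicoalgebroid C).
Implicit Types (V X Y Z : lmodType K).

(* The totally defined map r restricts to a right B-coaction of the subspace P,
   and l to the left C-coaction which it induces. *)
Definition comodule_on Y (P : linsub Y) (r : {linear Y -> tens Y B})
    (l : {linear Y -> tens C Y}) : Prop :=
  forall y, P y ->
  [/\ tensl P (r y),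
      \sw_(y0, y1 <- r y) \sw_(y00, y01 <- r y0) y00 \ot y01 \ot y1 =
      \sw_(y0, y1 <- r y) \sw_(b1, b2 <- cDelta y1) y0 \ot b1 \ot b2,
      \sw_(y0, y1 <- r y) ceps y1 *: y0 = y &
      l y = push_flip r beta y].

Section Elimination.
Variables (Y : lmodType K) (P : linsub Y).
Variables (r : {linear Y -> tens Y B}) (l : {linear Y -> tens C Y}).
Hypothesis rP : comodule_on P r l.

Lemma con_in y : P y -> tensl P (r y).
Proof. by move=> /rP[]. Qed.

Lemma conAE Z (F : Y -> B -> B -> Z) y : P y -> trilin F ->
  \sw_(y0, y1 <- r y) \sw_(y00, y01 <- r y0) F y00 y01 y1 =
  \sw_(y0, y1 <- r y) \sw_(b1, b2 <- cDelta y1) F y0 b1 b2.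
Proof.
move=> /rP[_ e _ _] Ft; have {}e := eq_tens3 F e.
by etransitivity; [|etransitivity; [exact: e|nrm]]; symmetry; nrm.
Qed.

Lemma con1E Z (F : Y -> Z) y : P y -> linear F ->
  \sw_(y0, y1 <- r y) (ceps y1 : K) *: F y0 = F y.
Proof.
move=> /rP[_ _ e _] Fl; rewrite -[in RHS]e (linear_fun_sw _ _ Fl).
by apply: eq_sw => u v; rewrite (linear_funZ _ _ Fl).
Qed.

Lemma conLE Z (F : C -> Y -> Z) y : P y -> bilin F ->
  sw (l y) F = \sw_(y0, y1 <- r y) F (beta y1) y0.
Proof. by move=> /rP[_ _ _ ->] Fb; nrm. Qed.

End Elimination.

Section Cotensor.
Variables (X : lmodType K) (PX : linsub X).
Variables (rX : {linear X -> tens X B}) (lX : {linear X -> tens C X}).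
Variables (Y : lmodType K) (PY : linsub Y).
Variables (rY : {linear Y -> tens Y B}) (lY : {linear Y -> tens C Y}).
Hypothesis (rXP : comodule_on PX rX lX) (rYP : comodule_on PY rY lY).

(** Makes the product of coaction components legitimate. Coassociativity rewrites $\alpha$ of the
    second half of $x_{[1]}$ as the $C$-coaction of $x_{[0]}$'s parent, and the balancing of [w]
    turns it into $\beta$ of a component of $y$. *)
Lemma cotensor_BB (w : tens X Y) : tensl PX w -> tensr PY w ->
  \sw_(x, y <- w) \sw_(x0, x1 <- rX x) x0 \ot alpha x1 \ot y =
  \sw_(x, y <- w) \sw_(y0, y1 <- rY y) x \ot beta y1 \ot y0 ->
  tensr (BB B) (\sw_(x, y <- w) \sw_(x0, x1 <- rX x) \sw_(y0, y1 <- rY y)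
    (x0 \ot y0) \ot (x1 \ot y1)).
Proof.
move=> wX wY e; apply: BB_slice; nrm2.
transitivity (\sw_(x, y <- w) \sw_(x0, x1 <- rX x) \sw_(x00, x01 <- rX x0)
   \sw_(y0, y1 <- rY y) (x00 \ot y0) \ot x01 \ot alpha x1 \ot y1).
  apply: (sw_tensl wX); [lin|lin|] => x y Px; symmetry.
  lhs (conAE rXP (F := fun x0 b1 b2 => \sw_(y0, y1 <- rY y)
    (x0 \ot y0) \ot b1 \ot alpha b2 \ot y1) Px _).
  by swmatch.
transitivity (\sw_(x, y <- w) \sw_(y0, y1 <- rY y) \sw_(y00, y01 <- rY y0)
   \sw_(x0, x1 <- rX x) (x0 \ot y00) \ot x1 \ot beta y1 \ot y01); last first.
  apply: (sw_tensr wY); [lin|lin|] => x y Py.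
  lhs (conAE rYP (F := fun y0 b1 b2 => \sw_(x0, x1 <- rX x)
    (x0 \ot y0) \ot x1 \ot beta b2 \ot b1) Py _).
  by swmatch.
have {}e := eq_tens3 (fun x c y => \sw_(x0, x1 <- rX x) \sw_(y0, y1 <- rY y)
  (x0 \ot y0) \ot x1 \ot c \ot y1) e.
by etransitivity; [|etransitivity; [exact: e|]]; [symmetry|]; swt.
Qed.

(** The threefold version. Composability of the last two components is assumed through [S], so only
    the balancing between the first and the second remains. *)
Lemma cotensor_BBB Z (rZ : {linear Z -> tens Z B}) (S : linsub (tens Y Z))
    (w : tens X (tens Y Z)) :
  (forall u, S u -> tensl PY u /\ tensr (BB B) (\sw_(y, z <- u)
    \sw_(y0, y1 <- rY y) \sw_(z0, z1 <- rZ z) (y0 \ot z0) \ot (y1 \ot z1))) ->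
  tensl PX w -> tensr S w ->
  \sw_(x, u <- w) \sw_(y, z <- u) \sw_(x0, x1 <- rX x)
    x0 \ot alpha x1 \ot y \ot z =
  \sw_(x, u <- w) \sw_(y, z <- u) \sw_(y0, y1 <- rY y)
    x \ot beta y1 \ot y0 \ot z ->
  tensr (BBB B) (\sw_(x, u <- w) \sw_(y, z <- u) \sw_(x0, x1 <- rX x)
    \sw_(y0, y1 <- rY y) \sw_(z0, z1 <- rZ z)
    (x0 \ot y0 \ot z0) \ot (x1 \ot y1 \ot z1)).
Proof.
move=> SP wX wS e; apply: BBB_slice.
  set t := (X in tensr _ X).
  have -> : t = \sw_(x, u <- w) \sw_(v, y <- \sw_(y, z <- u) \sw_(y0, y1 <- rY y)
      \sw_(z0, z1 <- rZ z) (y0 \ot z0) \ot (y1 \ot z1))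
    \sw_(x0, x1 <- rX x) ((x0 \ot v) \ot x1) \ot y.
    by rewrite /t; swt.
  apply: (lset_sw_tensr wS); first by lin.
  move=> x u /SP[_ h]; apply: (lset_sw_tensr h); first by lin.
  by move=> v y By; apply: lset_sw => x0 x1; apply: tensr_pure.
nrm2.
transitivity (\sw_(x, u <- w) \sw_(y, z <- u) \sw_(x0, x1 <- rX x) \sw_(x00, x01 <- rX x0)
   \sw_(y0, y1 <- rY y) \sw_(z0, z1 <- rZ z)
   (x00 \ot y0 \ot z0) \ot x01 \ot alpha x1 \ot y1 \ot z1).
  apply: (sw_tensl wX); [lin|lin|] => x u Px; apply: eq_sw => y z; symmetry.
  lhs (conAE rXP (F := fun x0 b1 b2 => \sw_(y0, y1 <- rY y) \sw_(z0, z1 <- rZ z)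
    (x0 \ot y0 \ot z0) \ot b1 \ot alpha b2 \ot y1 \ot z1) Px _).
  by swmatch.
transitivity (\sw_(x, u <- w) \sw_(y, z <- u) \sw_(y0, y1 <- rY y) \sw_(y00, y01 <- rY y0)
   \sw_(x0, x1 <- rX x) \sw_(z0, z1 <- rZ z)
   (x0 \ot y00 \ot z0) \ot x1 \ot beta y1 \ot y01 \ot z1); last first.
  apply: (sw_tensr wS); [lin|lin|] => x u /SP[Pu _].
  apply: (sw_tensl Pu); [lin|lin|] => y z Py.
  lhs (conAE rYP (F := fun y0 b1 b2 => \sw_(x0, x1 <- rX x) \sw_(z0, z1 <- rZ z)
    (x0 \ot y0 \ot z0) \ot x1 \ot beta b2 \ot b1 \ot z1) Py _).
  by swmatch.
have {}e := eq_tens3 (fun x c u => \sw_(y, z <- u)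
  \sw_(x0, x1 <- rX x) \sw_(y0, y1 <- rY y) \sw_(z0, z1 <- rZ z)
  (x0 \ot y0 \ot z0) \ot x1 \ot c \ot y1 \ot z1) e.
by etransitivity; [|etransitivity; [exact: e|]]; [symmetry|]; swt.
Qed.

End Cotensor.
End ComodulesOn.

(** * The diagonal coaction on the cotensor product of the ring with a comodule *)

Section Powers.
Variables (K : fieldType) (C : coalgebra K) (B : bicoalgebroid C).
Variable (A : comodule_ring B).
Implicit Types (V Y Z : lmodType K).

Lemma comodule_on_ring : comodule_on (lfull A) (@coact _ _ _ A) cr_l.
Proof.
move=> a _; have [e1 e2] := coactP A.
by split; [exact: tensl_full | exact: e1 | exact: e2 | exact: coact_l].
Qed.

Section Step.
Variables (Y : lmodType K) (P : linsub Y).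
Variables (r : {linear Y -> tens Y B}) (l : {linear Y -> tens C Y}).
Hypothesis rP : comodule_on P r l.

Definition cot_ring : linsub (tens A Y) := cotensor (lfull A) P cr_r l.

Lemma cr_rE Z (F : A -> C -> Z) a : bilin F ->
  sw (cr_r a) F = \sw_(a0, a1 <- coact a) F a0 (alpha a1).
Proof. by move=> Fb; rewrite coact_r; nrm. Qed.

Lemma cr_lE Z (F : C -> A -> Z) a : bilin F ->
  sw (cr_l a) F = \sw_(a0, a1 <- coact a) F (beta a1) a0.
Proof. by move=> Fb; rewrite coact_l; nrm. Qed.

Lemma cot_ring_r x : cot_ring x -> tensr P x.
Proof. by move=> /cotensor_r[]. Qed.

Lemma cot_ringE Z (F : A -> C -> Y -> Z) x : cot_ring x -> trilin F ->
  \sw_(a, y <- x) \sw_(a0, a1 <- coact a) F a0 (alpha a1) y =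
  \sw_(a, y <- x) \sw_(c, y0 <- l y) F a c y0.
Proof.
move=> /cotensor_r[xP e] Ft; have {}e := eq_tens3 F e.
transitivity (\sw_(a, y <- x) \sw_(a0, c <- cr_r a) F a0 c y).
  by apply: eq_sw => a y; rewrite (cr_rE (F := fun a0 c => F a0 c y)) //; lin.
by etransitivity; [|etransitivity; [exact: e|nrm]]; symmetry; nrm.
Qed.

Lemma cot_ringBE Z (F : A -> C -> Y -> Z) x : cot_ring x -> trilin F ->
  \sw_(a, y <- x) \sw_(a0, a1 <- coact a) F a0 (alpha a1) y =
  \sw_(a, y <- x) \sw_(y0, y1 <- r y) F a (beta y1) y0.
Proof.
move=> Ax Ft; rewrite cot_ringE //; apply: (sw_tensr (cot_ring_r Ax)); [lin|lin|].
by move=> a y Py; apply: (conLE rP (F := F a)) => //; lin.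
Qed.

Lemma cot_ring_slice V (t : tens V (tens A Y)) : tensr (tensr P) t ->
  \sw_(v, x <- t) \sw_(a, y <- x) \sw_(a0, a1 <- coact a)
    v \ot a0 \ot alpha a1 \ot y =
  \sw_(v, x <- t) \sw_(a, y <- x) \sw_(y0, y1 <- r y)
    v \ot a \ot beta y1 \ot y0 ->
  tensr cot_ring t.
Proof.
move=> tP e; apply: tensr_cotensor => //.
etransitivity; [|etransitivity; [exact: e|symmetry]].
  nrm2; apply: eq_sw => v x; apply: eq_sw => a y.
  by rewrite (cr_rE (F := fun a0 c => v \ot a0 \ot c \ot y)) //; lin.
transitivity (\sw_(v, x <- t) \sw_(a, y <- x) \sw_(c, y0 <- l y) v \ot a \ot c \ot y0).
  by nrm.
apply: (sw_tensr tP); [lin|lin|] => v x Px; apply: (sw_tensr Px); [lin|lin|] => a y Py.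
by apply: (conLE rP (F := fun c y0 => v \ot a \ot c \ot y0)) => //; lin.
Qed.

Lemma cot_ringI x : tensr P x ->
  \sw_(a, y <- x) \sw_(a0, a1 <- coact a) a0 \ot alpha a1 \ot y =
  \sw_(a, y <- x) \sw_(c, y0 <- l y) a \ot c \ot y0 ->
  cot_ring x.
Proof.
move=> tP e; apply/cotensor_r; split => //.
etransitivity; [|etransitivity; [exact: e|symmetry; nrm]].
nrm2; apply: eq_sw => a y.
by rewrite (cr_rE (F := fun a0 c => a0 \ot c \ot y)) //; lin.
Qed.

Lemma cot_ring_BB x : cot_ring x ->
  tensr (BB B) (\sw_(a, y <- x) \sw_(a0, a1 <- coact a) \sw_(y0, y1 <- r y)
    (a0 \ot y0) \ot (a1 \ot y1)).
Proof.
move=> Ax; apply: (cotensor_BB comodule_on_ring rP (tensl_full _) (cot_ring_r Ax)).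
by apply: (cot_ringBE (F := fun a c y => a \ot c \ot y)) => //; lin.
Qed.

(** Allows the axioms of [mu] to be used under the diagonal coaction, with the degree zero parts as
    spectator. *)
Lemma sw_cot_ring Z (F G : tens A Y -> tens B B -> Z) x : cot_ring x ->
  bilin F -> bilin G -> (forall v w, BB B w -> F v w = G v w) ->
  \sw_(a, y <- x) \sw_(a0, a1 <- coact a) \sw_(y0, y1 <- r y)
    F (a0 \ot y0) (a1 \ot y1) =
  \sw_(a, y <- x) \sw_(a0, a1 <- coact a) \sw_(y0, y1 <- r y)
    G (a0 \ot y0) (a1 \ot y1).
Proof.
move=> Ax Fb Gb h; have e := sw_tensr (cot_ring_BB Ax) Fb Gb h.
by etransitivity; [|etransitivity; [exact: e|nrm]]; symmetry; nrm.
Qed.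

(** Since $\alpha(a_{[1]}y_{[1]})=\varepsilon(a_{[1]})\alpha(y_{[1]})$, the induced right
    $C$-coaction only sees the last factor. *)
Lemma coact2_alpha Z (F : tens A Y -> C -> Z) x : cot_ring x -> bilin F ->
  \sw_(x0, x1 <- coact2 r x) F x0 (alpha x1) =
  \sw_(a, y <- x) \sw_(y0, y1 <- r y) F (a \ot y0) (alpha y1).
Proof.
move=> Ax Fb; etransitivity; [nrm|].
transitivity (\sw_(a, y <- x) \sw_(a0, a1 <- coact a) \sw_(y0, y1 <- r y)
  (ceps a1 : K) *: F (a0 \ot y0) (alpha y1)).
  via (sw_cot_ring (F := fun v w => \sw_(b, b' <- w) F v (alpha (papp mu b b')))
    (G := fun v w => \sw_(b, b' <- w) (ceps b : K) *: F v (alpha b')) Ax _ _ _).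
  by move=> v w Bw; apply: (mu_alphaE (F := F v)) => //; lin.
apply: eq_sw => a y.
transitivity (\sw_(a0, a1 <- coact a) (ceps a1 : K) *:
  (\sw_(y0, y1 <- r y) F (a0 \ot y0) (alpha y1))); first by symmetry; nrm.
by apply: (rcounitE (F := fun a => \sw_(y0, y1 <- r y) F (a \ot y0) (alpha y1)) _ (coactP A)); lin.
Qed.

(** Each clause reflects one property of [mu]: stability of the subspace comes from [mu_alpha_beta],
    coassociativity from [mu_Delta], the counit law from [mu_eps], and the left $C$-coaction from
    [mu_betaE]. *)
Lemma comodule_on_cot_ring : comodule_on cot_ring (coact2 r) (lcoact1 cr_l).
Proof.
move=> x Ax; have Px := cot_ring_r Ax.
split.
(* Flipping makes the product $a_{[1]}y_{[1]}$ the spectator; the balancing still required between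
   $a_{[0]}$ and $y_{[0]}$ is then [mu_alpha_beta]. *)
- apply/tensl_flip; apply: cot_ring_slice.
    rewrite /flip; have -> : \sw_(v, b <- coact2 r x) b \ot v = \sw_(a, y <- x)
      \sw_(y0, y1 <- r y) \sw_(a0, a1 <- coact a) papp mu a1 y1 \ot a0 \ot y0.
      by swt.
    apply: (lset_sw_tensr Px); first by lin.
    move=> a y /(con_in rP) ry; apply: (lset_sw_tensl ry); first by lin.
    by move=> y0 y1 Py0; apply: lset_sw => a0 a1; do 2!apply: tensr_pure.
  nrm2.
  transitivity (\sw_(a, y <- x) \sw_(a0, a1 <- coact a) \sw_(y0, y1 <- r y)
    \sw_(b1, b2 <- cDelta a1) papp mu b2 y1 \ot a0 \ot alpha b1 \ot y0).
    apply: eq_sw => a y; via (rcoassocE (F := fun a0 b1 b2 => \sw_(y0, y1 <- r y)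
      papp mu b2 y1 \ot a0 \ot alpha b1 \ot y0) a (coactP A) _).
  transitivity (\sw_(a, y <- x) \sw_(a0, a1 <- coact a) \sw_(y0, y1 <- r y)
    \sw_(b1, b2 <- cDelta y1) papp mu a1 b2 \ot a0 \ot beta b1 \ot y0).
    symmetry.
    via (sw_cot_ring (F := fun v w => \sw_(a0, y0 <- v) \sw_(b, b' <- w)
        \sw_(b1, b2 <- cDelta b') papp mu b b2 \ot a0 \ot beta b1 \ot y0)
      (G := fun v w => \sw_(a0, y0 <- v) \sw_(b, b' <- w)
        \sw_(b1, b2 <- cDelta b) papp mu b2 b' \ot a0 \ot alpha b1 \ot y0) Ax _ _ _).
    move=> v w Bw; apply: eq_sw => a0 y0.
    by apply: (mu_alpha_betaE (F := fun u c => u \ot a0 \ot c \ot y0)) => //; lin.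
  apply: (sw_tensr Px); [lin|lin|] => a y Py; apply: eq_sw => a0 a1; symmetry.
  by apply: (conAE rP (F := fun y0 b1 b2 => papp mu a1 b2 \ot a0 \ot beta b1 \ot y0) Py); lin.
- transitivity (\sw_(a, y <- x) \sw_(a0, a1 <- coact a) \sw_(y0, y1 <- r y)
    \sw_(b1, b2 <- cDelta a1) \sw_(b'1, b'2 <- cDelta y1)
    (a0 \ot y0) \ot papp mu b1 b'1 \ot papp mu b2 b'2).
    transitivity (\sw_(a, y <- x) \sw_(y0, y1 <- r y) \sw_(y00, y01 <- r y0)
      \sw_(a0, a1 <- coact a) \sw_(a00, a01 <- coact a0)
      (a00 \ot y00) \ot papp mu a01 y01 \ot papp mu a1 y1); first by swt.
    apply: (sw_tensr Px); [lin|lin|] => a y Py.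
    lhs (conAE rP (F := fun y0 b'1 b'2 =>
      \sw_(a0, a1 <- coact a) \sw_(a00, a01 <- coact a0)
      (a00 \ot y0) \ot papp mu a01 b'1 \ot papp mu a1 b'2) Py _).
    via (rcoassocE (F := fun a0 b1 b2 => \sw_(y0, y1 <- r y)
      \sw_(b'1, b'2 <- cDelta y1)
      (a0 \ot y0) \ot papp mu b1 b'1 \ot papp mu b2 b'2) a (coactP A) _).
  symmetry.
  via (sw_cot_ring (F := fun v w => \sw_(b, b' <- w) \sw_(p, q <- cDelta (papp mu b b'))
      v \ot p \ot q)
    (G := fun v w => \sw_(b, b' <- w) \sw_(b1, b2 <- cDelta b)
      \sw_(b'1, b'2 <- cDelta b') v \ot papp mu b1 b'1 \ot papp mu b2 b'2) Ax _ _ _).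
  by move=> v w Bw; apply: (mu_DeltaE (F := fun p q => v \ot p \ot q)) => //; lin.
- transitivity (\sw_(a, y <- x) \sw_(a0, a1 <- coact a) \sw_(y0, y1 <- r y)
    (ceps a1 : K) *: ((ceps y1 : K) *: (a0 \ot y0))).
    via (sw_cot_ring (F := fun v w => \sw_(b, b' <- w) (ceps (papp mu b b') : K) *: v)
      (G := fun v w => \sw_(b, b' <- w) (ceps b : K) *: ((ceps b' : K) *: v)) Ax _ _ _).
    by move=> v w Bw; apply: mu_epsE.
  rewrite -[RHS]pure_sw; apply: (sw_tensr Px); [lin|exact: pure_bilin|] => a y Py.
  transitivity (\sw_(a0, a1 <- coact a) (ceps a1 : K) *: (a0 \ot y)).
    apply: eq_sw => a0 a1; rewrite -scale_swr; congr (_ *: _).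
    by apply: (con1E rP (F := fun y => a0 \ot y) Py); lin.
  by apply: (rcounitE (F := fun a => a \ot y) _ (coactP A)); lin.
- symmetry.
  transitivity (\sw_(a, y <- x) \sw_(a0, a1 <- coact a) \sw_(y0, y1 <- r y)
    (ceps y1 : K) *: (beta a1 \ot a0 \ot y0)).
    via (sw_cot_ring (F := fun v w => \sw_(a0, y0 <- v) \sw_(b, b' <- w)
        beta (papp mu b b') \ot a0 \ot y0)
      (G := fun v w => \sw_(a0, y0 <- v) \sw_(b, b' <- w)
        (ceps b' : K) *: (beta b \ot a0 \ot y0)) Ax _ _ _).
    move=> v w Bw; apply: eq_sw => a0 y0.
    by apply: (mu_betaE (F := fun c => c \ot a0 \ot y0)) => //; lin.
  rewrite lcoact1E; apply: (sw_tensr Px); [lin|lin|] => a y Py.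
  rewrite (cr_lE (F := fun c a0 => c \ot a0 \ot y)); last by lin.
  apply: eq_sw => a0 a1; apply: (con1E rP (F := fun y => beta a1 \ot a0 \ot y) Py); lin.
Qed.

End Step.
End Powers.

Arguments comodule_on_ring {K C B} A.

Section EtaLeft.
Variables (K : fieldType) (C : coalgebra K) (B : bicoalgebroid C).
Implicit Types (Z : lmodType K) (b : B).

Lemma BB_eta_l b : BB B (\sw_(b1, b2 <- cDelta b) eta (beta b2) \ot b1).
Proof.
apply/BBE; nrm2.
etransitivity.
  by apply: eq_sw => b1 b2; apply: (eta_colinrE (F := fun h c => h \ot c \ot b1)); lin.
swr (apply: betaE); symmetry.
lhs (coassocE (F := fun u v w : B => (eta (beta w) : B) \ot beta v \ot u) b _).
by [].
Qed.

(** Left counterpart of [eta_Delta_act], obtained from [mu_alpha_beta] and the left unit law. It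
    evaluates the coaction of an inserted unit. *)
Lemma eta_Delta_act_l Z (F : C -> B -> Z) b : bilin F ->
  \sw_(b1, b2 <- cDelta b) \sw_(h1, h2 <- cDelta (eta (beta b2)))
    F (alpha h1) (papp mu h2 b1) =
  \sw_(b1, b2 <- cDelta b) F (beta b1) b2.
Proof.
move=> Fb; have := mu_alpha_betaE (F := fun v w => F w v) (BB_eta_l b).
move=> /(_ ltac:(lin)) e.
etransitivity; [|etransitivity; [exact: esym e|]]; first by symmetry; nrm.
etransitivity; [nrm|].
lhs (coassocE (F := fun u v w : B => F (beta u) (papp mu (eta (beta w)) v)) b _).
apply: eq_sw => b1 b2.
by rewrite -[in RHS](mu_etal b2) (linear_fun_sw _ _ (Fb.2 _)).
Qed.

End EtaLeft.

(** * Colinearity of unit insertion and of multiplication *)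

Section Colinear.
Variables (K : fieldType) (C : coalgebra K) (B : bicoalgebroid C).
Variable (A : comodule_ring B).
Implicit Types (V Y Z : lmodType K).

(** Linearity is required on the ambient space so that [f] passes through every [sw]; the rest is
    required on [P] only, where the coactions are meaningful. *)
Definition colinear_on Y (P : linsub Y) (r : {linear Y -> tens Y B})
    Y' (P' : linsub Y') (r' : {linear Y' -> tens Y' B}) (f : Y -> Y') : Prop :=
  linear f /\
  forall y, P y -> P' (f y) /\ r' (f y) = \sw_(y0, y1 <- r y) f y0 \ot y1.

Lemma colinearE Y (P : linsub Y) r Y' (P' : linsub Y') r' f Z (F : Y' -> B -> Z) y :
  colinear_on P r P' r' f -> P y -> bilin F ->
  sw (r' (f y)) F = \sw_(y0, y1 <- r y) F (f y0) y1.
Proof. by move=> [fl fP] /fP[_ ->] Fb; nrm. Qed.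

Lemma coact_oneE Z (F : A -> B -> Z) c : bilin F ->
  sw (coact (cr_one c)) F =
  \sw_(h1, h2 <- cDelta (eta c)) F (cr_one (alpha h1)) h2.
Proof. by move=> Fb; rewrite coact_one; nrm. Qed.

Lemma mul_sw (x : tens A A) : cot_ring A (lfull A) cr_l x ->
  exists2 u, x = val u & sw x (papp (@cr_mul _ _ A)) = cr_mul u.
Proof. by move=> /lsubE[u xu]; exists u => //; exact: sw_papp. Qed.

Lemma coact_mulE Z (F : A -> B -> Z) (x : tens A A) :
  cot_ring A (lfull A) cr_l x -> bilin F ->
  \sw_(a, b <- x) sw (coact (papp cr_mul a b)) F =
  \sw_(a, b <- x) \sw_(a0, a1 <- coact a) \sw_(b0, b1 <- coact b)
    F (papp cr_mul a0 b0) (papp mu a1 b1).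
Proof.
move=> /mul_sw[u -> e] Fb.
transitivity (sw (coact (sw (val u) (papp cr_mul))) F); first by symmetry; nrm.
by rewrite e coact_mul; nrm.
Qed.

Lemma mul_colinrE Z (F : A -> C -> Z) (x : tens A A) :
  cot_ring A (lfull A) cr_l x -> bilin F ->
  \sw_(a, b <- x) \sw_(p, q <- coact (papp cr_mul a b)) F p (alpha q) =
  \sw_(a, b <- x) \sw_(b0, b1 <- coact b) F (papp cr_mul a b0) (alpha b1).
Proof.
move=> /mul_sw[u -> e] Fb.
transitivity (sw (cr_r (sw (val u) (papp cr_mul))) F).
  by rewrite cr_rE //; symmetry; nrm.
rewrite e cr_mul_colinr; etransitivity; [nrm|]; apply: eq_sw => a b.
by rewrite (cr_rE (F := fun b0 c => F (papp cr_mul a b0) c)) //; lin.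
Qed.

Lemma mulAE Z (F : A -> Z) (x : tens A (tens A A)) :
  cot_ring A (cot_ring A (lfull A) cr_l) (lcoact1 cr_l) x -> linear F ->
  \sw_(a, y <- x) \sw_(b, c <- y) F (papp cr_mul (papp cr_mul a b) c) =
  \sw_(a, y <- x) \sw_(b, c <- y) F (papp cr_mul a (papp cr_mul b c)).
Proof.
move=> Ax Fl; have := congr1 F (cr_mulA Ax) => e.
by etransitivity; [|etransitivity; [exact: e|nrm]]; symmetry; nrm.
Qed.

Lemma mul1E Z (F : A -> Z) a : linear F ->
  \sw_(a0, c <- cr_r a) F (papp cr_mul a0 (cr_one c)) = F a.
Proof. by move=> Fl; rewrite -[in RHS](cr_mulr1 a); symmetry; nrm. Qed.

Section Step.
Variables (Y : lmodType K) (P : linsub Y).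
Variables (r : {linear Y -> tens Y B}) (l : {linear Y -> tens C Y}).
Hypothesis rP : comodule_on P r l.

(** The induction step for operators at positive positions: they act as the identity on the first
    letter and as a lower operator on the remaining word. *)
Lemma colinear_cot_ring Y' (P' : linsub Y') (r' : {linear Y' -> tens Y' B})
    (l' : {linear Y' -> tens C Y'}) (f : Y -> Y') :
  comodule_on P' r' l' -> colinear_on P r P' r' f ->
  colinear_on (cot_ring A P l) (coact2 r) (cot_ring A P' l') (coact2 r')
    (fun x => \sw_(a, y <- x) a \ot f y).
Proof.
move=> rP' ff; have [fl fP] := ff; split; first by lin.
move=> x Ax; have Px := cot_ring_r Ax; split.
  apply: cot_ringI.
    apply: (lset_sw_tensr Px) => [|a y Py]; first by lin.
    by apply: tensr_pure; have [] := fP y Py.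
  nrm2; lhs (cot_ringBE rP (F := fun a c y => a \ot c \ot f y) Ax _).
  apply: (sw_tensr Px); [lin|lin|] => a y Py; symmetry.
  rewrite (conLE rP' (F := fun c y => a \ot c \ot y)) //; [|by have [] := fP y Py|by lin].
  by rewrite (colinearE (F := fun y b => a \ot beta b \ot y) ff Py) //; lin.
transitivity (\sw_(a, y <- x) \sw_(a0, a1 <- coact a) \sw_(y0, y1 <- r' (f y))
  (a0 \ot y0) \ot papp mu a1 y1); first by nrm.
transitivity (\sw_(a, y <- x) \sw_(a0, a1 <- coact a) \sw_(y0, y1 <- r y)
  (a0 \ot f y0) \ot papp mu a1 y1); last by swt.
apply: (sw_tensr Px); [lin|lin|] => a y Py; apply: eq_sw => a0 a1.
by apply: (colinearE (F := fun y b => (a0 \ot y) \ot papp mu a1 b) ff Py); lin.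
Qed.

(** The unit inserted from $\beta(y_{[1]})$ contributes the coaction of $\eta(\beta(y_{[1]}))$;
    multiplied by the component of $y$ it is contracted by [eta_Delta_act_l]. *)
Lemma colinear_insert_unit :
  colinear_on P r (cot_ring A P l) (coact2 r)
    (fun y => \sw_(c, y0 <- l y) cr_one c \ot y0).
Proof.
split; first by lin.
have iE y : P y -> \sw_(c, y0 <- l y) cr_one c \ot y0 =
    \sw_(y0, y1 <- r y) (cr_one (beta y1) : A) \ot y0.
  by move=> Py; apply: (conLE rP (F := fun c y0 => (cr_one c : A) \ot y0) Py); lin.
move=> y Py; rewrite (iE y Py); have ry := con_in rP Py; split.
  apply: cot_ringI.
    by apply: (lset_sw_tensl ry) => [|y0 y1 Py0]; [lin | exact: tensr_pure].
  nrm2; transitivity (\sw_(y0, y1 <- r y) \sw_(b1, b2 <- cDelta y1)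
      (cr_one (beta b2) : A) \ot beta b1 \ot y0).
    apply: eq_sw => y0 y1; rewrite -(cr_rE (F := fun a c => a \ot c \ot y0)); last by lin.
    rewrite cr_one_colinr; etransitivity; [nrm|].
    by apply: (betaE (F := fun c1 c2 => (cr_one c1 : A) \ot c2 \ot y0)); lin.
  lhs <- (conAE rP (F := fun y0 b1 b2 => (cr_one (beta b2) : A) \ot beta b1 \ot y0) Py _).
  apply: (sw_tensl ry); [lin|lin|] => y0 y1 Py0; symmetry.
  by apply: (conLE rP (F := fun c y => (cr_one (beta y1) : A) \ot c \ot y) Py0); lin.
transitivity (\sw_(y0, y1 <- r y) \sw_(y00, y01 <- r y0)
   \sw_(h1, h2 <- cDelta (eta (beta y1))) ((cr_one (alpha h1) : A) \ot y00) \ot papp mu h2 y01).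
  etransitivity; [nrm|]; apply: eq_sw => y0 y1.
  rewrite (coact_oneE (F := fun a b => \sw_(y00, y01 <- r y0) (a \ot y00) \ot papp mu b y01)); last by lin.
  by swmatch.
lhs (conAE rP (F := fun y0 b1 b2 => \sw_(h1, h2 <- cDelta (eta (beta b2)))
  ((cr_one (alpha h1) : A) \ot y0) \ot papp mu h2 b1) Py _).
transitivity (\sw_(y0, y1 <- r y) \sw_(b1, b2 <- cDelta y1)
  ((cr_one (beta b1) : A) \ot y0) \ot b2).
  apply: eq_sw => y0 y1.
  by apply: (eta_Delta_act_l (F := fun c b => ((cr_one c : A) \ot y0) \ot b)); lin.
lhs <- (conAE rP (F := fun y0 b1 b2 => ((cr_one (beta b1) : A) \ot y0) \ot b2) Py _).
symmetry; apply: (sw_tensl ry); [lin|lin|] => y0 y1 Py0.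
by rewrite iE //; nrm.
Qed.

Let P2 := cot_ring A (cot_ring A P l) (lcoact1 cr_l).

Lemma cot_ring2E Z (F : A -> C -> tens A Y -> Z) x : P2 x -> trilin F ->
  \sw_(a, z <- x) \sw_(a0, a1 <- coact a) F a0 (alpha a1) z =
  \sw_(a, z <- x) \sw_(b, y <- z) \sw_(b0, b1 <- coact b) F a (beta b1) (b0 \ot y).
Proof.
move=> Px Ft; rewrite (cot_ringE Px) //; etransitivity; [nrm|].
apply: eq_sw => a z; apply: eq_sw => b y.
by apply: (cr_lE (F := fun c b0 => F a c (b0 \ot y))); lin.
Qed.

(** The tail is moved to the front as spectator, so that axioms of the ring product apply to the
    first two letters. *)
Lemma cot_ring2_slice x : P2 x ->
  tensr (cot_ring A (lfull A) cr_l) (\sw_(a, z <- x) \sw_(b, y <- z) y \ot a \ot b).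
Proof.
move=> Px; apply: (cot_ring_slice (comodule_on_ring A)).
  by apply: lset_sw => a z; apply: lset_sw => b y; apply: tensr_pure; exact: tensr_full.
via (cot_ring2E (F := fun a c z => \sw_(b, y <- z) y \ot a \ot c \ot b) Px _).
Qed.

Lemma cot_ring2_BBB x : P2 x ->
  tensr (BBB B) (\sw_(a, z <- x) \sw_(b, y <- z) \sw_(a0, a1 <- coact a)
    \sw_(b0, b1 <- coact b) \sw_(y0, y1 <- r y)
    (a0 \ot b0 \ot y0) \ot (a1 \ot b1 \ot y1)).
Proof.
move=> Px; apply: (cotensor_BBB (S := cot_ring A P l) (comodule_on_ring A) (comodule_on_ring A)).
- by move=> u Au; split; [exact: tensl_full | exact: (cot_ring_BB rP)].
- exact: tensl_full.
- exact: (cot_ring_r Px).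
via (cot_ring2E (F := fun a c z => \sw_(b, y <- z) a \ot c \ot b \ot y) Px _).
Qed.

(** Multiplying first produces the component $(a_{[1]}b_{[1]})y_{[1]}$, the iterated diagonal
    coaction produces $a_{[1]}(b_{[1]}y_{[1]})$; associativity of [mu] identifies them, and needs
    [cot_ring2_BBB]. *)
Lemma colinear_mul :
  colinear_on P2 (coact2 (coact2 r)) (cot_ring A P l) (coact2 r)
    (fun x => \sw_(a, z <- x) \sw_(b, y <- z) papp cr_mul a b \ot y).
Proof.
split; first by lin.
move=> x Px; have Sx := cot_ring2_slice Px; have AAx := cot_ring_r Px; split.
  apply: cot_ringI.
    apply: (lset_sw_tensr AAx) => [|a z Az]; first by lin.
    apply: (lset_sw_tensr (cot_ring_r Az)) => [|b y Py]; first by lin.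
    exact: tensr_pure.
  transitivity (\sw_(a, z <- x) \sw_(b, y <- z) \sw_(b0, b1 <- coact b)
    papp cr_mul a b0 \ot alpha b1 \ot y).
    pose F := fun y (w : tens A A) => \sw_(a, b <- w) \sw_(p, q <- coact (papp cr_mul a b))
      p \ot alpha q \ot (y : Y).
    pose G := fun y (w : tens A A) => \sw_(a, b <- w) \sw_(b0, b1 <- coact b)
      papp cr_mul a b0 \ot alpha b1 \ot (y : Y).
    have := sw_tensr (f := F) (g := G) Sx; rewrite /F /G => e.
  via (e _ _ _).
    by move=> y w Aw; apply: (mul_colinrE (F := fun p c => p \ot c \ot y)) => //; lin.
  etransitivity; last by symmetry; nrm.
  apply: (sw_tensr AAx); [lin|lin|] => a z Az.
  by apply: (cot_ringE (F := fun b c y => papp cr_mul a b \ot c \ot y) Az); lin.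
transitivity (\sw_(a, z <- x) \sw_(b, y <- z) \sw_(a0, a1 <- coact a)
  \sw_(b0, b1 <- coact b) \sw_(y0, y1 <- r y)
  (papp cr_mul a0 b0 \ot y0) \ot papp mu (papp mu a1 b1) y1).
  pose F := fun y (w : tens A A) => \sw_(a, b <- w) \sw_(p, q <- coact (papp cr_mul a b))
    \sw_(y0, y1 <- r y) (p \ot y0) \ot papp mu q y1.
  pose G := fun y (w : tens A A) => \sw_(a, b <- w) \sw_(a0, a1 <- coact a)
    \sw_(b0, b1 <- coact b) \sw_(y0, y1 <- r y)
    (papp cr_mul a0 b0 \ot y0) \ot papp mu (papp mu a1 b1) y1.
  have := sw_tensr (f := F) (g := G) Sx; rewrite /F /G => e.
  via (e _ _ _).
  move=> y w Aw; apply: (coact_mulE (F := fun p q => \sw_(y0, y1 <- r y)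
    (p \ot y0) \ot papp mu q y1)) => //; lin.
pose F := fun (v : tens A (tens A Y)) (w : tens B (tens B B)) =>
  \sw_(a, z <- v) \sw_(b, y <- z) \sw_(p, u <- w) \sw_(q, s <- u)
  (papp cr_mul a b \ot y) \ot papp mu (papp mu p q) s.
pose G := fun (v : tens A (tens A Y)) (w : tens B (tens B B)) =>
  \sw_(a, z <- v) \sw_(b, y <- z) \sw_(p, u <- w) \sw_(q, s <- u)
  (papp cr_mul a b \ot y) \ot papp mu p (papp mu q s).
have := sw_tensr (f := F) (g := G) (cot_ring2_BBB Px); rewrite /F /G => e.
  via (e _ _ _).
move=> v w Bw; apply: eq_sw => a z; apply: eq_sw => b y.
by apply: (muAE (F := fun p => (papp cr_mul a b \ot y) \ot p)) => //; lin.
Qed.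

End Step.
End Colinear.

(** * Cotensor powers *)

Section Tower.
Variables (K : fieldType) (C : coalgebra K) (B : hopf_coalgebra C).
Variable (A : comodule_ring B).
Implicit Types (V Y Z : lmodType K).

Lemma comodule_on_cotpow n :
  comodule_on (cotpow A n) (tpow_coact A n) (tpow_l A n).
Proof.
by elim: n => [|n IH]; [exact: comodule_on_ring | exact: (comodule_on_cot_ring IH)].
Qed.

Arguments comodule_on_cotpow : clear implicits.

Lemma insert_one0 n (x : tpow A n) :
  insert_one 0 x = \sw_(c, x0 <- tpow_l A n x) cr_one c \ot x0.
Proof. by case: n x => [|n] x //; symmetry; nrm. Qed.

Lemma insert_linear n i : linear (@insert_one _ _ _ A n i).
Proof.
elim: n i => [|n IH] [|i]; rewrite /insert_one; try by lin.
by have := IH i => h; lin.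
Qed.

Lemma colinear_insert n i : colinear_on (cotpow A n) (tpow_coact A n)
  (cotpow A n.+1) (tpow_coact A n.+1) (insert_one i).
Proof.
have unit m : colinear_on (cotpow A m) (tpow_coact A m)
    (cotpow A m.+1) (tpow_coact A m.+1)
    (fun y => \sw_(c, y0 <- tpow_l A m y) cr_one c \ot y0).
  exact: (colinear_insert_unit A (comodule_on_cotpow m)).
elim: n i => [|n IH] [|i]; try exact: (unit 0%N).
- have -> : @insert_one _ _ _ A n.+1 0 = fun y => \sw_(c, y0 <- tpow_l A n.+1 y) cr_one c \ot y0.
    by apply/funext => x; exact: insert_one0.
  exact: unit.
- exact: (colinear_cot_ring A (comodule_on_cotpow n) (comodule_on_cotpow n.+1) (IH i)).
Qed.

Lemma merge_linear n i : linear (@merge _ _ _ A n i).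
Proof.
elim: n i => [|n IH] [|i]; rewrite /merge; try by lin.
by have := IH i => h; lin.
Qed.

Lemma colinear_merge n i : colinear_on (cotpow A n.+1) (tpow_coact A n.+1)
  (cotpow A n) (tpow_coact A n) (merge i).
Proof.
elim: n i => [|n IH] i.
  split; first exact: merge_linear.
  move=> x Ax; split=> //.
  transitivity (coact (\sw_(a, b <- x) papp cr_mul a b)); first by [].
  transitivity (\sw_(a, b <- x) coact (papp cr_mul a b)); first by nrm.
  transitivity (\sw_(a, b <- x) sw (coact (papp cr_mul a b)) (@pure K A B)).
    by apply: eq_sw => a b; rewrite pure_sw.
  lhs (coact_mulE Ax (pure_bilin A B)).
  transitivity (\sw_(y0, y1 <- tpow_coact A 1 x)
    (\sw_(a, b <- y0) papp cr_mul a b) \ot y1); last by [].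
  by symmetry; nrm.
case: i => [|i].
  exact: (colinear_mul A (comodule_on_cotpow n)).
exact: (colinear_cot_ring A (comodule_on_cotpow n.+1) (comodule_on_cotpow n) (IH i)).
Qed.

Lemma tsnoc_bilin n : bilin (@tsnoc _ _ _ A n).
Proof.
elim: n => [|n IH]; first exact: pure_bilin.
have h : bilin (fun (x : tpow A n.+1) (a : A) => \sw_(b, u <- x) b \ot tsnoc u a) by lin.
exact: h.
Qed.

Lemma tpow_l_tsnoc n (t : tpow A n) a :
  tpow_l A n.+1 (tsnoc t a) = \sw_(c, t0 <- tpow_l A n t) c \ot tsnoc t0 a.
Proof.
case: n t => [|n] t.
  transitivity (tpow_l A 1 ((t : A) \ot a)); first by [].
  transitivity (\sw_(c, t0 <- cr_l (t : A)) c \ot t0 \ot a); last by [].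
  by nrm.
have tb := tsnoc_bilin n.
transitivity (tpow_l A n.+2 (\sw_(b, u <- t) b \ot tsnoc u a)); first by [].
transitivity (\sw_(c, t0 <- tpow_l A n.+1 t) c \ot (\sw_(b, u <- t0) b \ot tsnoc u a)).
  by swt.
by [].
Qed.

(* A^{[](n+1)} [] A, the right C-coaction of the first factor being expressed
   through its B-coaction. *)
Definition snocable n : linsub (tens (tpow A n) A) :=
  cotensor (cotpow A n) (lfull A) (push_r (tpow_coact A n) alpha) cr_l.

Lemma snocable_l n w : snocable n w -> tensl (cotpow A n) w.
Proof. by move=> /cotensor_l[]. Qed.

Lemma snocableE n Z (F : tpow A n -> C -> A -> Z) w : snocable n w -> trilin F ->
  \sw_(t, a <- w) \sw_(t0, t1 <- tpow_coact A n t) F t0 (alpha t1) a =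
  \sw_(t, a <- w) \sw_(a0, a1 <- coact a) F t (beta a1) a0.
Proof.
move=> /cotensor_l[_ e] Ft; have {}e := eq_tens3 F e.
transitivity (\sw_(t, a <- w) \sw_(c, a0 <- cr_l a) F t c a0); last first.
  by apply: eq_sw => t a; apply: cr_lE; lin.
by etransitivity; [|etransitivity; [exact: e|nrm]]; symmetry; nrm.
Qed.

Lemma snocable_slice n V (t : tens V (tens (tpow A n) A)) :
  tensr (tensl (cotpow A n)) t ->
  \sw_(v, x <- t) \sw_(y, a <- x) \sw_(y0, y1 <- tpow_coact A n y)
    v \ot y0 \ot alpha y1 \ot a =
  \sw_(v, x <- t) \sw_(y, a <- x) \sw_(a0, a1 <- coact a)
    v \ot y \ot beta a1 \ot a0 ->
  tensr (snocable n) t.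
Proof.
move=> tP e; apply: tensr_cotensor_l => //.
etransitivity; [nrm|]; etransitivity; [exact: e|symmetry].
nrm2; apply: eq_sw => v x; apply: eq_sw => y a.
by apply: (cr_lE (F := fun c a0 => v \ot y \ot c \ot a0)); lin.
Qed.

Lemma snocable_BB n w : snocable n w ->
  tensr (BB B) (\sw_(t, a <- w) \sw_(t0, t1 <- tpow_coact A n t)
    \sw_(a0, a1 <- coact a) (t0 \ot a0) \ot (t1 \ot a1)).
Proof.
move=> Sw; apply: (cotensor_BB (comodule_on_cotpow n) (comodule_on_ring A)
  (snocable_l Sw) (tensr_full _)).
by apply: (snocableE (F := fun t c a => t \ot c \ot a) Sw); lin.
Qed.

(** [tpow_coact] brackets the components to the right, while an appended letter multiplies them from
    the right end. The induction on [n] shifts one pair of brackets per level. *)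
Lemma snocP n w : snocable n w ->
  cotpow A n.+1 (\sw_(t, a <- w) tsnoc t a) /\
  tpow_coact A n.+1 (\sw_(t, a <- w) tsnoc t a) =
  \sw_(t, a <- w) \sw_(t0, t1 <- tpow_coact A n t) \sw_(a0, a1 <- coact a)
    tsnoc t0 a0 \ot papp mu t1 a1.
Proof.
elim: n w => [|n IH] w Sw.
  split; last first.
    transitivity (tpow_coact A 1 (\sw_(t, a <- w) (t : A) \ot a)); first by [].
    transitivity (\sw_(t, a <- w) \sw_(t0, t1 <- tpow_coact A 0 t)
      \sw_(a0, a1 <- coact a) ((t0 : A) \ot a0) \ot papp mu t1 a1); last by [].
    by nrm.
  apply: cot_ringI; first exact: tensr_full.
  rewrite pure_sw; etransitivity.
    by apply: (snocableE (F := fun t c a => t \ot c \ot a) Sw); lin.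
  by apply: eq_sw => t a; symmetry; apply: (cr_lE (F := fun c a => t \ot c \ot a)); lin.
have tb := tsnoc_bilin n; have Pw := snocable_l Sw.
(* Rebracketing: the first letter is split off, so that the induction hypothesis applies to the
   shorter word together with the appended letter. *)
pose w' : tens A (tens (tpow A n) A) :=
  \sw_(x, a <- w) \sw_(b, t <- (x : tens A (tpow A n))) b \ot t \ot a.
have wE : \sw_(x, a <- w) tsnoc x a = \sw_(b, u <- w') b \ot \sw_(t, a <- u) tsnoc t a.
  by rewrite /w'; symmetry; nrm.
have w'P : tensr (tensl (cotpow A n)) w'.
  apply: (lset_sw_tensl Pw) => [|x a Px]; first by lin.
  apply: (lset_sw_tensr (cot_ring_r Px)) => [|b t Pt]; first by lin.
  by apply: tensr_pure; apply: tensl_pure.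
(* By [coact2_alpha] the right $C$-coaction of a long word is that of its tail, so the tail and the
   new letter inherit the balancing. *)
have w'S : tensr (snocable n) w'.
  apply: snocable_slice => //; rewrite /w'.
  have e := snocableE (n := n.+1) (F := fun (x : tens A (tpow A n)) c a => \sw_(b, t <- x) b \ot t \ot c \ot a) Sw _.
  etransitivity; [|etransitivity; [apply: e; lin|]]; last by symmetry; swt.
  etransitivity; [nrm|].
  apply: (sw_tensl Pw); [lin|lin|] => x a Px; symmetry.
  etransitivity.
    by apply: (coact2_alpha (comodule_on_cotpow n) (F := fun (x : tens A (tpow A n)) c => \sw_(b, t <- x) b \ot t \ot c \ot a) Px); lin.
  by nrm.
have wA : \sw_(b, u <- w') \sw_(t, a <- u) \sw_(b0, b1 <- coact b)
    b0 \ot alpha b1 \ot t \ot a =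
    \sw_(b, u <- w') \sw_(t, a <- u) \sw_(t0, t1 <- tpow_coact A n t)
    b \ot beta t1 \ot t0 \ot a.
  rewrite /w'; nrm2.
  apply: (sw_tensl Pw); [lin|lin|] => x a Px.
  by apply: (cot_ringBE (comodule_on_cotpow n) (F := fun b c t => b \ot c \ot t \ot a) Px); lin.
rewrite wE; split.
  apply: cot_ringI.
    apply: (lset_sw_tensr w'S) => [|b u Su]; first by lin.
    by apply: tensr_pure; have [] := IH u Su.
  have {}wA := eq_tens3 (fun b c u => \sw_(t, a <- u) b \ot c \ot tsnoc t a) wA.
  etransitivity; [|etransitivity; [exact: wA|]]; first by symmetry; swt.
  nrm2.
  transitivity (\sw_(b, u <- w') \sw_(t, a <- u) \sw_(c, t0 <- tpow_l A n t)
    b \ot c \ot tsnoc t0 a).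
    apply: (sw_tensr w'P); [lin|lin|] => b u Pu.
    apply: (sw_tensl Pu); [lin|lin|] => t a Pt; symmetry.
    by apply: (conLE (comodule_on_cotpow n) (F := fun c t => b \ot c \ot tsnoc t a) Pt); lin.
  apply: eq_sw => b u; apply: eq_sw => t a.
  symmetry; via (congr_sw (fun c y => b \ot c \ot y) (tpow_l_tsnoc t a)).
transitivity (\sw_(b, u <- w') \sw_(b0, b1 <- coact b)
  \sw_(z0, z1 <- tpow_coact A n.+1 (\sw_(t, a <- u) tsnoc t a))
  (b0 \ot z0) \ot papp mu b1 z1); first by symmetry; nrm2; reflexivity.
transitivity (\sw_(b, u <- w') \sw_(b0, b1 <- coact b) \sw_(t, a <- u)
  \sw_(t0, t1 <- tpow_coact A n t) \sw_(a0, a1 <- coact a)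
  (b0 \ot tsnoc t0 a0) \ot papp mu b1 (papp mu t1 a1)).
  apply: (sw_tensr w'S); [lin|lin|] => b u Su; apply: eq_sw => b0 b1.
  by have [_ ->] := IH u Su; nrm.
have wB := cotensor_BBB (comodule_on_ring A) (comodule_on_cotpow n)
  (rZ := @coact _ _ _ A) (S := snocable n) (w := w').
have {}wB := wB (fun u Su => conj (snocable_l Su) (snocable_BB Su)) (tensl_full _) w'S wA.
pose F := fun (v : tens A (tens (tpow A n) A)) (w : tens B (tens B B)) =>
  \sw_(b0, z <- v) \sw_(t0, a0 <- z) \sw_(p, u <- w) \sw_(q, s <- u)
  (b0 \ot tsnoc t0 a0) \ot papp mu p (papp mu q s).
pose G := fun (v : tens A (tens (tpow A n) A)) (w : tens B (tens B B)) =>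
  \sw_(b0, z <- v) \sw_(t0, a0 <- z) \sw_(p, u <- w) \sw_(q, s <- u)
  (b0 \ot tsnoc t0 a0) \ot papp mu (papp mu p q) s.
have := sw_tensr (f := F) (g := G) wB; rewrite /F /G => e.
transitivity (\sw_(t, a <- w) \sw_(t0, t1 <- tpow_coact A n.+1 t)
  \sw_(a0, a1 <- coact a) (\sw_(b, u <- t0) b \ot tsnoc u a0) \ot papp mu t1 a1);
  last by [].
etransitivity; [|etransitivity; [apply: e; [lin|lin|]|]]; first by swt.
  move=> v z Bz; apply: eq_sw => b0 y; apply: eq_sw => t0 a0; symmetry.
  by apply: (muAE (F := fun p => (b0 \ot tsnoc t0 a0) \ot p)) => //; lin.
by rewrite /w'; swt.
Qed.

End Tower.

Arguments comodule_on_cotpow {K C B} A n.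

(** * The cyclic operator *)

Section Rotation.
Variables (K : fieldType) (C : coalgebra K) (B : hopf_coalgebra C).
Variables (M : rlmodule B) (A : comodule_ring B).
Hypotheses (M_ayd : anti_yetter_drinfeld M) (M_stable : stable M).
Implicit Types (V Y Z : lmodType K).

(** Stability identifies the right $C$-coaction of [M] with the one obtained from [lam] through
    [beta]; hence flipping carries [MB M] into [BcopM M], the domain of the anti-Yetter-Drinfeld
    formula. *)
Lemma aydE Z (F : B -> M -> Z) (x : tens M B) : MB M x -> bilin F ->
  \sw_(m, b <- x) sw (lam (papp rm_act m b)) F =
  \sw_(m, b <- x) \sw_(b1, b2 <- cDelta b) \sw_(m1, m0 <- lam m)
    \sw_(nm, np <- nuinv B (b2 \ot m1)) F (papp mu np b1) (papp rm_act m0 nm).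
Proof.
move=> Mx Fb; have Bx : BcopM M (flip x).
  apply/cotensor_full; have e := eq_tens3 (fun m c b => b \ot c \ot m) ((MBE x).1 Mx).
  symmetry; etransitivity; [|etransitivity; [exact: e|]]; last by symmetry; swt.
  nrm2; apply: eq_sw => m b; symmetry.
  by apply: (rm_coactE M_stable (F := fun m c => b \ot c \ot m)); lin.
have [y yx e] := M_ayd.2 _ Bx; rewrite flipK in yx.
transitivity (sw (lam (sw x (papp rm_act))) F); first by symmetry; nrm.
by rewrite (sw_papp _ (esym yx)) e; swt.
Qed.

Lemma CtildeP n z : Ctilde M A n z -> tensl (cotpow A n) z.
Proof. by move=> /cotensor_l[]. Qed.

Lemma CtildeE n Z (F : tpow A n -> B -> M -> Z) z : Ctilde M A n z -> trilin F ->
  \sw_(x, m <- z) \sw_(x0, x1 <- tpow_coact A n x) F x0 x1 m =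
  \sw_(x, m <- z) \sw_(b, m0 <- lam m) F x b m0.
Proof.
move=> /cotensor_l[_ e] Ft; have {}e := eq_tens3 F e.
by etransitivity; [|etransitivity; [exact: e|nrm]]; symmetry; nrm.
Qed.

(** Apply [beta] to the balancing over [B]. The resulting condition links the first letter to the
    module and thereby closes the word into a cycle. *)
Lemma Ctilde_coactE n Z (F : tpow A n -> C -> M -> Z) z :
  Ctilde M A n z -> trilin F ->
  \sw_(x, m <- z) \sw_(c, x0 <- tpow_l A n x) F x0 c m =
  \sw_(x, m <- z) \sw_(m0, c <- rm_coact m) F x c m0.
Proof.
move=> Xz Ft.
transitivity (\sw_(x, m <- z) \sw_(x0, x1 <- tpow_coact A n x) F x0 (beta x1) m).
  apply: (sw_tensl (CtildeP Xz)); [lin|lin|] => x m Px.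
  by apply: (conLE (comodule_on_cotpow A n) (F := fun c x => F x c m) Px); lin.
lhs (CtildeE (F := fun x b m => F x (beta b) m) Xz _).
apply: eq_sw => x m; symmetry.
by apply: (rm_coactE M_stable (F := fun m c => F x c m)); lin.
Qed.

Lemma CtildeI n z : tensl (cotpow A n) z ->
  \sw_(x, m <- z) \sw_(x0, x1 <- tpow_coact A n x) x0 \ot x1 \ot m =
  \sw_(x, m <- z) \sw_(b, m0 <- lam m) x \ot b \ot m0 ->
  Ctilde M A n z.
Proof. by move=> zP e; apply/cotensor_l; split. Qed.

Lemma Ctilde_colinear n n' (f : tpow A n -> tpow A n') z :
  colinear_on (cotpow A n) (tpow_coact A n) (cotpow A n') (tpow_coact A n') f ->
  Ctilde M A n z -> Ctilde M A n' (\sw_(x, m <- z) f x \ot m).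
Proof.
move=> ff Xz; have [fl fP] := ff; have Pz := CtildeP Xz; apply: CtildeI.
  apply: (lset_sw_tensl Pz) => [|x m Px]; first by lin.
  by apply: tensl_pure; have [] := fP x Px.
transitivity (\sw_(x, m <- z) \sw_(x0, x1 <- tpow_coact A n x) f x0 \ot x1 \ot m).
  transitivity (\sw_(x, m <- z) \sw_(x0, x1 <- tpow_coact A n' (f x)) x0 \ot x1 \ot m).
    by etransitivity; [apply: sw_sw; lin|]; apply: eq_sw => x m; rewrite sw_pure //; lin.
  apply: (sw_tensl Pz); [lin|lin|] => x m Px.
  by apply: (colinearE (F := fun x b => x \ot b \ot m) ff Px); lin.
lhs (CtildeE (F := fun x b m => f x \ot b \ot m) Xz _).
by symmetry; nrm.
Qed.

(** In degree 0 the balancing replaces the coaction component of the letter by that of $m$, and the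
    formula becomes stability. *)
Lemma tau0E z : Ctilde M A 0 z -> tau_formula (n := 0) z = z.
Proof.
move=> Xz; rewrite /tau_formula.
lhs (CtildeE (F := fun (x : tpow A 0) b m => x \ot papp rm_act m b) Xz _).
rewrite -[RHS]pure_sw; apply: eq_sw => x m.
by apply: (stableE M_stable (F := fun m => x \ot m)); lin.
Qed.

Section Successor.
Variables (n : nat) (z : tens (tpow A n.+1) M).
Hypothesis Xz : Ctilde M A n.+1 z.

Lemma Ctilde_MB :
  tensr (MB M) (\sw_(x, m <- z) \sw_(a, t <- x) \sw_(a0, a1 <- coact a)
    (t \ot a0) \ot (m \ot a1)).
Proof.
apply: MB_slice; nrm2; symmetry.
have e := Ctilde_coactE (n := n.+1) (F := fun (x : tens A (tpow A n)) c m =>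
  \sw_(a, t <- x) \sw_(a0, a1 <- coact a) (t \ot a0) \ot m \ot c \ot a1) Xz _.
etransitivity; [|etransitivity; [apply: e; lin|]]; last by swt.
transitivity (\sw_(x, m <- z) \sw_(a, t <- x) \sw_(c, a' <- cr_l a)
  \sw_(a0, a1 <- coact a') (t \ot a0) \ot m \ot c \ot a1); last by symmetry; swt.
apply: eq_sw => x m; apply: eq_sw => a t; symmetry.
rewrite (cr_lE (F := fun c a' => \sw_(a0, a1 <- coact a') (t \ot a0) \ot m \ot c \ot a1));
  last by lin.
by apply: (rcoassocE (F := fun a0 b1 b2 => (t \ot a0) \ot m \ot beta b2 \ot b1) a (coactP A)); lin.
Qed.

Lemma Ctilde_snocable :
  tensr (snocable A n) (\sw_(x, m <- z) \sw_(a, t <- x) \sw_(a0, a1 <- coact a)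
    papp rm_act m a1 \ot t \ot a0).
Proof.
have Pz : tensl (cotpow A n.+1) z := CtildeP Xz.
apply: snocable_slice.
  apply: (lset_sw_tensl Pz) => [|x m Px]; first by lin.
  apply: (lset_sw_tensr (cot_ring_r Px)) => [|a t Pt]; first by lin.
  by apply: lset_sw => a0 a1; apply: tensr_pure; apply: tensl_pure.
nrm2.
(* Replaces the $C$-component of the tail by that of the whole word, the form in which [CtildeE] can
   exchange it for $\alpha(m_{[-1]})$. *)
transitivity (\sw_(x, m <- z) \sw_(x0, x1 <- coact2 (tpow_coact A n) x)
  \sw_(a, t <- x0) \sw_(a0, a1 <- coact a) papp rm_act m a1 \ot t \ot alpha x1 \ot a0).
  apply: (sw_tensl Pz); [lin|lin|] => x m Px; symmetry.
  have e := coact2_alpha (comodule_on_cotpow A n) (F := fun (x : tens A (tpow A n)) c =>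
    \sw_(a, t <- x) \sw_(a0, a1 <- coact a) papp rm_act m a1 \ot t \ot c \ot a0) Px.
  by via (e _).
have e := CtildeE (n := n.+1) (F := fun (x : tens A (tpow A n)) b m => \sw_(a, t <- x)
  \sw_(a0, a1 <- coact a) papp rm_act m a1 \ot t \ot alpha b \ot a0) Xz _.
etransitivity; [apply: e; lin|]; cbn beta.
have := sw_tensr Ctilde_MB
  (f := fun v w => \sw_(t, a0 <- v) \sw_(m, b <- w) \sw_(b', m0 <- lam m)
    papp rm_act m0 b \ot t \ot alpha b' \ot a0)
  (g := fun v w => \sw_(t, a0 <- v) \sw_(m, b <- w) \sw_(b1, b2 <- cDelta b)
    papp rm_act m b2 \ot t \ot beta b1 \ot a0) => {}e.
etransitivity; [|etransitivity; [apply: e; [lin|lin|]|]]; first by swt.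
  move=> v w Mw; apply: eq_sw => t a0.
  by apply: (lam_actE M_stable (F := fun c m => m \ot t \ot c \ot a0)) => //; lin.
etransitivity; [nrm|]; apply: eq_sw => x m; apply: eq_sw => a t; symmetry.
by apply: (rcoassocE (F := fun a0 b1 b2 => papp rm_act m b2 \ot t \ot beta b1 \ot a0) a (coactP A)); lin.
Qed.

Lemma tau_formulaE : tau_formula z = \sw_(m, u <-
    \sw_(x, m <- z) \sw_(a, t <- x) \sw_(a0, a1 <- coact a)
      papp rm_act m a1 \ot t \ot a0) (\sw_(t, a <- u) tsnoc t a) \ot m.
Proof.
have tb := tsnoc_bilin A n; symmetry; etransitivity; [nrm|].
by [].
Qed.

Lemma nuinv_slice V (t : tens V (tens B B)) Z (F : V -> tens B B -> Z) :
  tensr (BB B) t -> bilin F ->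
  \sw_(v, w <- t) F v (nuinv B (nu w)) = \sw_(v, w <- t) F v w.
Proof.
move=> tB Fb; apply: (sw_tensr tB) => [||v w Bw]; [lin|lin|].
by rewrite nuinvK.
Qed.

(* After m_{-1} (x) m_0 is traded for the coaction of a (x) t, the argument of
   nu^{-1} in the anti-Yetter-Drinfeld formula becomes nu(a_2 (x) t_1). *)
Lemma Ctilde_tauS : Ctilde M A n.+1 (tau_formula z).
Proof.
have Pz : tensl (cotpow A n.+1) z := CtildeP Xz.
have tb := tsnoc_bilin A n.
rewrite tau_formulaE; set w := sw z _.
have Sw : tensr (snocable A n) w := Ctilde_snocable.
apply: CtildeI.
  apply: (lset_sw_tensr Sw) => [|m u Su]; first by lin.
  by apply: tensl_pure; have [] := snocP Su.
transitivity (\sw_(m, u <- w) \sw_(t, a <- u) \sw_(t0, t1 <- tpow_coact A n t)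
  \sw_(a0, a1 <- coact a) tsnoc t0 a0 \ot papp mu t1 a1 \ot m).
  etransitivity; [apply: sw_sw; lin|].
  apply: (sw_tensr Sw); [lin|lin|] => m u Su.
  rewrite sw_pure; last by lin.
  by have [_ ->] := snocP Su; nrm.
(* The spectator is the rotated word; the anti-Yetter-Drinfeld formula is applied to $m\otimes
   a_{0[1]}$. *)
have := sw_tensr Ctilde_MB
  (f := fun v w => \sw_(t, a0 <- v) \sw_(m, b <- w) \sw_(p, q <- lam (papp rm_act m b))
    tsnoc t a0 \ot p \ot q)
  (g := fun v w => \sw_(t, a0 <- v) \sw_(m, b <- w)
    \sw_(b1, b2 <- cDelta b) \sw_(m1, m0 <- lam m)
    \sw_(nm, np <- nuinv B (b2 \ot m1)) tsnoc t a0 \ot papp mu np b1 \ot papp rm_act m0 nm) => e.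
symmetry; etransitivity; [|etransitivity; [apply: e; [lin|lin|]|]]; first by rewrite /w; swt.
  move=> v y My; apply: eq_sw => t a0.
  by apply: (aydE (F := fun b m => tsnoc t a0 \ot b \ot m) My); lin.
(* The balancing is read from the module to the word: $m_{[-1]}$ becomes the product of the coaction
   components of all letters. *)
have {}e := CtildeE (n := n.+1) (F := fun (x : tens A (tpow A n)) b m => \sw_(a, t <- x)
  \sw_(a0, a1 <- coact a) \sw_(b1, b2 <- cDelta a1)
  \sw_(nm, np <- nuinv B (b2 \ot b)) tsnoc t a0 \ot papp mu np b1 \ot papp rm_act m nm) Xz _.
etransitivity; [|etransitivity; [symmetry; apply: e; lin|]]; first by swt.
transitivity (\sw_(x, m <- z) \sw_(a, t <- x) \sw_(t0, t1 <- tpow_coact A n t)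
  \sw_(a0, a1 <- coact a) \sw_(d1, d2 <- cDelta a1)
  tsnoc t0 a0 \ot papp mu t1 d1 \ot papp rm_act m d2); last first.
  rewrite /w; symmetry; etransitivity; [nrm|].
  apply: eq_sw => x m; apply: eq_sw => a t.
  via (rcoassocE (F := fun a0 d1 d2 => \sw_(t0, t1 <- tpow_coact A n t)
    tsnoc t0 a0 \ot papp mu t1 d1 \ot papp rm_act m d2) a (coactP A) _).
apply: (sw_tensl Pz); [lin|lin|] => x m Px.
(* The pair isolated in [BB B] consists of the last component of $a$ and the component of the tail;
   [nu] of this pair is what [nuinv] receives, so the two cancel. *)
pose y := \sw_(a, t <- x) \sw_(a0, a1 <- coact a) \sw_(t0, t1 <- tpow_coact A n t)
  \sw_(a00, a01 <- coact a0) ((t0 \ot a00) \ot a01) \ot (a1 \ot t1).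
have yB : tensr (BB B) y.
  have -> : y = \sw_(v, u <- \sw_(a, t <- x) \sw_(a0, a1 <- coact a)
      \sw_(t0, t1 <- tpow_coact A n t) (a0 \ot t0) \ot (a1 \ot t1))
    \sw_(a0, t0 <- v) \sw_(a00, a01 <- coact a0) ((t0 \ot a00) \ot a01) \ot u.
    by rewrite /y; swt.
  apply: (lset_sw_tensr (cot_ring_BB (comodule_on_cotpow A n) Px)) => [|v u Bu]; first by lin.
  by apply: lset_sw => a0 t0; apply: lset_sw => a00 a01; apply: tensr_pure.
pose G := fun (v : tens (tens (tpow A n) A) B) (u : tens B B) => \sw_(q, d1 <- v) \sw_(t0, a0 <- q)
  \sw_(nm, np <- u) tsnoc t0 a0 \ot papp mu np d1 \ot papp rm_act m nm.
have Gb : bilin G by rewrite /G; lin.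
have := nuinv_slice yB Gb; rewrite /G /y => {}e.
etransitivity; [|etransitivity; [exact: e|]]; last first.
  etransitivity; [nrm|]; apply: eq_sw => a t.
  via (rcoassocE (F := fun a0 d1 d2 => \sw_(t0, t1 <- tpow_coact A n t)
    tsnoc t0 a0 \ot papp mu t1 d1 \ot papp rm_act m d2) a (coactP A) _).
(* The arguments [u v w s] are the four parts of $a$ under three coactions or coproducts. The
   remaining steps compare bracketings of this splitting by coassociativity. *)
pose Phi t (u : A) (v w s : B) := \sw_(t0, t1 <- tpow_coact A n t)
  \sw_(nm, np <- nuinv B (w \ot papp mu s t1))
    tsnoc t0 u \ot papp mu np v \ot papp rm_act m nm.
transitivity (\sw_(a, t <- x) \sw_(a0, a1 <- coact a) \sw_(d1, d2 <- cDelta a1)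
  \sw_(b1, b2 <- cDelta d1) Phi t a0 b1 b2 d2); rewrite /Phi.
  transitivity (\sw_(a, t <- x) \sw_(a0, a1 <- coact a) \sw_(a00, a01 <- coact a0)
    \sw_(b1, b2 <- cDelta a01) Phi t a00 b1 b2 a1); rewrite /Phi; first by swt.
  apply: eq_sw => a t.
  by apply: (rcoassocE (F := fun a0 d1 d2 => \sw_(b1, b2 <- cDelta d1)
    Phi t a0 b1 b2 d2) a (coactP A)); rewrite /Phi; lin.
transitivity (\sw_(a, t <- x) \sw_(a0, a1 <- coact a) \sw_(d1, d2 <- cDelta a1)
  \sw_(b1, b2 <- cDelta d2) Phi t a0 d1 b1 b2); rewrite /Phi.
  apply: eq_sw => a t; apply: eq_sw => a0 a1.
  by apply: (coassocE (F := fun u v w => Phi t a0 u v w)); rewrite /Phi; lin.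
transitivity (\sw_(a, t <- x) \sw_(a0, a1 <- coact a) \sw_(a00, a01 <- coact a0)
  \sw_(b1, b2 <- cDelta a1) Phi t a00 a01 b1 b2); rewrite /Phi; last by swt.
apply: eq_sw => a t; symmetry.
by apply: (rcoassocE (F := fun a0 d1 d2 => \sw_(b1, b2 <- cDelta d2)
  Phi t a0 d1 b1 b2) a (coactP A)); rewrite /Phi; lin.
Qed.

End Successor.
End Rotation.

(** * Pure words as initial windows of streams *)

Section Streams.
Variables (K : fieldType) (A : lmodType K).
Implicit Types (u v : nat -> A).

(** Representing a word by a stream makes rotation an operation on indices, with no type depending
    on the length. *)
Fixpoint win n u : tpow A n :=
  match n return tpow A n with
  | 0 => u 0%N
  | n'.+1 => u 0%N \ot win n' (fun k => u k.+1)
  end.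

Definition scons (a : A) u : nat -> A := fun k => if k is k'.+1 then u k' else a.
Definition supd u n (a : A) : nat -> A := fun k => if k == n then a else u k.

Lemma win_ext n u v : (forall k, (k <= n)%N -> u k = v k) -> win n u = win n v.
Proof.
elim: n u v => [|n IH] u v e /=; first exact: e.
by rewrite (e 0%N) // (IH _ (fun k => v k.+1)) // => k kn; apply: e.
Qed.

Lemma linear_win_ext n (Z : lmodType K) (f g : tpow A n -> Z) :
  linear f -> linear g -> (forall u, f (win n u) = g (win n u)) -> f =1 g.
Proof.
elim: n f g => [|n IH] f g fl gl e x; first exact: (e (fun=> x)).
rewrite -(pure_sw (x : tens A (tpow A n))) (linear_fun_sw _ _ fl) (linear_fun_sw _ _ gl).
apply: eq_sw => a t; apply: (IH (fun t => f (a \ot t)) (fun t => g (a \ot t))); [lin|lin|].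
by move=> u; exact: (e (scons a u)).
Qed.

End Streams.

(** * The order of the cyclic operator *)

Section CyclicOrder.
Variables (K : fieldType) (C : coalgebra K) (B : hopf_coalgebra C).
Variables (M : rlmodule B) (A : comodule_ring B).
Implicit Types (V Y Z : lmodType K) (u : nat -> A) (m : M).

Lemma tau_linear n : linear (@tau_formula _ _ _ M A n).
Proof.
case: n => [|n]; rewrite /tau_formula; first by lin.
by have tb := tsnoc_bilin A n; lin.
Qed.

Lemma tsnoc_win n u a : tsnoc (win n u) a = win n.+1 (supd u n.+1 a).
Proof.
elim: n u => [|n IH] u //.
transitivity (u 0%N \ot tsnoc (win n (fun k => u k.+1)) a).
  have tb := tsnoc_bilin A n.
  by transitivity (\sw_(b, t <- u 0%N \ot win n (fun k => u k.+1)) b \ot tsnoc t a);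
    [|nrm].
by rewrite IH.
Qed.

Lemma tau_win n u m : tau_formula (win n u \ot m) =
  \sw_(a0, a1 <- coact (u 0%N))
    win n (supd (fun k => u k.+1) n a0) \ot papp rm_act m a1.
Proof.
case: n => [|n].
  by transitivity (\sw_(a, m <- u 0%N \ot m) \sw_(a0, a1 <- coact a)
    a0 \ot papp rm_act m a1); [|nrm].
have tb := tsnoc_bilin A n.
transitivity (\sw_(x, m <- (u 0%N \ot win n (fun k => u k.+1)) \ot m)
  \sw_(a, t <- x) \sw_(a0, a1 <- coact a) tsnoc t a0 \ot papp rm_act m a1) => //.
by etransitivity; [nrm|]; apply: eq_sw => a0 a1; rewrite tsnoc_win.
Qed.

(* The action of the coaction components of u 0, ..., u (k - 1) on m, the
   stream of the degree zero components being handed over to f. *)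
Fixpoint act_stream k Z u m (f : (nat -> A) -> M -> Z) : Z :=
  if k is k'.+1 then
    \sw_(a0, a1 <- coact (u 0%N))
      act_stream k' (fun j => u j.+1) (papp rm_act m a1) (fun v => f (scons a0 v))
  else f u m.

Lemma eq_act_stream k Z u m (f g : (nat -> A) -> M -> Z) :
  (forall v m, f v m = g v m) -> act_stream k u m f = act_stream k u m g.
Proof.
elim: k u m f g => [|k IH] u m f g e //=.
by apply: eq_sw => a0 a1; apply: IH => v m'; apply: e.
Qed.

Lemma act_stream_app k Z Y u m (f : (nat -> A) -> M -> Z) (g : Z -> Y) : linear g ->
  g (act_stream k u m f) = act_stream k u m (fun v m => g (f v m)).
Proof.
move=> gl; elim: k u m f => [|k IH] u m f //=.
by rewrite (linear_fun_sw _ _ gl); apply: eq_sw => a0 a1; exact: IH.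
Qed.

Lemma act_stream_supd k n Z u m a (f : (nat -> A) -> M -> Z) : (k <= n)%N ->
  act_stream k (supd u n a) m f = act_stream k u m (fun v => f (supd v n a)).
Proof.
elim: k n u m f => [|k IH] [|n] u m f //= kn.
apply: eq_sw => a0 a1.
etransitivity; first exact: (IH n (fun j => u j.+1) _ (fun v => f (scons a0 v)) kn).
apply: eq_act_stream => v m'.
by congr f; apply/funext => -[|j].
Qed.

(** For [j <= n] and [k <= n.+1] the index is [j + k] reduced modulo [n.+1]; a single subtraction
    suffices. *)
Definition srot n k u : nat -> A :=
  fun j => if (j + k <= n)%N then u (j + k)%N else u (j + k - n.+1)%N.

(** A formal identity on pure words of the ambient space: each step records one action on [m] and
    moves one letter to the end. *)
Lemma iter_tau_win n k u m : (k <= n.+1)%N ->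
  iter k (@tau_formula _ _ _ M A n) (win n u \ot m) =
  act_stream k u m (fun v m => win n (srot n k v) \ot m).
Proof.
have tl := @tau_linear n.
have il k' : linear (iter k' (@tau_formula _ _ _ M A n)).
  by elim: k' => [|k' IH] a x y //; rewrite !iterS IH tl.
elim: k u m => [|k IH] u m kn.
  by congr (_ \ot _); apply: win_ext => j jn; rewrite /srot addn0 jn.
rewrite iterSr tau_win (linear_fun_sw _ _ (il k)); apply: eq_sw => a0 a1.
rewrite IH; last by lia.
(* The letter just written at position [n] is not read by the remaining [k <= n] steps, so writing
   it may be postponed. *)
rewrite act_stream_supd; last by lia.
apply: eq_act_stream => v m'; congr (_ \ot _); apply: win_ext => j jn.
rewrite /srot /supd; case: (ltngtP (j + k) n) => h.
- have -> : (j + k.+1 <= n)%N = true by lia.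
  by rewrite addnS.
- have -> : (j + k.+1 <= n)%N = false by lia.
  have -> : (j + k.+1 - n.+1 = (j + k - n.+1).+1)%N by lia.
  by case: eqP => // e; exfalso; lia.
- have -> : (j + k.+1 <= n)%N = false by lia.
  by have -> : (j + k.+1 - n.+1 = 0)%N by lia.
Qed.

(** The value of the full iterate of the cyclic operator: the letters act on [m] one after another.
    [ractE] merges these actions where the products make sense. *)
Fixpoint ract n : tpow A n -> M -> tens (tpow A n) M :=
  match n return tpow A n -> M -> tens (tpow A n) M with
  | 0 => fun a m => \sw_(a0, a1 <- coact a) a0 \ot papp rm_act m a1
  | n'.+1 => fun x m => \sw_(a, t <- x) \sw_(a0, a1 <- coact a)
      \sw_(t0, m' <- ract t (papp rm_act m a1)) (a0 \ot t0) \ot m'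
  end.

Lemma ract_bilin n : bilin (@ract n).
Proof.
elim: n => [|n IH].
  have h : bilin (fun (a : A) (m : M) =>
    \sw_(a0, a1 <- coact a) a0 \ot papp rm_act m a1) by lin.
  exact: h.
have h : bilin (fun (x : tpow A n.+1) (m : M) => \sw_(a, t <- x) \sw_(a0, a1 <- coact a)
  \sw_(t0, m' <- ract t (papp rm_act m a1)) (a0 \ot t0) \ot m') by lin.
exact: h.
Qed.

Lemma ract_win n u m :
  act_stream n.+1 u m (fun v m => win n v \ot m) = ract (win n u) m.
Proof.
elim: n u m => [|n IH] u m //.
have rb := ract_bilin n.
transitivity (\sw_(a, t <- u 0%N \ot win n (fun k => u k.+1)) \sw_(a0, a1 <- coact a)
  \sw_(t0, m' <- ract t (papp rm_act m a1)) (a0 \ot t0) \ot m') => //.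
symmetry; etransitivity; [nrm|].
transitivity (\sw_(a0, a1 <- coact (u 0%N))
  act_stream n.+1 (fun k => u k.+1) (papp rm_act m a1)
    (fun v m' => (a0 \ot win n v) \ot m')) => //.
apply: eq_sw => a0 a1; rewrite -IH.
have gl : linear (fun z : tens (tpow A n) M => \sw_(t0, m' <- z) (a0 \ot t0) \ot m') by lin.
rewrite (act_stream_app _ _ _ _ gl); apply: eq_act_stream => v m'; nrm.
Qed.

Definition cot_act n : linsub (tens M (tpow A n)) :=
  cotensor (lfull M) (cotpow A n) (@rm_coact _ _ _ M) (tpow_l A n).

Lemma cot_actE n Z (F : M -> C -> tpow A n -> Z) y : cot_act n y -> trilin F ->
  \sw_(m, x <- y) \sw_(m0, c <- rm_coact m) F m0 c x =
  \sw_(m, x <- y) \sw_(c, x0 <- tpow_l A n x) F m c x0.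
Proof.
move=> /cotensor_r[_ e] Ft; have {}e := eq_tens3 F e.
by etransitivity; [|etransitivity; [exact: e|nrm]]; symmetry; nrm.
Qed.

(** After the first letter has acted, the module element and the tail are again balanced, so the
    induction hypothesis applies to them; associativity of the action then joins the first action to
    the product of the others. *)
Lemma ractE n y : cot_act n y ->
  \sw_(m, x <- y) ract x m =
  \sw_(m, x <- y) \sw_(x0, x1 <- tpow_coact A n x) x0 \ot papp rm_act m x1.
Proof.
elim: n y => [|n IH] y Cy //.
have rb := ract_bilin n; have Py : tensr (cotpow A n.+1) y by case/cotensor_r: Cy.
have CE Z (F : M -> C -> tens A (tpow A n) -> Z) : trilin F ->
    \sw_(m, x <- y) \sw_(m0, c <- rm_coact m) F m0 c x =
    \sw_(m, x <- y) \sw_(a, t <- x) \sw_(a0, a1 <- coact a) F m (beta a1) (a0 \ot t).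
  move=> Ft; lhs (cot_actE (n := n.+1) (F := F) Cy Ft).
  etransitivity; [nrm|]; apply: eq_sw => m x; apply: eq_sw => a t.
  by apply: (cr_lE (F := fun c a0 => F m c (a0 \ot t))); lin.
have Sy : tensr (MB M) (\sw_(m, x <- y) \sw_(a, t <- x) \sw_(a0, a1 <- coact a)
    (a0 \ot t) \ot (m \ot a1)).
  apply: MB_slice; nrm2.
  have e := CE _ (fun m c x => \sw_(a, t <- x) \sw_(a0, a1 <- coact a)
    (a0 \ot t) \ot m \ot c \ot a1).
  etransitivity; [|etransitivity; [apply: e; lin|]]; first by swt.
  etransitivity; [nrm|]; apply: eq_sw => m x; apply: eq_sw => a t.
  by apply: (rcoassocE (F := fun a0 b1 b2 => (a0 \ot t) \ot m \ot beta b2 \ot b1)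
    a (coactP A)); lin.
pose y' := \sw_(m, x <- y) \sw_(a, t <- x) \sw_(a0, a1 <- coact a)
  a0 \ot papp rm_act m a1 \ot t.
(* Colinearity of the action makes the $C$-component of $m\triangleleft a_{[1]}$ equal to $\alpha$
   of a component of $a$, which the cotensor condition of the word passes to the tail. *)
have y'C : tensr (cot_act n) y'.
  apply: tensr_cotensor.
    apply: (lset_sw_tensr Py) => [|m x Px]; first by lin.
    apply: (lset_sw_tensr (cot_ring_r Px)) => [|a t Pt]; first by lin.
    by apply: lset_sw => a0 a1; do 2!apply: tensr_pure.
  transitivity (\sw_(m, x <- y) \sw_(a, t <- x) \sw_(a0, a1 <- coact a)
      \sw_(b1, b2 <- cDelta a1) a0 \ot papp rm_act m b1 \ot alpha b2 \ot t).
    have e := sw_tensr Sy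
      (f := fun v w => \sw_(a0, t <- v) \sw_(m, b <- w)
        \sw_(m0, c <- rm_coact (papp rm_act m b)) a0 \ot m0 \ot c \ot t)
      (g := fun v w => \sw_(a0, t <- v) \sw_(m, b <- w)
        \sw_(b1, b2 <- cDelta b) a0 \ot papp rm_act m b1 \ot alpha b2 \ot t).
    etransitivity; [|etransitivity; [apply: e; [lin|lin|]|]]; last by swt.
      by rewrite /y'; swt.
    move=> v w Mw; apply: eq_sw => a0 t.
    by apply: (act_colinE (F := fun m c => a0 \ot m \ot c \ot t) Mw); lin.
  transitivity (\sw_(m, x <- y) \sw_(a, t <- x) \sw_(c, t0 <- tpow_l A n t)
      \sw_(a0, a1 <- coact a) a0 \ot papp rm_act m a1 \ot c \ot t0).
    apply: (sw_tensr Py); [lin|lin|] => m x Px.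
    have e := cot_ringE Px (F := fun a c t => \sw_(a0, a1 <- coact a)
      a0 \ot papp rm_act m a1 \ot c \ot t).
    etransitivity; [|etransitivity; [apply: e; lin|]]; last by swt.
    apply: eq_sw => a t; symmetry.
    by apply: (rcoassocE (F := fun a0 b1 b2 => a0 \ot papp rm_act m b1 \ot alpha b2 \ot t)
      a (coactP A)); lin.
  by rewrite /y'; symmetry; swt.
transitivity (\sw_(a0, w <- y') \sw_(q, m' <- \sw_(m, t <- w) ract t m) (a0 \ot q) \ot m').
  transitivity (\sw_(m, x <- y) \sw_(a, t <- x) \sw_(a0, a1 <- coact a)
    \sw_(t0, m' <- ract t (papp rm_act m a1)) (a0 \ot t0) \ot m') => //.
  by rewrite /y'; symmetry; nrm.
transitivity (\sw_(a0, w <- y') \sw_(q, m' <- \sw_(m, t <- w)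
    \sw_(t0, t1 <- tpow_coact A n t) t0 \ot papp rm_act m t1) (a0 \ot q) \ot m').
  apply: (sw_tensr y'C); [lin|lin|] => a0 w Cw.
  by rewrite IH.
(* The degree zero letters are the spectator here; $m$ and the two [B]-components form the triple
   for associativity of the action. *)
pose y2 := \sw_(m, x <- y) \sw_(a, t <- x) \sw_(a0, a1 <- coact a)
  \sw_(t0, t1 <- tpow_coact A n t) (a0 \ot t0) \ot m \ot a1 \ot t1.
have y2M : tensr (MBB M) y2.
  apply: MBB_slice.
    have -> : (\sw_(v, z <- y2) \sw_(m, w <- z) (v \ot m) \ot w) = \sw_(m, x <- y)
        \sw_(v, w <- \sw_(a, t <- x) \sw_(a0, a1 <- coact a)
          \sw_(t0, t1 <- tpow_coact A n t) (a0 \ot t0) \ot (a1 \ot t1))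
        (v \ot m) \ot w.
      by rewrite /y2; swt.
    apply: (lset_sw_tensr Py) => [|m x Px]; first by lin.
    apply: (lset_sw_tensr (cot_ring_BB (comodule_on_cotpow A n) Px)); first by lin.
    by move=> v w Bw; exact: tensr_pure.
  have e := CE _ (fun m c x => \sw_(a, t <- x) \sw_(a0, a1 <- coact a)
    \sw_(t0, t1 <- tpow_coact A n t) (a0 \ot t0) \ot m \ot c \ot a1 \ot t1).
  rewrite /y2; etransitivity; [|etransitivity; [apply: e; lin|]]; first by swt.
  nrm2; apply: eq_sw => m x; apply: eq_sw => a t.
  via (rcoassocE (F := fun a0 b1 b2 => \sw_(t0, t1 <- tpow_coact A n t)
    (a0 \ot t0) \ot m \ot beta b2 \ot b1 \ot t1) a (coactP A) _).
have e := sw_tensr y2M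
  (f := fun v w => \sw_(m, z <- w) \sw_(b, b' <- z)
    v \ot papp rm_act (papp rm_act m b) b')
  (g := fun v w => \sw_(m, z <- w) \sw_(b, b' <- z)
    v \ot papp rm_act m (papp mu b b')).
etransitivity; [|etransitivity; [apply: e; [lin|lin|]|]].
- by rewrite /y2 /y'; swt.
- by move=> v w Mw; apply: (actAE (F := fun m => v \ot m) Mw); lin.
- by rewrite /y2; swt.
Qed.

Lemma tau_order n z : anti_yetter_drinfeld M -> stable M -> Ctilde M A n z ->
  iter n.+1 (@tau_formula _ _ _ M A n) z = z.
Proof.
move=> M_ayd M_stable Xz; have rb := ract_bilin n.
have tl := @tau_linear n.
have il k : linear (iter k (@tau_formula _ _ _ M A n)).
  by elim: k => [|k IH] a x y //; rewrite !iterS IH tl.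
transitivity (\sw_(x, m <- z) ract x m).
  rewrite -[in LHS](pure_sw z) (linear_fun_sw _ _ (il _)); apply: eq_sw => x m.
  have pl : linear (fun x => iter n.+1 (@tau_formula _ _ _ M A n) (x \ot m)).
    by apply: linear_comp (il _) _; lin.
  have rl : linear (fun x : tpow A n => ract x m) by lin.
  (* Both members are linear on the entire ambient space and agree there without cotensor
     conditions, so pure words suffice. *)
  apply: (linear_win_ext pl rl) => u.
  rewrite iter_tau_win // -ract_win; apply: eq_act_stream => v m'.
  congr (_ \ot _); apply: win_ext => k kn; rewrite /srot.
  have -> : (k + n.+1 <= n)%N = false by lia.
  by congr v; lia.
(* The cyclic closure [Ctilde_coactE] is the balancing needed on the other side of the word. *)
have Cz : cot_act n (flip z).
  apply/cotensor_r; split; first by apply/tensl_flip; exact: (CtildeP Xz).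
  have e := Ctilde_coactE M_stable (F := fun x c m => m \ot c \ot x) Xz.
  symmetry; etransitivity; [|etransitivity; [apply: e; lin|]]; last by symmetry; swt.
  by swt.
have e := ractE Cz.
etransitivity; [|etransitivity; [exact: e|]]; first by symmetry; nrm.
have {}e := CtildeE (F := fun x b m => x \ot papp rm_act m b) Xz.
etransitivity; [|etransitivity; [apply: e; lin|]]; first by swt.
rewrite -[RHS]pure_sw; apply: eq_sw => x m.
by apply: (stableE M_stable (F := fun m => x \ot m)); lin.
Qed.

End CyclicOrder.

(** * Cocyclic relations *)

Section Simplicial.
Variables (K : fieldType) (C : coalgebra K) (B : hopf_coalgebra C).
Variable (A : comodule_ring B).
Implicit Types (V Y Z : lmodType K).

(** The left $C$-coaction is induced from the [B]-coaction by [beta], so [B]-colinearity carries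
    over to it. *)
Lemma colinear_lE Y (P : linsub Y) r (l : {linear Y -> tens C Y})
    Y' (P' : linsub Y') r' (l' : {linear Y' -> tens C Y'}) f Z (F : C -> Y' -> Z) y :
  comodule_on (B := B) P r l -> comodule_on P' r' l' -> colinear_on P r P' r' f ->
  P y -> bilin F -> sw (l' (f y)) F = \sw_(c, y0 <- l y) F c (f y0).
Proof.
move=> rP rP' ff Py Fb; have [fl fP] := ff; have [Py' _] := fP y Py.
rewrite (conLE rP' Py' Fb) (conLE rP (F := fun c y => F c (f y)) Py); last by lin.
by apply: (colinearE (F := fun y b => F (beta b) y) ff Py); lin.
Qed.

(** Reduces relations with the zeroth coface to colinearity: the inserted unit depends on the word
    only through its left $C$-coaction. *)
Lemma insert0_colinear n n' (f : tpow A n -> tpow A n') x :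
  colinear_on (cotpow A n) (tpow_coact A n) (cotpow A n') (tpow_coact A n') f ->
  cotpow A n x ->
  insert_one 0 (f x) = \sw_(c, x0 <- tpow_l A n x) cr_one c \ot f x0.
Proof.
move=> ff Px; rewrite insert_one0.
by apply: (colinear_lE (comodule_on_cotpow A n) (comodule_on_cotpow A n')
  (F := fun c y => (cr_one c : A) \ot y) ff Px); lin.
Qed.

Lemma insert_insert n i j (x : tpow A n) : (i <= j <= n)%N -> cotpow A n x ->
  insert_one j.+1 (insert_one i x) = insert_one i (insert_one j x).
Proof.
have il := @insert_linear _ _ _ A.
elim: n i j x => [|n IH] [|i] [|j] x // ij Px.
- rewrite (insert0_colinear (colinear_insert A 0 0) Px).
  rewrite [insert_one 0 x]insert_one0; have i0 := @il 0%N 0%N.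
  transitivity (\sw_(a, t <- \sw_(c, x0 <- tpow_l A 0 x) (cr_one c : A) \ot x0)
    a \ot insert_one 0 t) => //.
  by nrm.
- rewrite (insert0_colinear (colinear_insert A n.+1 0) Px).
  rewrite [insert_one 0 x]insert_one0; have i0 := @il n.+1 0%N.
  transitivity (\sw_(a, t <- \sw_(c, x0 <- tpow_l A n.+1 x) (cr_one c : A) \ot x0)
    a \ot insert_one 0 t) => //.
  by swt.
- rewrite (insert0_colinear (colinear_insert A n.+1 j.+1) Px).
  rewrite [insert_one 0 x]insert_one0; have i0 := @il n.+1 j.+1.
  transitivity (\sw_(a, t <- \sw_(c, x0 <- tpow_l A n.+1 x) (cr_one c : A) \ot x0)
    a \ot insert_one j.+1 t) => //.
  by swt.
have i1 := @il n i; have i2 := @il n j; have i3 := @il n.+1 j.+1; have i4 := @il n.+1 i.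
transitivity (\sw_(a, t <- \sw_(a, t <- x) a \ot insert_one i t) a \ot insert_one j.+1 t) => //.
transitivity (\sw_(a, t <- \sw_(a, t <- x) a \ot insert_one j t) a \ot insert_one i t) => //.
nrm2; apply: (sw_tensr (cot_ring_r Px)); [lin|lin|] => a t Pt.
by rewrite IH.
Qed.

Lemma merge_mulA n (x : tpow A n.+2) : cotpow A n.+2 x ->
  merge 0 (merge 0 x) = merge 0 (merge 1 x).
Proof.
case: n x => [|n] x Px.
  transitivity (\sw_(a, y <- x) \sw_(b, c <- y) papp cr_mul (papp cr_mul a b) c).
    transitivity (\sw_(p, q <- \sw_(a, y <- x) \sw_(b, c <- y) papp cr_mul a b \ot c)
      papp cr_mul p q) => //.
    by nrm.
  transitivity (\sw_(p, q <- \sw_(a, y <- x) a \ot \sw_(b, c <- y) papp cr_mul b c)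
      papp cr_mul p q) => //.
  etransitivity; first by apply: (mulAE (F := fun a => a) Px); lin.
  by symmetry; nrm.
have [Px1 e] := (cotensor_r _ _ _ _).1 Px.
(* The tail [u] goes to the front as spectator so that the first three letters can be placed in the
   threefold cotensor power of [A], where [cr_mulA] holds. *)
pose t := \sw_(a, z <- x) \sw_(b, w <- z) \sw_(c, u <- w) u \ot a \ot b \ot c.
have tA : tensr (cot_ring A (cot_ring A (lfull A) cr_l) (lcoact1 cr_l)) t.
  apply: tensr_cotensor.
    apply: tensr_assoc.
    have -> : (\sw_(v, z <- t) \sw_(a, y <- z) (v \ot a) \ot y) = \sw_(a, z <- x)
        \sw_(u, y <- \sw_(b, w <- z) \sw_(c, u <- w) u \ot b \ot c) (u \ot a) \ot y.
      by rewrite /t; swt.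
    apply: (lset_sw_tensr Px1) => [|a z Pz]; first by lin.
    apply: (lset_sw_tensr (cot_ring2_slice Pz)) => [|u y Ay]; first by lin.
    exact: tensr_pure.
  have {}e := eq_tens3 (fun a c z => \sw_(b, w <- z) \sw_(c', u <- w)
    u \ot a \ot c \ot b \ot c') e.
  by rewrite /t; etransitivity; [|etransitivity; [exact: e|]]; swt.
transitivity (\sw_(u, y <- t) \sw_(a, z <- y) \sw_(b, c <- z)
  papp cr_mul (papp cr_mul a b) c \ot u).
  transitivity (\sw_(p, q <- \sw_(a, z <- x) \sw_(b, w <- z) papp cr_mul a b \ot w)
    \sw_(c, u <- q) papp cr_mul p c \ot u) => //.
  by rewrite /t; swt.
transitivity (\sw_(u, y <- t) \sw_(a, z <- y) \sw_(b, c <- z)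
  papp cr_mul a (papp cr_mul b c) \ot u).
  apply: (sw_tensr tA); [lin|lin|] => u y Ay.
  by apply: (mulAE (F := fun a => a \ot u) Ay); lin.
transitivity (\sw_(p, q <- \sw_(a, z <- x) a \ot \sw_(b, w <- z) \sw_(c, u <- w)
  papp cr_mul b c \ot u) \sw_(c, u <- q) papp cr_mul p c \ot u) => //.
by rewrite /t; swt.
Qed.

Lemma merge_merge n i j (x : tpow A n.+2) : (i <= j <= n)%N -> cotpow A n.+2 x ->
  merge j (merge i x) = merge i (merge j.+1 x).
Proof.
have ml := @merge_linear _ _ _ A.
elim: n i j x => [|n IH] [|i] [|j] x // ij Px; try exact: merge_mulA.
- have m1 := @ml n j.
  transitivity (\sw_(a, t <- \sw_(a, z <- x) \sw_(b, w <- z) papp cr_mul a b \ot w)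
    a \ot merge j t) => //.
  transitivity (\sw_(a, t <- \sw_(a, z <- x) a \ot \sw_(b, w <- z) b \ot merge j w)
    \sw_(b, w <- t) papp cr_mul a b \ot w) => //.
  by swt.
have m1 := @ml n i; have m2 := @ml n j; have m3 := @ml n.+1 i; have m4 := @ml n.+1 j.+1.
transitivity (\sw_(a, t <- \sw_(a, t <- x) a \ot merge (n := n.+1) i t) a \ot merge (n := n) j t) => //.
transitivity (\sw_(a, t <- \sw_(a, t <- x) a \ot merge (n := n.+1) j.+1 t) a \ot merge (n := n) i t) => //.
nrm2; apply: (sw_tensr (cot_ring_r Px)); [lin|lin|] => a t Pt.
by rewrite IH.
Qed.

Lemma merge_insert_lt n i j (x : tpow A n.+1) : (i <= j <= n)%N -> cotpow A n.+1 x ->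
  merge j.+1 (insert_one i x) = insert_one i (merge j x).
Proof.
have ml := @merge_linear _ _ _ A; have il := @insert_linear _ _ _ A.
have base m k (y : tpow A m.+1) : cotpow A m.+1 y ->
    merge k.+1 (insert_one 0 y) = insert_one 0 (merge k y).
  move=> Py; rewrite (insert0_colinear (colinear_merge A m k) Py) [insert_one 0 y]insert_one0.
  have m0 := @ml m k.
  transitivity (\sw_(a, t <- \sw_(c, x0 <- tpow_l A m.+1 y) (cr_one c : A) \ot x0)
    a \ot merge k t) => //.
  by swt.
elim: n i j x => [|n IH] [|i] [|j] x ij Px; try (by exfalso; lia);
  [exact: (base 0%N 0%N) | exact: (base n.+1 0%N) | exact: (base n.+1 j.+1) | ].
have m1 := @ml n j; have m2 := @ml n.+1 j.+1; have i1 := @il n i; have i2 := @il n.+1 i.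
transitivity (\sw_(a, t <- \sw_(a, t <- x) a \ot insert_one (n := n.+1) i t) a \ot merge (n := n.+1) j.+1 t) => //.
transitivity (\sw_(a, t <- \sw_(a, t <- x) a \ot merge (n := n) j t) a \ot insert_one (n := n) i t) => //.
nrm2; apply: (sw_tensr (cot_ring_r Px)); [lin|lin|] => a t Pt.
by rewrite IH.
Qed.

Lemma merge_insert_id n j (x : tpow A n) : (j <= n)%N -> merge j (insert_one j x) = x.
Proof.
elim: n j x => [|n IH] [|j] x // jn.
- rewrite -[RHS](cr_mul1r (x : A)).
  transitivity (\sw_(a, b <- \sw_(c, a0 <- cr_l (x : A)) cr_one c \ot a0) papp cr_mul a b) => //.
  by nrm.
- transitivity (\sw_(a, y <- \sw_(a, t <- x) \sw_(c, a0 <- cr_l a) cr_one c \ot a0 \ot t)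
    \sw_(b, u <- y) papp cr_mul a b \ot u) => //.
  rewrite -[RHS](pure_sw (x : tens A (tpow A n))); etransitivity; [nrm|].
  apply: eq_sw => a t; rewrite -[in RHS](cr_mul1r a); symmetry; nrm.
have ml := @merge_linear _ _ _ A n j.
transitivity (\sw_(a, y <- \sw_(a, t <- x) a \ot insert_one (n := n) j t) a \ot merge (n := n) j y) => //.
rewrite -[RHS](pure_sw (x : tens A (tpow A n))); etransitivity; [nrm|].
by apply: eq_sw => a t; rewrite IH.
Qed.

(** The unit comes from the left coaction of the letter after it; the cotensor condition rewrites it
    through the right coaction of the letter before it, where the right unit law applies. Position
    [n] is excluded because no letter follows it. *)
Lemma merge_insert_idS n j (x : tpow A n) : (j < n)%N -> cotpow A n x ->
  merge j (insert_one j.+1 x) = x.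
Proof.
elim: n j x => [|n IH] [|j] x // jn Px.
  transitivity (\sw_(a, y <- \sw_(a, t <- x) a \ot insert_one 0 t)
    \sw_(b, u <- y) papp cr_mul a b \ot u) => //.
  transitivity (\sw_(a, y <- \sw_(a, t <- x) a \ot
    \sw_(c, t0 <- tpow_l A n t) (cr_one c : A) \ot t0)
    \sw_(b, u <- y) papp cr_mul a b \ot u).
    congr sw; apply: eq_sw => a t; congr (_ \ot _); exact: insert_one0.
  have [_ e] := (cotensor_r _ _ _ _).1 Px.
  have {}e := eq_tens3 (fun a c t => papp cr_mul a (cr_one c) \ot t) e.
  symmetry; etransitivity; [|etransitivity; [exact: e|]]; last by symmetry; swt.
  rewrite -[LHS](pure_sw (x : tens A (tpow A n))); symmetry; etransitivity; [nrm|].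
  by apply: eq_sw => a t; apply: (mul1E (F := fun a => a \ot t)); lin.
have ml := @merge_linear _ _ _ A n j; have il := @insert_linear _ _ _ A n j.+1.
transitivity (\sw_(a, y <- \sw_(a, t <- x) a \ot insert_one (n := n) j.+1 t) a \ot merge (n := n) j y) => //.
rewrite -[RHS](pure_sw (x : tens A (tpow A n))); etransitivity; [nrm|].
apply: (sw_tensr (cot_ring_r Px)); [lin|exact: pure_bilin|] => a t Pt.
by rewrite IH.
Qed.

Lemma merge_insert_gt n i j (x : tpow A n.+1) : (j < i <= n)%N ->
  merge j (insert_one i.+1 x) = insert_one i (merge j x).
Proof.
have ml := @merge_linear _ _ _ A; have il := @insert_linear _ _ _ A.
elim: n i j x => [|n IH] [|i] [|j] x ij; try (by exfalso; lia).
  have i1 := @il n i.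
  transitivity (\sw_(a, z <- \sw_(a, z <- x) a \ot \sw_(b, u <- z) b \ot insert_one i u)
    \sw_(b, u <- z) papp cr_mul a b \ot u) => //.
  transitivity (\sw_(a, t <- \sw_(a, z <- x) \sw_(b, u <- z) papp cr_mul a b \ot u)
    a \ot insert_one i t) => //.
  by swt.
have m1 := @ml n j; have m2 := @ml n.+1 j; have i1 := @il n i; have i2 := @il n.+1 i.+1.
transitivity (\sw_(a, t <- \sw_(a, t <- x) a \ot insert_one (n := n.+1) i.+1 t) a \ot merge (n := n.+1) j t) => //.
transitivity (\sw_(a, t <- \sw_(a, t <- x) a \ot merge (n := n) j t) a \ot insert_one (n := n) i t) => //.
by nrm2; apply: eq_sw => a t; rewrite IH.
Qed.

Lemma tsnoc_insert n i (t : tpow A n) a : (i <= n)%N ->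
  tsnoc (insert_one i t) a = insert_one i (tsnoc t a).
Proof.
elim: n i t => [|n IH] [|i] t // ni.
- transitivity (\sw_(b, u <- \sw_(c, a0 <- cr_l (t : A)) (cr_one c : A) \ot a0) b \ot u \ot a) => //.
  transitivity (\sw_(b, u <- (t : A) \ot a) \sw_(c, a0 <- cr_l b) (cr_one c : A) \ot a0 \ot u) => //.
  by swt.
- have tb := tsnoc_bilin A n.
  transitivity (\sw_(b, u <- \sw_(b, u <- t) \sw_(c, a0 <- cr_l b) (cr_one c : A) \ot a0 \ot u)
    b \ot \sw_(b', u' <- u) b' \ot tsnoc u' a) => //.
  transitivity (\sw_(b, u <- \sw_(b, u <- t) b \ot tsnoc u a)
    \sw_(c, a0 <- cr_l b) (cr_one c : A) \ot a0 \ot u) => //.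
  by swt.
have tb := tsnoc_bilin A n; have tb1 := tsnoc_bilin A n.+1.
have il := @insert_linear _ _ _ A n i; have il1 := @insert_linear _ _ _ A n.+1 i.
transitivity (\sw_(b, u <- \sw_(b, u <- t) b \ot insert_one (n := n) i u) b \ot tsnoc (n := n.+1) u a) => //.
transitivity (\sw_(b, u <- \sw_(b, u <- t) b \ot tsnoc (n := n) u a) b \ot insert_one (n := n.+1) i u) => //.
by nrm2; apply: eq_sw => b u; rewrite IH.
Qed.

Lemma tsnoc_merge n i (t : tpow A n.+1) a : (i <= n)%N ->
  tsnoc (merge i t) a = merge i (tsnoc t a).
Proof.
elim: n i t => [|n IH] [|i] t // ni.
- transitivity ((\sw_(b, c <- t) papp cr_mul b c) \ot a) => //.
  transitivity (\sw_(b, u <- \sw_(b, c <- t) b \ot c \ot a)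
    \sw_(c, a' <- u) papp cr_mul b c \ot a') => //.
  by swt.
- have tb := tsnoc_bilin A n.
  transitivity (\sw_(b, u <- \sw_(b, z <- t) \sw_(c, u <- z) papp cr_mul b c \ot u)
    b \ot tsnoc u a) => //.
  transitivity (\sw_(b, z <- \sw_(b, z <- t) b \ot \sw_(c, u <- z) c \ot tsnoc u a)
    \sw_(c, u <- z) papp cr_mul b c \ot u) => //.
  by swt.
have tb := tsnoc_bilin A n; have tb1 := tsnoc_bilin A n.+1.
have ml := @merge_linear _ _ _ A n i; have ml1 := @merge_linear _ _ _ A n.+1 i.
transitivity (\sw_(b, u <- \sw_(b, u <- t) b \ot merge (n := n) i u) b \ot tsnoc (n := n) u a) => //.
transitivity (\sw_(b, u <- \sw_(b, u <- t) b \ot tsnoc (n := n.+1) u a) b \ot merge (n := n.+1) i u) => //.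
by nrm2; apply: eq_sw => b u; rewrite IH.
Qed.

End Simplicial.

(** * All cocyclic relations from the inner ones and the order of rotation *)

Section CocyclicCriterion.
Variables (K : fieldType) (X : nat -> lmodType K).
Variable (d : forall n, nat -> {linear X n -> X n.+1}).
Variable (s : forall n, nat -> {linear X n.+1 -> X n}).
Variable (t : forall n, {linear X n -> X n}).
Hypothesis last_coface : forall n x, d n n.+1 x = t n.+1 (d n 0%N x).
Hypothesis dd : forall n i j x, (i <= j <= n)%N ->
  d n.+1 j.+1 (d n i x) = d n.+1 i (d n j x).
Hypothesis ss : forall n i j x, (i <= j <= n)%N ->
  s n j (s n.+1 i x) = s n i (s n.+1 j.+1 x).
Hypothesis sd_lt : forall n i j x, (i <= j <= n)%N ->
  s n.+1 j.+1 (d n.+1 i x) = d n i (s n j x).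
Hypothesis sd_id : forall n j x, (j <= n)%N -> s n j (d n j x) = x.
Hypothesis sd_idS : forall n j x, (j < n)%N -> s n j (d n j.+1 x) = x.
Hypothesis sd_gt : forall n i j x, (j < i <= n)%N ->
  s n.+1 j (d n.+1 i.+1 x) = d n i (s n j x).
Hypothesis td : forall n i x, (i < n)%N -> t n.+1 (d n i.+1 x) = d n i (t n x).
Hypothesis ts : forall n i x, (i < n)%N -> t n (s n i.+1 x) = s n i (t n.+1 x).
Hypothesis tt : forall n x, iter n.+1 (t n) x = x.

Let iter_td n k i x : (i + k <= n)%N ->
  iter k (t n.+1) (d n (i + k) x) = d n i (iter k (t n) x).
Proof.
elim: k x => [|k IH] x ik; first by rewrite addn0.
by rewrite iterSr addnS td ?IH -?iterSr //; lia.
Qed.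

Let iter_ts n k i x : (i + k <= n)%N ->
  iter k (t n) (s n (i + k) x) = s n i (iter k (t n.+1) x).
Proof.
elim: k x => [|k IH] x ik; first by rewrite addn0.
by rewrite iterSr addnS ts ?IH -?iterSr //; lia.
Qed.

(* As t has order n + 1, the relations of t with the outer operators follow
   from those with the inner ones. *)
Let td_le n i x : (i <= n)%N -> t n.+1 (d n i.+1 x) = d n i (t n x).
Proof.
rewrite leq_eqVlt => /orP[/eqP->|]; last exact: td.
rewrite last_coface -[RHS]tt 2!iterS; do 2!congr (t n.+1 _).
have -> : iter n (t n.+1) (d n n (t n x)) = d n 0%N (iter n (t n) (t n x)).
  exact: (@iter_td n n 0%N _ (leqnn n)).
by rewrite -iterSr tt.
Qed.

(** Write the right member as [t] to the power [n.+1] applied to itself. The power [n] moves [s n n]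
    to [s n 0], and the powers of [t n.+1] inside add up to [n.+2], its order. *)
Let ts0 n x : t n (s n 0%N x) = s n n (t n.+1 (t n.+1 x)).
Proof.
rewrite -[RHS]tt iterS; congr (t n _).
have -> y : iter n (t n) (s n n y) = s n 0%N (iter n (t n.+1) y).
  exact: (@iter_ts n n 0%N _ (leqnn n)).
by rewrite -!iterSr tt.
Qed.

(** Only [j = n.+1] is new: expanding the last coface as [t] after the zeroth one and pulling every
    [t] outwards leaves a relation between inner cofaces. *)
Let dd_le n i j x : (i <= j <= n.+1)%N ->
  d n.+1 j.+1 (d n i x) = d n.+1 i (d n j x).
Proof.
move=> /andP[ij]; rewrite leq_eqVlt => /orP[/eqP jn|jn]; last by apply: dd; lia.
subst j; rewrite last_coface; move: ij; rewrite leq_eqVlt => /orP[/eqP->|ij].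
  by rewrite [d n n.+1 x]last_coface -!td_le // last_coface dd.
by rewrite -dd; [rewrite td_le -?last_coface //; lia | lia].
Qed.

Let sd_gt_le n i j x : (j < i <= n.+1)%N ->
  s n.+1 j (d n.+1 i.+1 x) = d n i (s n j x).
Proof.
move=> /andP[ji]; rewrite leq_eqVlt => /orP[/eqP e|jn]; last by apply: sd_gt; lia.
subst i; rewrite !last_coface -ts; last by lia.
by rewrite sd_lt //; lia.
Qed.

(** With $x=t\,y$ one gets $s_nd_{n+1}t\,y=s_nt\,t\,d_1y=t\,s_0d_1y$, and $s_0d_1=1$ is an inner
    relation because [0 < n]. *)
Let sd_idS_gt0 n x : (0 < n)%N -> s n n (d n n.+1 x) = x.
Proof.
move=> n0; rewrite -[x]tt iterS; set y := iter _ _ _.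
by rewrite last_coface -td_le // -ts0 sd_idS.
Qed.

Let sd_idS_le n j x : (j <= n)%N -> s n j (d n j.+1 x) = x.
Proof.
rewrite leq_eqVlt => /orP[/eqP->|]; last exact: sd_idS.
case: n x => [|n] x; last exact: sd_idS_gt0.
(* In degree 0 no inner coface is available. Writing $x=s_0d_0x$ and commuting $d_1$ past $s_0$
   raises the identity to degree 1, where it is already proved. *)
by rewrite -[x](sd_id (j := 0%N)) // -sd_gt_le // ss // sd_idS_gt0.
Qed.

Lemma cocyclic_criterion : cocyclic X d s t.
Proof. by split; rewrite // => *; rewrite ?last_coface. Qed.

End CocyclicCriterion.

Lemma restrict_linear (K : fieldType) (V W : lmodType K) (U : linsub V) (U' : linsub W)
    (f : V -> W) : linear f -> (forall x, U x -> U' (f x)) ->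
  {g : {linear lsub U -> lsub U'} | forall x, val (g x) = f (val x)}.
Proof.
move=> fl fU.
pose g (x : lsub U) : lsub U' := exist _ (f (val x)) (asboolT (fU _ (lsubP x))).
have gl : linear g.
  move=> a x y; apply: val_inj.
  have -> : val (a *: g x + g y) = a *: f (val x) + f (val y) by rewrite linearP.
  by rewrite -fl -linearP.
pose gm := GRing.isLinear.Build _ _ _ _ g gl.
by exists (HB.pack g gm : {linear lsub U -> lsub U'}).
Qed.

(** * Restriction of the operators to the cotensor products *)

Section Operators.
Variables (K : fieldType) (C : coalgebra K) (B : hopf_coalgebra C).
Variables (M : rlmodule B) (A : comodule_ring B).
Hypotheses (M_ayd : anti_yetter_drinfeld M) (M_stable : stable M).

Lemma delta_linear n i : linear (@delta_formula _ _ _ M A n i).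
Proof. by have il := @insert_linear _ _ _ A n i; rewrite /delta_formula; lin. Qed.

Lemma sigma_linear n i : linear (@sigma_formula _ _ _ M A n i).
Proof. by have ml := @merge_linear _ _ _ A n i; rewrite /sigma_formula; lin. Qed.

Lemma Ctilde_delta n i z : Ctilde M A n z -> Ctilde M A n.+1 (delta_formula i z).
Proof. exact: (Ctilde_colinear (colinear_insert A n i)). Qed.

Lemma Ctilde_sigma n i z : Ctilde M A n.+1 z -> Ctilde M A n (sigma_formula i z).
Proof. exact: (Ctilde_colinear (colinear_merge A n i)). Qed.

Lemma Ctilde_tau n z : Ctilde M A n z -> Ctilde M A n (tau_formula z).
Proof.
by case: n z => [|n] z Xz; [rewrite tau0E | exact: Ctilde_tauS].
Qed.

Lemma tau_delta n i (z : tens (tpow A n) M) : (i < n)%N ->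
  tau_formula (delta_formula i.+1 z) = delta_formula i (tau_formula z).
Proof.
case: n z => [|n] z // ni.
have il := @insert_linear _ _ _ A n i; have il1 := @insert_linear _ _ _ A n.+1 i.
have tb := tsnoc_bilin A n; have tb1 := tsnoc_bilin A n.+1.
transitivity (\sw_(x, m <- \sw_(x, m <- z) (\sw_(a, t <- x) a \ot insert_one (n := n) i t) \ot m)
  \sw_(a, t <- x) \sw_(a0, a1 <- coact a) tsnoc (n := n.+1) t a0 \ot papp rm_act m a1) => //.
transitivity (\sw_(x, m <- \sw_(x, m <- z) \sw_(a, t <- x) \sw_(a0, a1 <- coact a)
  tsnoc (n := n) t a0 \ot papp rm_act m a1) insert_one (n := n.+1) i x \ot m) => //.
nrm2; do 3!apply: eq_sw => ? ?.
by rewrite tsnoc_insert.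
Qed.

Lemma tau_sigma n i (z : tens (tpow A n.+1) M) : (i < n)%N ->
  tau_formula (sigma_formula i.+1 z) = sigma_formula i (tau_formula z).
Proof.
case: n z => [|n] z // ni.
have ml := @merge_linear _ _ _ A n i; have ml1 := @merge_linear _ _ _ A n.+1 i.
have tb := tsnoc_bilin A n; have tb1 := tsnoc_bilin A n.+1.
transitivity (\sw_(x, m <- \sw_(x, m <- z) (\sw_(a, t <- x) a \ot merge (n := n) i t) \ot m)
  \sw_(a, t <- x) \sw_(a0, a1 <- coact a) tsnoc (n := n) t a0 \ot papp rm_act m a1) => //.
transitivity (\sw_(x, m <- \sw_(x, m <- z) \sw_(a, t <- x) \sw_(a0, a1 <- coact a)
  tsnoc (n := n.+1) t a0 \ot papp rm_act m a1) merge (n := n.+1) i x \ot m) => //.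
nrm2; do 3!apply: eq_sw => ? ?.
by rewrite tsnoc_merge.
Qed.

Lemma Ctilde_cocyclic :
  exists (delta : forall n, nat ->
            {linear lsub (Ctilde M A n) -> lsub (Ctilde M A n.+1)})
         (sigma : forall n, nat ->
            {linear lsub (Ctilde M A n.+1) -> lsub (Ctilde M A n)})
         (tau : forall n, {linear lsub (Ctilde M A n) -> lsub (Ctilde M A n)}),
  [/\ forall n i (x : lsub (Ctilde M A n)), (i <= n)%N ->
        sval (delta n i x) = delta_formula i (sval x),
      forall n i (x : lsub (Ctilde M A n.+1)), (i <= n)%N ->
        sval (sigma n i x) = sigma_formula i (sval x),
      forall n (x : lsub (Ctilde M A n)),
        sval (tau n x) = tau_formula (sval x),
      forall n (x : lsub (Ctilde M A n)),
        delta n n.+1 x = tau n.+1 (delta n 0%N x) &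
      cocyclic (fun n => lsub (Ctilde M A n)) delta sigma tau].
Proof.
pose X n : lmodType K := lsub (Ctilde M A n).
pose d' n i : {linear X n -> X n.+1} :=
  sval (restrict_linear (@delta_linear n i) (@Ctilde_delta n i)).
pose s n i : {linear X n.+1 -> X n} :=
  sval (restrict_linear (@sigma_linear n i) (@Ctilde_sigma n i)).
pose t n : {linear X n -> X n} :=
  sval (restrict_linear (@tau_linear _ _ _ M A n) (@Ctilde_tau n)).
(* The branch [i > n] is meant for [i = n.+1], the last coface; larger indices receive the same map
   as a default value. *)
pose d n i : {linear X n -> X n.+1} :=
  if (i <= n)%N then d' n i else (t n.+1 \o d' n 0%N : {linear X n -> X n.+1}).
have dE n i (x : X n) : (i <= n)%N -> val (d n i x) = delta_formula i (val x).
  by move=> ni; rewrite /d ni /d'; case: restrict_linear => g /= ->.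
have sE n i (x : X n.+1) : val (s n i x) = sigma_formula i (val x).
  by rewrite /s; case: restrict_linear => g /= ->.
have tE n (x : X n) : val (t n x) = tau_formula (val x).
  by rewrite /t; case: restrict_linear => g /= ->.
have lE n (x : X n) : d n n.+1 x = t n.+1 (d n 0%N x) by rewrite /d ltnn.
have XP n (x : X n) : tensl (cotpow A n) (val x) by exact: (CtildeP (lsubP x)).
exists d, s, t; split=> //; first by move=> n i x _; exact: sE.
(* Nine inner relations remain. Whenever the word must satisfy cotensor conditions, [XP] permits the
   identity on words to be used under the sum over [x]. *)
apply: cocyclic_criterion => //.
- move=> n i j x /andP[ij jn]; apply: val_inj.
  have il := @insert_linear _ _ _ A n i; have il1 := @insert_linear _ _ _ A n j.
  have il2 := @insert_linear _ _ _ A n.+1 j.+1; have il3 := @insert_linear _ _ _ A n.+1 i.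
  rewrite !dE; try lia; rewrite /delta_formula; nrm2.
  apply: (sw_tensl (XP n x)); [lin|lin|] => a m Pa.
  by rewrite insert_insert // ij.
- move=> n i j x /andP[ij jn]; apply: val_inj.
  have m1 := @merge_linear _ _ _ A n i; have m2 := @merge_linear _ _ _ A n j.
  have m3 := @merge_linear _ _ _ A n.+1 i; have m4 := @merge_linear _ _ _ A n.+1 j.+1.
  rewrite !sE /sigma_formula; nrm2.
  apply: (sw_tensl (XP n.+2 x)); [lin|lin|] => a m Pa.
  by rewrite merge_merge // ij.
- move=> n i j x /andP[ij jn]; apply: val_inj.
  have m1 := @merge_linear _ _ _ A n j; have m2 := @merge_linear _ _ _ A n.+1 j.+1.
  have i1 := @insert_linear _ _ _ A n i; have i2 := @insert_linear _ _ _ A n.+1 i.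
  rewrite sE !dE ?sE; try lia; rewrite /delta_formula /sigma_formula; nrm2.
  apply: (sw_tensl (XP n.+1 x)); [lin|lin|] => a m Pa.
  by rewrite merge_insert_lt // ij.
- move=> n j x jn; apply: val_inj.
  have m1 := @merge_linear _ _ _ A n j; have i1 := @insert_linear _ _ _ A n j.
  rewrite sE dE // /delta_formula /sigma_formula -[RHS]pure_sw.
  by etransitivity; [nrm|]; apply: eq_sw => a m; rewrite merge_insert_id.
- move=> n j x jn; apply: val_inj.
  have m1 := @merge_linear _ _ _ A n j; have i1 := @insert_linear _ _ _ A n j.+1.
  rewrite sE dE // /delta_formula /sigma_formula -[RHS]pure_sw.
  etransitivity; [nrm|].
  apply: (sw_tensl (XP n x)); [lin|exact: pure_bilin|] => a m Pa.
  by rewrite merge_insert_idS.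
- move=> n i j x /andP[ji ni]; apply: val_inj.
  have m1 := @merge_linear _ _ _ A n j; have m2 := @merge_linear _ _ _ A n.+1 j.
  have i1 := @insert_linear _ _ _ A n i; have i2 := @insert_linear _ _ _ A n.+1 i.+1.
  rewrite sE !dE ?sE; try lia; rewrite /delta_formula /sigma_formula; nrm2.
  by apply: eq_sw => a m; rewrite merge_insert_gt // ji.
- by move=> n i x ni; apply: val_inj; rewrite tE !dE ?tE ?tau_delta //; lia.
- by move=> n i x ni; apply: val_inj; rewrite tE !sE tE tau_sigma.
- move=> n x; apply: val_inj.
  have -> : forall k, val (iter k (t n) x) = iter k (@tau_formula _ _ _ M A n) (val x).
    by elim=> [|k IH] //=; rewrite tE IH.
  by apply: tau_order => //; exact: lsubP.
Qed.

End Operators.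

Theorem proposition3p3 (R : realType) (C : coalgebra R[i])
    (B : hopf_coalgebra C) (M : rlmodule B) (A : comodule_ring B)
    (M_ayd : anti_yetter_drinfeld M) (M_stable : stable M) :
  exists (delta : forall n, nat ->
            {linear lsub (Ctilde M A n) -> lsub (Ctilde M A n.+1)})
         (sigma : forall n, nat ->
            {linear lsub (Ctilde M A n.+1) -> lsub (Ctilde M A n)})
         (tau : forall n, {linear lsub (Ctilde M A n) -> lsub (Ctilde M A n)}),
  [/\ forall n i (x : lsub (Ctilde M A n)), (i <= n)%N ->
        sval (delta n i x) = delta_formula i (sval x),
      forall n i (x : lsub (Ctilde M A n.+1)), (i <= n)%N ->
        sval (sigma n i x) = sigma_formula i (sval x),
      forall n (x : lsub (Ctilde M A n)),
        sval (tau n x) = tau_formula (sval x),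
      forall n (x : lsub (Ctilde M A n)),
        delta n n.+1 x = tau n.+1 (delta n 0%N x) &
      cocyclic (fun n => lsub (Ctilde M A n)) delta sigma tau].
Proof. exact: (Ctilde_cocyclic A M_ayd M_stable). Qed.
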